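(* Suppose $C$ and $\Phi$ satisfy the standing assumptions (S1)–(S3) and the assumptions (A1), (A2), (A3) listed in the context, with constants $L,L',M,N_\Phi,\zeta$. Let $T>0$ and $h_1>0$ satisfy $$T^2+L(T^2+2h_1T)\le\frac{\zeta}{1+L}.$$ Let $v\sim\mathcal{N}(0,C)$ and $U\sim\mathrm{Unif}(0,1)$ be independent, and let $R$ be any real number with $\mathbb{P}[\|v\|_l>R]\le\frac{\zeta}{2000(L+1)}$. For $q\in\mathcal{H}^l$ let $q'(q,v,U)$ be the next position of adjusted pHMC, i.e. the position component of $\psi_h^{(T)}(q,v)$ if $U\le\alpha(q,v)$, and $q$ if $U>\alpha(q,v)$, with $\psi_h^{(T)}$ and $\alpha$ as defined in the context. Write $x'(x,v,U)=q'(x,v,U)$, $y'(y,v,U)=q'(y,v,U)$ (the same $v,U$ for both). Then there exists $h_0>0$ such that for every $0<h\le\min\{h_0,h_1\}$ with $T/h\in\mathbb{Z}$ and all $x,y\in\mathcal{H}^l$ with $\max\{\|x\|_l,\|y\|_l\}\le R$, $$\mathbb{E}\left[\|x'(x,v,U)-y'(y,v,U)\|_l\right]\le\left(1-\tfrac{1}{27}\zeta T^2\right)\|x-y\|_l ,$$ the expectation being over $v$ and $U$. Furthermore, for fixed $L,L',M$ and $C$, the dependence of $h_0^{-1}$ on $T$ and $R$ is of the form $\mathcal{O}\big((1+T^{-1/2})(1+R^2)\big)$.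
   Context: Spaces. $(\mathcal{H},\langle\cdot,\cdot\rangle)$ is a real separable infinite-dimensional Hilbert space with norm $\|\cdot\|$, $\pi_0=\mathcal{N}(0,C)$ a centred Gaussian measure on it with injective covariance operator $C$; $\{\phi_j\}_{j\ge1}$ is an orthonormal eigenbasis, $C\phi_j=\lambda_j^2\phi_j$, $\lambda_j>0$. For $s\in\mathbb{R}$, $\mathcal{H}^s$ is the Hilbert space obtained by completing the span of the $\phi_j$ with respect to $\langle f,g\rangle_s=\sum_{j\ge1} j^{2s}\langle f,\phi_j\rangle\langle g,\phi_j\rangle$, with norm $\|\cdot\|_s$; $\mathcal{H}^{-s}$ is identified with the dual of $\mathcal{H}^s$ via the extension of $\langle\cdot,\cdot\rangle$. $C$ and $C^{1/2}$ act diagonally on all these spaces. Standing assumptions. (S1) There is $\kappa>\frac12$ with $0<\liminf_j j^\kappa\lambda_j\le\limsup_j j^\kappa\lambda_j<\infty$. (S2) There is a fixed $l\in[0,\kappa-\frac12)$ such that $\Phi:\mathcal{H}^l\to\mathbb{R}$ is continuous and its Fréchet derivative $D\Phi:\mathcal{H}^l\to\mathcal{H}^{-l}$ is globally Lipschitz. (S3) For every $\epsilon>0$ there is $K(\epsilon)\in\mathbb{R}$ with $\Phi(q)\ge K(\epsilon)-\epsilon\|q\|_l^2$ for all $q\in\mathcal{H}^l$. Under (S1), $\pi_0(\mathcal{H}^l)=1$, and under (S1)–(S2), $C\,D\Phi$ maps $\mathcal{H}^l$ to $\mathcal{H}^l$ and $C^{1/2}D\Phi$ maps $\mathcal{H}^l$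 to $\mathcal{H}$. Further assumptions. (A1) $L>0$ and $L'\ge 0$ are constants such that for all $q,q'\in\mathcal{H}^l$: $\|D\Phi(q)-D\Phi(q')\|_{-l}\le L\|q-q'\|_l$, $\|C D\Phi(q)-C D\Phi(q')\|_l\le L\|q-q'\|_l$, $\|D\Phi(q)\|_{-l}\le L\|q\|_l+L'$, and $\|C D\Phi(q)\|_l\le L\|q\|_l+L'$. (A2) $\zeta>0$ is a constant with $\zeta\le L+1$ such that for all $x,y\in\mathcal{H}^l$: $\langle x-y,x-y\rangle_l+\langle C D\Phi(x)-C D\Phi(y),x-y\rangle_l\ge\zeta\|x-y\|_l^2$. (A3) $\Phi:\mathcal{H}^l\to\mathbb{R}$ is $C^4$, and there are constants $M,N_\Phi$ such that for all $x,y\in\mathcal{H}^l$: $\|D^2\Phi(x)-D^2\Phi(y)\|_{\mathcal{H}^l\to\mathcal{H}^{-l}}\le M\|x-y\|_l$ (i.e. $\|D^3\Phi\|\le M$), $\|C D^2\Phi(x)-C D^2\Phi(y)\|_{\mathcal{H}^l\to\mathcal{H}^{l}}\le M\|x-y\|_l$, and $\|D^4\Phi(x)\|\le N_\Phi$ (norm as a multilinear form on $\mathcal{H}^l$). Numerical flow. For $h>0$, $\psi_h(q,v)=(q^+,v^+)$ on $\mathcal{H}^l\times\mathcal{H}^l$ is $$q^+=\cos(h)q+\sin(h)v-\tfrac h2\sin(h)\,C D\Phi(q),$$ $$v^+=-\sin(h)q+\cos(h)v-\tfrac h2\cos(h)\,C D\Phi(q)-\tfrac h2\,C D\Phi(q^+),$$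 and $\psi_h^{(T)}=\psi_h^{T/h}$ is its $T/h$-fold composition. Acceptance probability. With $I=T/h$ and $(q_i,v_i)=\psi_h^i(q_0,v_0)$, $$\Delta H(q_0,v_0)=\Phi(q_I)-\Phi(q_0)+\tfrac{h^2}{8}\big(\|C^{1/2}D\Phi(q_0)\|^2-\|C^{1/2}D\Phi(q_I)\|^2\big)-h\sum_{i=1}^{I-1}\langle D\Phi(q_i),v_i\rangle-\tfrac h2\big(\langle D\Phi(q_0),v_0\rangle+\langle D\Phi(q_I),v_I\rangle\big),$$ where $\langle D\Phi(q),v\rangle$ is the dual pairing, and $\alpha(q,v)=\min\{1,\exp(-\Delta H(q,v))\}$. *)

(* Defs.v *)
From HB Require Import structures.
From mathcomp Require Import all_boot all_order all_algebra.
From mathcomp Require Import ring lra.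
From mathcomp Require Import all_classical all_reals all_analysis.

Set Implicit Arguments.
Unset Strict Implicit.
Unset Printing Implicit Defensive.

Import Order.TTheory GRing.Theory Num.Theory.
Import numFieldNormedType.Exports.

Local Open Scope classical_set_scope.
Local Open Scope ring_scope.

(* Coordinates are numbered from 0: [a j] is the coefficient of the (j+1)-st
   eigenvector, hence the weight (j+1)^(2s). *)
Section WeightedSequences.
Context {R : realType}.
Implicit Types (s : R) (a b c : nat -> R).

Definition ip_term s a b : nat -> R :=
  fun j => j.+1%:R `^ (2 * s) * (a j * b j).

Definition ip_s s a b : R := limn (series (ip_term s a b)).

Definition sq_summable s : {pred nat -> R} :=
  fun a => `[< cvgn (series (ip_term s a a)) >].

Lemma weight_gt0 s j : 0 < j.+1%:R `^ (2 * s) :> R.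
Proof. by rewrite powR_gt0 ?ltr0Sn. Qed.

Lemma ip_term_ge0 s a j : 0 <= ip_term s a a j.
Proof. by rewrite mulr_ge0 ?powR_ge0 // -expr2 sqr_ge0. Qed.

Lemma ip_term_le s a b (t : R) j : 0 < t ->
  2 * `|ip_term s a b j| <= t * ip_term s a a j + t^-1 * ip_term s b b j.
Proof.
move=> t0; rewrite /ip_term !normrM (ger0_norm (powR_ge0 _ _)).
set w := _ `^ _; have w0 : 0 <= w by exact: powR_ge0.
rewrite -[a j * a j]expr2 -[b j * b j]expr2 -(real_normK (num_real (a j))).
rewrite -(real_normK (num_real (b j))).
set x := `|a j|; set y := `|b j|.
have -> : t * (w * x ^+ 2) + t^-1 * (w * y ^+ 2) =
    2 * (w * (x * y)) + w * t^-1 * (t * x - y) ^+ 2.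
  by field; rewrite gt_eqF.
by rewrite lerDl mulr_ge0 ?sqr_ge0 // mulr_ge0 // invr_ge0 ltW.
Qed.

Lemma cvg_ip_term s a b : a \in sq_summable s -> b \in sq_summable s ->
  cvgn (series (ip_term s a b)).
Proof.
move=> /asboolP ca /asboolP cb; apply: normed_cvg.
apply: (@series_le_cvg _ _ (ip_term s a a + ip_term s b b)) => //.
- by move=> j /=.
- by move=> j; exact: addr_ge0 (ip_term_ge0 _ _ _) (ip_term_ge0 _ _ _).
- move=> j; have := @ip_term_le s a b 1 j ltr01; rewrite invr1 !mul1r /=.
  have : 0 <= `|ip_term s a b j| by [].
  rewrite -[(_ + _) j]/(ip_term s a a j + ip_term s b b j); lra.
- by rewrite seriesD; exact: is_cvgD.
Qed.

Lemma ip_termDl s a b c : ip_term s (a + b) c = ip_term s a c + ip_term s b c.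
Proof. by apply/funext => j; rewrite /ip_term !fctE; ring. Qed.

Lemma ip_termDr s a b c : ip_term s c (a + b) = ip_term s c a + ip_term s c b.
Proof. by apply/funext => j; rewrite /ip_term !fctE; ring. Qed.

Lemma ip_termC s a b : ip_term s a b = ip_term s b a.
Proof. by apply/funext => j; rewrite /ip_term; ring. Qed.

Lemma ip_termZ s (k : R) a :
  ip_term s (k *: a) (k *: a) = (k ^+ 2) *: ip_term s a a.
Proof.
apply/funext => j; rewrite /ip_term /GRing.scale /=.
by rewrite /GRing.scale /=; ring.
Qed.

Lemma sq_summable_submod s : submod_closed (sq_summable s).
Proof.
split.
  apply/asboolP; rewrite (_ : ip_term _ _ _ = 0); last first.
    by apply/funext => j; rewrite /ip_term mulr0 mulr0.
  rewrite (_ : series 0 = cst 0); first exact: is_cvg_cst.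
  by apply/funext => n; rewrite /series /= big1.
move=> k a b sa sb.
have ska : k *: a \in sq_summable s.
  by apply/asboolP; rewrite ip_termZ; apply: is_cvg_seriesZ; apply/asboolP.
apply/asboolP; rewrite ip_termDl !ip_termDr !seriesD.
apply: is_cvgD; apply: is_cvgD; exact: cvg_ip_term.
Qed.

HB.instance Definition _ s :=
  GRing.isSubmodClosed.Build R (nat -> R) (sq_summable s) (sq_summable_submod s).

End WeightedSequences.

(* [Hs s] is the completion of the span of the eigenvectors for <.,.>_s, its
   elements being given by their coordinates. *)
Record Hs (R : realType) (s : R) := MkHs {
  coords :> nat -> R;
  _ : coords \in sq_summable s }.
Arguments Hs {R} s.

Section HsNormed.
Context {R : realType} {s : R}.

HB.instance Definition _ := [isSub for @coords R s].
HB.instance Definition _ := [Choice of Hs s by <:].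
HB.instance Definition _ := [SubChoice_isSubLmodule of Hs s by <:].

Lemma coordsD (a b : Hs s) : coords (a + b) = coords a + coords b.
Proof. by []. Qed.

Lemma coordsZ (k : R) (a : Hs s) : coords (k *: a) = k *: coords a.
Proof. by []. Qed.

Lemma cvg_ip_s (a b : Hs s) : cvgn (series (ip_term s a b)).
Proof. by apply: cvg_ip_term; apply: valP. Qed.

Definition norm_s (a : Hs s) : R := Num.sqrt (ip_s s a a).

Lemma ip_s_ge0 (a : Hs s) : 0 <= ip_s s a a.
Proof.
apply: limr_ge; first exact: cvg_ip_s.
by near=> n; rewrite /series /= sumr_ge0 // => j _; exact: ip_term_ge0.
Unshelve. all: by end_near. Qed.

Lemma norm_s_sqr (a : Hs s) : norm_s a ^+ 2 = ip_s s a a.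
Proof. by rewrite sqr_sqrtr // ip_s_ge0. Qed.

Lemma norm_s_eq0 (a : Hs s) : norm_s a = 0 -> a = 0.
Proof.
move=> /eqP; rewrite -sqrf_eq0 norm_s_sqr => /eqP a0.
apply/val_inj/funext => j /=.
have nd : nondecreasing_seq (series (ip_term s a a)).
  by apply: nondecreasing_series => i _ _; exact: ip_term_ge0.
have le0 n : series (ip_term s a a) n <= 0.
  by rewrite -a0; apply: nondecreasing_cvgn_le => //; exact: cvg_ip_s.
have := le0 j.+1; rewrite /series /= big_nat_recr //= => h.
have : ip_term s a a j <= 0.
  apply: le_trans h; rewrite lerDr sumr_ge0 // => i _; exact: ip_term_ge0.
rewrite pmulr_rle0 ?weight_gt0 // -expr2 => h2.
by apply/eqP; rewrite -sqrf_eq0 eq_le h2 sqr_ge0.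
Qed.

Lemma ip_s_le (a b : Hs s) : ip_s s a b <= norm_s a * norm_s b.
Proof.
have [a0|a0] := eqVneq (norm_s a) 0.
  rewrite a0 mul0r (norm_s_eq0 a0) /ip_s (_ : ip_term _ _ _ = 0).
    rewrite (_ : series 0 = cst 0); first by rewrite lim_cst.
    by apply/funext => n; rewrite /series /= big1.
  by apply/funext => j; rewrite /ip_term /= mul0r mulr0.
have [b0|b0] := eqVneq (norm_s b) 0.
  rewrite b0 mulr0 (norm_s_eq0 b0) /ip_s (_ : ip_term _ _ _ = 0).
    rewrite (_ : series 0 = cst 0); first by rewrite lim_cst.
    by apply/funext => n; rewrite /series /= big1.
  by apply/funext => j; rewrite /ip_term /= mulr0 mulr0.
have A0 : 0 < norm_s a by rewrite lt_neqAle eq_sym a0 sqrtr_ge0.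
have B0 : 0 < norm_s b by rewrite lt_neqAle eq_sym b0 sqrtr_ge0.
set t := norm_s b / norm_s a; have t0 : 0 < t by rewrite divr_gt0.
have key : 2 * ip_s s a b <= t * ip_s s a a + t^-1 * ip_s s b b.
  have cz k (x y : Hs s) : cvgn (series (k *: ip_term s x y)).
    by apply: is_cvg_seriesZ; exact: cvg_ip_s.
  have lz k (x y : Hs s) :
      limn (series (k *: ip_term s x y)) = k * ip_s s x y.
    by rewrite lim_seriesZ //; exact: cvg_ip_s.
  rewrite -!lz -lim_seriesD //; apply: lim_series_le => //.
    by rewrite seriesD; exact: is_cvgD.
  move=> j; apply: le_trans (ip_term_le s a b j t0).
  by rewrite ler_pM2l ?ltr0n //; exact: ler_norm.
move: key; rewrite -!norm_s_sqr /t.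
have -> : norm_s b / norm_s a * norm_s a ^+ 2
    + (norm_s b / norm_s a)^-1 * norm_s b ^+ 2 = 2 * (norm_s a * norm_s b).
  by field; rewrite a0 b0.
by rewrite ler_pM2l ?ltr0n.
Qed.

Lemma ip_sD2 (a b : Hs s) :
  ip_s s (a + b) (a + b) = ip_s s a a + 2 * ip_s s a b + ip_s s b b.
Proof.
rewrite /ip_s coordsD ip_termDl !ip_termDr (ip_termC s b a).
have cD (x y z t : Hs s) : cvgn (series (ip_term s x y + ip_term s z t)).
  by rewrite seriesD; apply: is_cvgD; exact: cvg_ip_s.
rewrite (lim_seriesD (@cD _ _ _ _) (@cD _ _ _ _)).
rewrite !(lim_seriesD (@cvg_ip_s _ _) (@cvg_ip_s _ _)); ring.
Qed.

Lemma ler_norm_sD (a b : Hs s) : norm_s (a + b) <= norm_s a + norm_s b.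
Proof.
rewrite -(@ler_pXn2r _ 2) ?nnegrE ?addr_ge0 ?sqrtr_ge0 //.
rewrite norm_s_sqr ip_sD2 -!norm_s_sqr; have := ip_s_le a b; lra.
Qed.

Lemma norm_sZ (k : R) (a : Hs s) : norm_s (k *: a) = `|k| * norm_s a.
Proof.
rewrite /norm_s /ip_s coordsZ ip_termZ lim_seriesZ; last exact: cvg_ip_s.
by rewrite /GRing.scale /= sqrtrM ?sqr_ge0 // sqrtr_sqr.
Qed.

HB.instance Definition _ :=
  Lmodule_isNormed.Build R (Hs s) ler_norm_sD norm_sZ norm_s_eq0.

End HsNormed.

Section HsOperators.
Context {R : realType}.

(* The element of [Hs s] with coordinates [a], or 0 if there is none. *)
Definition to_Hs (s : R) (a : nat -> R) : Hs s := insubd (0 : Hs s) a.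

Definition dual_pair (s : R) (f : Hs (- s)) (u : Hs s) : R :=
  limn (series (fun j => f j * u j)).

(* Diagonal operator from [Hs s] to [Hs t]; it takes the junk value 0 at an [a]
   whose image does not lie in [Hs t]. *)
Definition diag_op (mu : nat -> R) (s t : R) (a : Hs s) : Hs t :=
  to_Hs t (fun j => mu j * a j).

End HsOperators.

Section GaussianMeasure.
Context {R : realType} {H : completeNormedModType R}.

Record is_inner_product (ip : H -> H -> R) : Prop := {
  ip_linear : forall z, linear (fun x => ip x z : R^o);
  ip_sym : forall x y, ip x y = ip y x;
  ip_norm : forall x, ip x x = `|x| ^+ 2 }.

Definition orthonormal_basis (ip : H -> H -> R) (phi : nat -> H) : Prop :=
  (forall i j, ip (phi i) (phi j) = (i == j)%:R) /\
  (forall x, series (fun j => ip x (phi j) *: phi j) @ \oo --> x).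

Definition borel := g_sigma_algebraType (@open H).

(* Law N(0,C) for injective [C]: every functional <.,x> with x <> 0 has the
   nondegenerate normal law N(0,<Cx,x>). *)
Definition gaussian_measure (ip : H -> H -> R) (C : H -> H)
    (mu : set borel -> \bar R) : Prop :=
  forall x : H, x != 0 -> forall A : set R, measurable A ->
    mu [set y : H | A (ip y x)] = normal_prob 0 (Num.sqrt (ip (C x) x)) A.

Definition Hs_of (ip : H -> H -> R) (phi : nat -> H) (s : R) (x : H) : Hs s :=
  to_Hs s (fun j => ip x (phi j)).

End GaussianMeasure.
Arguments borel {R} H.

Definition independent_rv d (T : measurableType d) (R : realType)
    (P : probability T R) d1 (T1 : measurableType d1)
    d2 (T2 : measurableType d2) (X : T -> T1) (Y : T -> T2) : Prop :=
  forall A B, measurable A -> measurable B ->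
    P (X @^-1` A `&` Y @^-1` B) = (P (X @^-1` A) * P (Y @^-1` B))%E.

(* Real-valued multilinear forms in curried form, and their operator norms. *)
Section HigherDerivatives.
Context {R : realType} {E : normedModType R}.

Fixpoint mform (k : nat) : lmodType R :=
  if k is k'.+1 then (E -> mform k' : Type) else R^o.

(* The operator norm of [A] is at most [c]. *)
Fixpoint mform_le (k : nat) : mform k -> R -> Prop :=
  match k with
  | 0 => fun A c => `|A : R| <= c
  | k'.+1 => fun A c => forall u : E, @mform_le k' (A u) (c * `|u|)
  end.

Definition is_frechet k (F : E -> mform k) (F' : E -> E -> mform k) : Prop :=
  forall x : E, [/\ linear (F' x),
    exists c, @mform_le k.+1 (F' x) c &
    forall eps : R, 0 < eps -> \forall u \near (0 : E),
      mform_le (F (x + u) - F x - F' x u) (eps * `|u|)].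

(* [f] is of class C^n, with successive Frechet derivatives [D 1], ..., [D n]. *)
Definition is_Cn (n : nat) (f : E -> R) (D : forall k, E -> mform k) : Prop :=
  [/\ forall x, D 0%N x = f x,
      forall k, (k < n)%N -> @is_frechet k (D k) (D k.+1) &
      forall (x : E) (eps : R), 0 < eps ->
        \forall y \near x, mform_le (D n y - D n x) eps].

End HigherDerivatives.
Arguments mform {R} E k.

Section Assumptions.
Context {R : realType}.

Definition eigenvalue_decay (lam : nat -> R) (kappa : R) : Prop :=
  let u := fun j => (j.+1%:R `^ kappa * lam j)%:E in
  2^-1 < kappa /\ (0 < limn_einf u /\ limn_esup u < +oo)%E.

Context {l : R}.
Implicit Types (lam : nat -> R) (Phi : Hs l -> R) (DPhi : Hs l -> Hs (- l)).

Definition is_gradient Phi DPhi : Prop :=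
  forall q, differentiable Phi q /\
    forall u, 'd Phi q u = dual_pair (DPhi q) u.

Definition C_grad lam DPhi (q : Hs l) : Hs l :=
  diag_op (fun j => lam j ^+ 2) l (DPhi q).

Definition sqrtC_grad lam DPhi (q : Hs l) : Hs 0 := diag_op lam 0 (DPhi q).

Definition potential_regular Phi DPhi : Prop :=
  [/\ continuous Phi, is_gradient Phi DPhi & lipschitz DPhi].

Definition potential_lower_bound Phi : Prop :=
  forall eps : R, 0 < eps ->
    exists K : R, forall q, K - eps * `|q| ^+ 2 <= Phi q.

Definition grad_bounds lam DPhi (L L' : R) : Prop :=
  [/\ forall q q', `|DPhi q - DPhi q'| <= L * `|q - q'|,
      forall q q', `|C_grad lam DPhi q - C_grad lam DPhi q'| <= L * `|q - q'|,
      forall q, `|DPhi q| <= L * `|q| + L' &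
      forall q, `|C_grad lam DPhi q| <= L * `|q| + L'].

Definition strongly_monotone lam DPhi (zeta : R) : Prop :=
  forall x y : Hs l,
    zeta * `|x - y| ^+ 2 <=
    ip_s l (x - y) (x - y) +
    ip_s l (C_grad lam DPhi x - C_grad lam DPhi y) (x - y).

(* The second derivative as an operator from [Hs l] to [Hs (-l)] is the
   derivative of [DPhi]. *)
Definition higher_bounds lam Phi DPhi (M N : R) : Prop :=
  [/\ exists D, is_Cn 4 Phi D /\ (forall x, mform_le (D 4%N x) N),
      forall x, differentiable DPhi x,
      forall x y u,
        `|'d DPhi x u - 'd DPhi y u| <= M * `|x - y| * `|u| &
      forall x y u,
        `|diag_op (fun j => lam j ^+ 2) l ('d DPhi x u) -
          diag_op (fun j => lam j ^+ 2) l ('d DPhi y u)|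
        <= M * `|x - y| * `|u| ].

End Assumptions.

Section PreconditionedHMC.
Context {R : realType} {l : R}.
Variables (lam : nat -> R) (Phi : Hs l -> R) (DPhi : Hs l -> Hs (- l)).
Variable h : R.

Definition psi (z : Hs l * Hs l) : Hs l * Hs l :=
  let q := z.1 in let v := z.2 in
  let q1 := cos h *: q + sin h *: v
            - (h / 2 * sin h) *: C_grad lam DPhi q in
  let v1 := - sin h *: q + cos h *: v
            - (h / 2 * cos h) *: C_grad lam DPhi q
            - (h / 2) *: C_grad lam DPhi q1 in
  (q1, v1).

(* [I] is the number of steps T/h. *)
Definition DeltaH (I : nat) (q0 v0 : Hs l) : R :=
  let q i := (iter i psi (q0, v0)).1 in
  let v i := (iter i psi (q0, v0)).2 in
  Phi (q I) - Phi (q 0%N)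
  + h ^+ 2 / 8 * (`|sqrtC_grad lam DPhi (q 0%N)| ^+ 2
                  - `|sqrtC_grad lam DPhi (q I)| ^+ 2)
  - h * (\sum_(1 <= i < I) dual_pair (DPhi (q i)) (v i))
  - h / 2 * (dual_pair (DPhi (q 0%N)) (v 0%N) + dual_pair (DPhi (q I)) (v I)).

Definition accept_prob (I : nat) (q v : Hs l) : R :=
  Num.min 1 (expR (- DeltaH I q v)).

Definition next_pos (I : nat) (q v : Hs l) (u : R) : Hs l :=
  if u <= accept_prob I q v then (iter I psi (q, v)).1 else q.

End PreconditionedHMC.

(* Main.v *)
(** Both chains are driven by the same velocity and the same uniform variable.
    The difference z_n of two leapfrog trajectories with equal initial velocity
    satisfies z_{n+1} - z_n = (z_n - z_{n-1}) - F_n, where F_n is the force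
    difference (2(1 - cos h)) z_n + (h sin h) g_n; summing twice, strong
    monotonicity and T^2 (1+L)^2 <= zeta give
    |z_n| <= (1 - zeta T^2 / 12) |z_0|, whatever the velocity.

    Adding and subtracting the potential at the position rotated by the exact
    free flow writes the energy error as a sum of local errors of the
    trapezoidal rule for s -> DPhi(rotated position).(rotated velocity).  Each
    is O(h^3) with an O(h^3) Lipschitz constant, so over a time T <= 1 the
    energy error and its Lipschitz constant are O(h^2 A^3), with A one plus the
    size of the initial data.  Rejecting both proposals loses the contraction
    with probability O(h^2 A^3); rejecting exactly one costs a displacement
    O(T A) with probability O(h^2 A^3 |x - y|).  In expectation this is
    O(T h^2 (1 + R^2)^2) |x - y|, by the fourth moment of the Gaussian velocity,
    and it is absorbed by the difference between 1/12 and 1/27 as soon as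
    h = O(sqrt T / (1 + R^2)). *)
Require Import Defs.
From HB Require Import structures.
From mathcomp Require Import all_boot all_order all_algebra.
From mathcomp Require Import all_classical all_reals all_analysis.
From mathcomp Require Import ring lra.
From mathcomp Require Import measurable_realfun.
Import Order.TTheory GRing.Theory Num.Theory.
Import numFieldNormedType.Exports.
Local Open Scope classical_set_scope.
Local Open Scope ring_scope.
Set Implicit Arguments.
Unset Strict Implicit.
Unset Printing Implicit Defensive.

(** * Calculus on an interval *)

(** The asserted bound is a multiple of |x - y|, so a small energy error is not enough: a rejection
    by exactly one chain must become unlikely as y tends to x. This is why each estimate of the
    energy error is paired with one of its Lipschitz constant, and why a fourth derivative of Phi
    enters. The contraction gains only a multiple of T^2, so every loss must carry a factor T
    besides h^2: for one rejection it comes from the displacement, for two from the lost gain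
    itself, which is at most T (1 + L). Dividing by T leaves h^2 (1 + R^2)^2 against T, hence the
    square root. The kinetic energy of a Gaussian velocity is almost surely infinite, so [DeltaH]
    must be estimated as a sum along the trajectory and not as a difference of energies. After its
    first half kick a leapfrog step moves the position by an exact rotation. Written with the
    rotated velocities, the sum consists of trapezoidal defects and one boundary term in |C^(1/2)
    DPhi|^2, of order h^2. All constants are fixed before Phi, because the step size has to be. *)

Section RealCalculus.
Context {R : realType}.
Implicit Types (f df : R -> R) (h B x : R).

Lemma mvt0 f df h : 0 <= h -> (forall x, is_derive x 1 f (df x)) ->
  exists2 c, 0 <= c <= h & f h - f 0 = df c * h.
Proof.
move=> h0 dfE; have cf : {within `[0, h], continuous f}.
  apply: derivable_within_continuous => x _; apply: ex_derive.
have [c ch E] := MVT_segment h0 (fun x _ => dfE x) cf.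
by exists c; [move: ch; rewrite in_itv|rewrite E subr0].
Qed.

Lemma ler_mvt0 f df h : 0 <= h -> (forall x, is_derive x 1 f (df x)) ->
  (forall x, 0 <= x <= h -> 0 <= df x) -> f 0 <= f h.
Proof.
move=> h0 dfE df0; have [c ch E] := mvt0 h0 dfE.
by rewrite -subr_ge0 E mulr_ge0 // df0.
Qed.

Lemma norm_mvt0 f df h B : 0 <= h -> (forall x, is_derive x 1 f (df x)) ->
  (forall x, 0 <= x <= h -> `|df x| <= B) -> `|f h - f 0| <= B * h.
Proof.
move=> h0 dfE dfB; have [c ch ->] := mvt0 h0 dfE.
by rewrite normrM (ger0_norm h0) ler_wpM2r // dfB.
Qed.

Lemma sin_le_id h : 0 <= h -> sin h <= h.
Proof.
move=> h0; rewrite -subr_ge0.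
rewrite (_ : 0 = 0 - sin (0 : R)); last by rewrite sin0 subr0.
have dE x : is_derive x 1 (fun x => x - sin x) (1 - cos x).
  by apply: trigger_derive.
apply: (ler_mvt0 h0 dE).
by move=> x _; rewrite subr_ge0 cos_le1.
Qed.

Lemma cos_ge_quad h : 0 <= h -> 1 - h ^+ 2 / 2 <= cos h.
Proof.
move=> h0; rewrite -subr_ge0.
rewrite (_ : 0 = cos (0 : R) - (1 - 0 ^+ 2 / 2)); last first.
  by rewrite cos0 expr0n mul0r subr0 subrr.
have dE x : is_derive x 1 (fun x => cos x - (1 - x ^+ 2 / 2))
    (x - sin x).
  by apply: trigger_derive; rewrite /GRing.scale /=; lra.
apply: (ler_mvt0 h0 dE).
by move=> x /andP[x0 _]; rewrite subr_ge0 sin_le_id.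
Qed.

Lemma sin_ge_cubic h : 0 <= h -> h - h ^+ 3 / 6 <= sin h.
Proof.
move=> h0; rewrite -subr_ge0.
rewrite (_ : 0 = sin (0 : R) - (0 - 0 ^+ 3 / 6)); last first.
  by rewrite sin0 expr0n mul0r !subr0.
have dE x : is_derive x 1 (fun x => sin x - (x - x ^+ 3 / 6))
    (cos x - (1 - x ^+ 2 / 2)).
  by apply: trigger_derive; rewrite /GRing.scale /=; lra.
apply: (ler_mvt0 h0 dE).
by move=> x /andP[x0 _]; rewrite subr_ge0 cos_ge_quad.
Qed.

Lemma sin_ge0_01 h : 0 <= h <= 1 -> 0 <= sin h.
Proof.
move=> /andP[h0 h1]; apply: le_trans (sin_ge_cubic h0).
have h2 : h ^+ 2 <= 1 by rewrite expr_le1.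
have -> : h - h ^+ 3 / 6 = h * (1 - h ^+ 2 / 6) by field.
by apply: mulr_ge0 => //; lra.
Qed.

Lemma sin_ge_56 h : 0 <= h <= 1 -> 5 / 6 * h <= sin h.
Proof.
move=> /andP[h0 h1]; apply: le_trans (sin_ge_cubic h0).
have h2 : h ^+ 2 <= 1 by rewrite expr_le1.
have -> : h - h ^+ 3 / 6 = (1 - h ^+ 2 / 6) * h by field.
by apply: ler_wpM2r => //; lra.
Qed.

Lemma sin_ge_hcos h : 0 <= h <= 1 -> h * cos h <= sin h.
Proof.
move=> /andP[h0 h1]; rewrite -subr_ge0.
rewrite (_ : 0 = sin (0 : R) - 0 * cos 0); last by rewrite sin0 mul0r subr0.
have dE x : is_derive x 1 (fun x => sin x - x * cos x)
    (x * sin x).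
  by apply: trigger_derive; rewrite /GRing.scale /=; lra.
apply: (ler_mvt0 h0 dE).
move=> x /andP[x0 xh]; apply: mulr_ge0 => //; apply: sin_ge0_01.
by rewrite x0 (le_trans xh).
Qed.

(** The difference of the sides has derivative sin h - h cos h. The inequality makes the force a
    nonnegative multiple of z plus h sin h times z + g, the vector to which strong monotonicity
    applies. *)
Lemma hsin_le_cos h : 0 <= h <= 1 -> h * sin h <= 2 * (1 - cos h).
Proof.
move=> /andP[h0 h1]; rewrite -subr_ge0.
rewrite (_ : 0 = 2 * (1 - cos (0 : R)) - 0 * sin 0); last first.
  by rewrite cos0 subrr mulr0 mul0r subr0.
have dE x : is_derive x 1 (fun x => 2 * (1 - cos x) - x * sin x)
    (sin x - x * cos x).
  by apply: trigger_derive; rewrite /GRing.scale /=; lra.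
apply: (ler_mvt0 h0 dE).
move=> x /andP[x0 xh]; rewrite subr_ge0; apply: sin_ge_hcos.
by rewrite x0 (le_trans xh).
Qed.

(** The defect and its first derivative vanish at 0, and its second derivative is - t/2 g3(t); two
    applications of the mean value theorem give h^3. Only a bound on g3 is required, so the lemma
    applies equally to the difference of two curves. *)
Lemma trapezoid_bound (g g1 g2 g3 : R -> R) h B : 0 <= h ->
  (forall x, is_derive x 1 g (g1 x)) -> (forall x, is_derive x 1 g1 (g2 x)) ->
  (forall x, is_derive x 1 g2 (g3 x)) ->
  (forall x, 0 <= x <= h -> `|g3 x| <= B) ->
  `|g h - g 0 - h / 2 * (g1 0 + g1 h)| <= B * h ^+ 3.
Proof.
move=> h0 d1 d2 d3 gB.
have B0 : 0 <= B by apply: le_trans (gB 0 _); rewrite ?lexx.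
pose p t := g t - g 0 - t / 2 * (g1 0 + g1 t).
pose p1 t := (g1 t - g1 0) / 2 - t / 2 * g2 t.
pose p2 t := - (t / 2 * g3 t).
have dp x : is_derive x 1 p (p1 x).
  apply: trigger_derive; rewrite /p1 /GRing.scale /=; lra.
have dp1 x : is_derive x 1 p1 (p2 x).
  apply: trigger_derive; rewrite /p2 /GRing.scale /=; lra.
have p00 : p 0 = 0 by rewrite /p; lra.
have p10 : p1 0 = 0 by rewrite /p1; lra.
have p1B x : 0 <= x <= h -> `|p1 x| <= B * h ^+ 2.
  move=> /andP[x0 xh]; rewrite -[p1 x]subr0 -{1}p10.
  apply: le_trans (@norm_mvt0 p1 p2 x (B * h) x0 dp1 _) _.
    move=> y /andP[y0 yx]; have yh := le_trans yx xh.
    rewrite /p2 normrN normrM ger0_norm ?divr_ge0 // mulrC.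
    have : `|g3 y| <= B by rewrite gB // y0.
    by move=> ?; apply: ler_pM => //; [rewrite divr_ge0|lra].
  by rewrite expr2 mulrA ler_wpM2l // mulr_ge0.
rewrite -/(p h) -[p h]subr0 -{1}p00 exprSr mulrA.
exact: norm_mvt0.
Qed.

End RealCalculus.

(** * Contraction of synchronously coupled leapfrog trajectories *)

Lemma eqW {d} {T : porderType d} (x y : T) : x = y -> (x <= y)%O.
Proof. by move=> ->. Qed.

Section LinearCombination.
Context {R : pzRingType} {V : lmodType R}.

(* Reduces linear identities between four vectors to identities between their
   coefficients, which [ring] decides. *)
Lemma lincomb (x y u w : V) : exists f : R -> R -> R -> R -> V,
  [/\ x = f 1 0 0 0, y = f 0 1 0 0, u = f 0 0 1 0, w = f 0 0 0 1 &
  [/\ forall a b c d a' b' c' d',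
      f a b c d + f a' b' c' d' = f (a + a') (b + b') (c + c') (d + d'),
    forall a b c d, - f a b c d = f (- a) (- b) (- c) (- d) &
    forall k a b c d, k *: f a b c d = f (k * a) (k * b) (k * c) (k * d)]].
Proof.
pose f a b c d := a *: x + b *: y + c *: u + d *: w.
have fZ k a b c d : k *: f a b c d = f (k * a) (k * b) (k * c) (k * d).
  by rewrite /f !scalerDr !scalerA.
exists f; split; rewrite /f ?scale0r ?scale1r ?addr0 ?add0r //; split => //.
- move=> *; rewrite !scalerDl [LHS]addrACA; congr (_ + _).
  by rewrite [LHS]addrACA; congr (_ + _); exact: addrACA.
- by move=> a b c d; rewrite -scaleN1r fZ !mulN1r.
Qed.

End LinearCombination.

Section LeapfrogContraction.
Context {R : realType} {E : normedModType R}.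
Variable ip : E -> E -> R.
Hypothesis ipD : forall x y z, ip (x + y) z = ip x z + ip y z.
Hypothesis ipZ : forall k x z, ip (k *: x) z = k * ip x z.
Hypothesis ipC : forall x y, ip x y = ip y x.
Hypothesis ipE : forall x, ip x x = `|x| ^+ 2.

Lemma ipN x z : ip (- x) z = - ip x z.
Proof. by rewrite -scaleN1r ipZ mulN1r. Qed.

Lemma ip_le x y : ip x y <= `|x| * `|y|.
Proof.
have [->|x0] := eqVneq x 0.
  by rewrite -(scale0r 0) ipZ mul0r mulr_ge0.
have [->|y0] := eqVneq y 0.
  by rewrite ipC -(scale0r 0) ipZ mul0r mulr_ge0.
have xy0 : 0 < `|x| * `|y| by rewrite mulr_gt0 ?normr_gt0.
rewrite -(ler_pM2l xy0).
have : 0 <= ip (`|y| *: x - `|x| *: y) (`|y| *: x - `|x| *: y).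
  by rewrite ipE sqr_ge0.
rewrite !(ipD, ipN, ipZ) ![ip _ (_ - _)]ipC !(ipD, ipN, ipZ) !ipE (ipC y x).
rewrite !expr2; nra.
Qed.

Lemma norm_ip_le x y : `|ip x y| <= `|x| * `|y|.
Proof.
rewrite ler_norml ip_le andbT lerNl -ipN.
by rewrite (le_trans (ip_le _ _)) // normrN.
Qed.

Variables (h L zeta : R) (z p g : nat -> E).
Hypothesis h0 : 0 < h.
Hypothesis L0 : 0 < L.
Hypothesis zeta_bnd : 0 < zeta <= L + 1.
Hypothesis p0 : p 0%N = 0.
Hypothesis zS : forall i,
  z i.+1 = cos h *: z i + sin h *: p i - (h / 2 * sin h) *: g i.
Hypothesis pS : forall i,
  p i.+1 = - sin h *: z i + cos h *: p i - (h / 2 * cos h) *: g i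
           - (h / 2) *: g i.+1.
Hypothesis gL : forall i, `|g i| <= L * `|z i|.
Hypothesis gmono : forall i,
  zeta * `|z i| ^+ 2 <= ip (z i) (z i) + ip (g i) (z i).

Let F i := (2 * (1 - cos h)) *: z i + (h * sin h) *: g i.
Let dz i := z i.+1 - z i.

(** With equal initial velocities the first step feels a single half kick, hence half a force; this
    is the 1/2 that starts the sums below. *)
Lemma leap_diff0 : dz 0%N = - (2^-1 *: F 0%N).
Proof.
rewrite /dz /F zS p0 scaler0 addr0.
have [f [-> -> _ _ [fD fN fZ]]] := lincomb (z 0%N) (g 0%N) 0 0.
by rewrite !(fZ, fN, fD); congr f; field.
Qed.

(** The velocity is eliminated: sin h p_i is read off from step i, and propagating it expresses sin
    h p_(i+1) through positions alone. Keeping the factor sin h avoids a division, and cos^2 - 1 = -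
    sin^2 closes the computation. *)
Lemma leap_diffS i : dz i.+1 = dz i - F i.+1.
Proof.
have spE : sin h *: p i = z i.+1 - cos h *: z i + (h / 2 * sin h) *: g i.
  rewrite zS; have [f [-> -> -> _ [fD fN fZ]]] := lincomb (z i) (p i) (g i) 0.
  by rewrite !(fZ, fN, fD); congr f; ring.
have spS : sin h *: p i.+1 =
    cos h *: z i.+1 - z i - (h / 2 * sin h) *: g i.+1.
  have -> : sin h *: p i.+1 = (cos h ^+ 2 - 1) *: z i
      + cos h *: (sin h *: p i) - (h / 2 * cos h * sin h) *: g i
      - (h / 2 * sin h) *: g i.+1.
    rewrite pS (_ : cos h ^+ 2 - 1 = - sin h ^+ 2); last by rewrite cos2sin2; ring.
    have [f [-> -> -> -> [fD fN fZ]]] := lincomb (z i) (p i) (g i) (g i.+1).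
    by rewrite !(fZ, fN, fD); congr f; ring.
  rewrite spE.
  have [f [-> -> -> -> [fD fN fZ]]] := lincomb (z i) (z i.+1) (g i) (g i.+1).
  by rewrite !(fZ, fN, fD); congr f; ring.
rewrite /dz /F (zS i.+1) spS.
have [f [-> -> -> _ [fD fN fZ]]] := lincomb (z i) (z i.+1) (g i.+1) 0.
by rewrite !(fZ, fN, fD); congr f; field.
Qed.

Variable n : nat.
Let T := n%:R * h.
Hypothesis n0 : (0 < n)%N.
Hypothesis T_small : T ^+ 2 * (1 + L) <= zeta / (1 + L).

Let N := `|z 0%N|.
Let b := h ^+ 2 * (1 + L).

Let N0 : 0 <= N. Proof. exact: normr_ge0. Qed.
Let b0 : 0 < b. Proof. by rewrite mulr_gt0 ?exprn_gt0 // addr_gt0. Qed.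

Let bN0 : 0 <= b * N. Proof. by rewrite mulr_ge0 // ltW. Qed.

Let T2_le : T ^+ 2 * (1 + L) ^+ 2 <= zeta.
Proof.
have L1 : 0 < 1 + L by rewrite addr_gt0.
by rewrite expr2 mulrA -ler_pdivlMr.
Qed.

Let bn2 : b * n%:R ^+ 2 <= 1.
Proof.
have -> : b * n%:R ^+ 2 = T ^+ 2 * (1 + L) by rewrite /b /T exprMn; ring.
apply: le_trans T_small _; rewrite ler_pdivrMr ?mul1r ?addr_gt0 //.
by rewrite addrC; case/andP: zeta_bnd.
Qed.

Let hT : h <= T.
Proof. by rewrite ler_peMl ?ler1n // ltW. Qed.

Let T1 : T ^+ 2 <= 1.
Proof.
apply: le_trans bn2; rewrite /T /b exprMn mulrC -mulrA ler_pM2l ?exprn_gt0 //.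
by rewrite ler_peMl ?exprn_ge0 // lerDl ltW.
Qed.

Let h01 : 0 <= h <= 1.
Proof.
have T0 : 0 <= T by rewrite ltW // (lt_le_trans h0).
have h2 : h ^+ 2 <= 1 by apply: le_trans T1; rewrite lerXn2r // nnegrE ltW.
by rewrite (ltW h0) -(@expr_le1 _ 2) // ltW.
Qed.

Let hsin_ge0 : 0 <= h * sin h.
Proof. by rewrite mulr_ge0 ?sin_ge0_01 // ltW. Qed.

Let hsin_le : h * sin h <= h ^+ 2.
Proof. by rewrite expr2 ler_pM2l // sin_le_id // ltW. Qed.

Let cos_le : 2 * (1 - cos h) <= h ^+ 2.
Proof. by have := cos_ge_quad (ltW h0); lra. Qed.

Lemma norm_force_le i : `|F i| <= b * `|z i|.
Proof.
rewrite /F (le_trans (ler_normD _ _)) // normrZ [`|_ *: g i|]normrZ.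
rewrite (ger0_norm hsin_ge0) ger0_norm; last first.
  by rewrite mulr_ge0 // subr_ge0 cos_le1.
have -> : b * `|z i| = h ^+ 2 * `|z i| + h ^+ 2 * (L * `|z i|).
  by rewrite /b; ring.
apply: lerD; first by rewrite ler_wpM2r.
by apply: ler_pM.
Qed.

(* 6/11 is the least c with 1/2 + c/12 <= c. *)
Let c : R := 6 / 11.

Let c0 : 0 <= c. Proof. by rewrite /c; lra. Qed.

Let cb0 : 0 <= c * b. Proof. by rewrite mulr_ge0 ?c0 // ltW. Qed.

Let dist_poly_le (x : R) : b * x ^+ 2 <= 1 ->
  x ^+ 2 / 2 + c * b * (x ^+ 2 * (x ^+ 2 - 1)) / 12 <= c * x ^+ 2.
Proof.
move=> bx; have X0 : 0 <= x ^+ 2 by rewrite sqr_ge0.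
have bX : b * x ^+ 2 * x ^+ 2 <= x ^+ 2 by rewrite ler_piMl.
have bX0 : 0 <= b * x ^+ 2 by rewrite mulr_ge0 // ltW.
rewrite (_ : c * b * _ = c * (b * x ^+ 2 * x ^+ 2 - b * x ^+ 2)); last by ring.
by rewrite /c; lra.
Qed.

(** Both polynomials are exact double sums: if |F_k| <= b N (1 + c b k^2), then summing once gives
    the sum of squares k (k + 1) (2 k + 1) / 6, and summing again gives k^2 (k^2 - 1) / 12. The
    hypothesis on F_k is reproduced by the first bound through [dist_poly_le], so the induction
    closes with the same c. *)
Lemma leap_dist_aux i : (i <= n)%N -> let x : R := i%:R in
  `|z i - z 0%N| <= b * N * (x ^+ 2 / 2 + c * b * (x ^+ 2 * (x ^+ 2 - 1)) / 12)
  /\ `|dz i| <=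
    b * N * (2^-1 + x + c * b * (x * (x + 1) * (2 * x + 1)) / 6).
Proof.
elim: i => [|i IH] iln x.
  rewrite /x subrr normr0; split; first by rewrite mulr0n expr0n !(mul0r, mulr0, addr0).
  rewrite leap_diff0 normrN normrZ ger0_norm ?invr_ge0 //.
  have := norm_force_le 0; rewrite -/N mulr0n; lra.
have [IH1 IH2] := IH (ltnW iln); set y : R := i%:R in IH1 IH2.
have xE : x = y + 1 by rewrite /x mulrSr.
have y0 : 0 <= y by [].
have x2n : b * x ^+ 2 <= 1.
  apply: le_trans bn2; rewrite ler_pM2l // lerXn2r ?nnegrE // /x ?ler_nat //.
have D1 : `|z i.+1 - z 0%N| <=
    b * N * (x ^+ 2 / 2 + c * b * (x ^+ 2 * (x ^+ 2 - 1)) / 12).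
  have -> : z i.+1 - z 0%N = (z i - z 0%N) + dz i.
    by rewrite /dz [RHS]addrC addrA subrK.
  apply: le_trans (ler_normD _ _) _; apply: le_trans (lerD IH1 IH2) _.
  by apply/eqW; rewrite xE; field.
split=> //.
have zN : `|z i.+1| <= N * (1 + c * b * x ^+ 2).
  have -> : z i.+1 = z 0%N + (z i.+1 - z 0%N) by rewrite addrC subrK.
  rewrite (le_trans (ler_normD _ _)) // mulrDr mulr1 lerD2l.
  apply: le_trans D1 _.
  have -> : N * (c * b * x ^+ 2) = b * N * (c * x ^+ 2) by ring.
  rewrite ler_wpM2l //.
  exact: dist_poly_le.
rewrite leap_diffS (le_trans (ler_normB _ _)) //.
rewrite (_ : b * N * _ = b * N * (2^-1 + y + c * b
    * (y * (y + 1) * (2 * y + 1)) / 6) + b * (N * (1 + c * b * x ^+ 2))).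
  apply: lerD => //; apply: le_trans (norm_force_le _) _.
  by rewrite ler_pM2l.
by rewrite xE; field.
Qed.

Lemma leap_dist i : (i <= n)%N ->
  `|z i - z 0%N| <= N * (c * b * i%:R ^+ 2).
Proof.
move=> iln; have [D1 _] := leap_dist_aux iln; apply: le_trans D1 _.
set x : R := i%:R.
have x2n : b * x ^+ 2 <= 1.
  apply: le_trans bn2; rewrite ler_pM2l // lerXn2r ?nnegrE // /x ?ler_nat //.
have -> : N * (c * b * x ^+ 2) = b * N * (c * x ^+ 2) by ring.
rewrite ler_wpM2l //.
exact: dist_poly_le.
Qed.

(** 5/6 is the lower bound of sin h / h on [0, 1]; 24/11 is 4 c. *)
Let A := 5 / 6 * h ^+ 2 * zeta.
Let B := 24 / 11 * b ^+ 2.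

(** Monotonicity is available for z_i paired with itself. Replacing one z_i by z_0 costs |z_i + g_i|
    |z_i - z_0|, which the relative displacement e = c b i^2 controls; |z_i|^2 is at least (1 - 2 e)
    N^2. *)
Lemma force_ip_ge i : (i <= n)%N ->
  N ^+ 2 * (A - B * i%:R ^+ 2) <= ip (F i) (z 0%N).
Proof.
move=> iln; set x : R := i%:R.
have dN := leap_dist iln; rewrite -/x in dN.
set e := c * b * x ^+ 2 in dN.
have e0 : 0 <= e by rewrite mulr_ge0 ?sqr_ge0 ?cb0.
have e1 : e <= c.
  have x2n : b * x ^+ 2 <= 1.
    apply: le_trans bn2; rewrite ler_pM2l // lerXn2r ?nnegrE // /x ?ler_nat //.
  by rewrite /e -mulrA ler_piMr // /c.
have zle : `|z i| <= N * (1 + e).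
  have -> : z i = z 0%N + (z i - z 0%N) by rewrite addrC subrK.
  by rewrite (le_trans (ler_normD _ _)) // mulrDr mulr1 lerD2l.
have zge : N * (1 - e) <= `|z i|.
  rewrite mulrBr mulr1 lerBlDr -(lerD2r (- `|z i|)) addrAC subrr add0r.
  apply: le_trans dN; rewrite distrC; exact: lerB_dist.
have zz0 : 0 <= ip (z i) (z 0%N).
  have -> : ip (z i) (z 0%N) = N ^+ 2 + ip (z i - z 0%N) (z 0%N).
    by rewrite ipD ipN [ip (z 0%N) _]ipE addrC subrK.
  have := norm_ip_le (z i - z 0%N) (z 0%N); rewrite -/N ler_norml => /andP[+ _].
  have : `|z i - z 0%N| * N <= N * e * N by rewrite ler_wpM2r.
  have : N * e * N <= N * N by rewrite -mulrA ler_wpM2l // ler_piMl // (le_trans e1) // /c; lra.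
  by rewrite expr2; lra.
have zeta0 : 0 < zeta by case/andP: zeta_bnd.
have zL : zeta <= L + 1 by case/andP: zeta_bnd.
have fz : zeta * (N ^+ 2 * (1 - 2 * e)) - (1 + L) * (N * (1 + e)) * (N * e)
    <= ip (z i + g i) (z 0%N).
  have -> : ip (z i + g i) (z 0%N) =
      (ip (z i) (z i) + ip (g i) (z i)) - ip (z i + g i) (z i - z 0%N).
    rewrite -ipD [ip _ (_ - _)]ipC (ipD (z i) (- z 0%N)) ipN.
    by rewrite !(ipC _ (z i + g i)) opprD opprK addrA addrN add0r.
  apply: lerB.
    apply: le_trans (gmono i); rewrite ler_pM2l //.
    apply: le_trans (_ : (N * (1 - e)) ^+ 2 <= _).
      by rewrite exprMn ler_wpM2l ?sqr_ge0 // expr2; nra.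
    rewrite lerXn2r ?nnegrE //; apply: mulr_ge0 => //.
    by rewrite subr_ge0 (le_trans e1) // /c; lra.
  apply: le_trans (ip_le _ _) _; apply: ler_pM => //.
  rewrite (le_trans (ler_normD _ _)) // mulrDl mul1r.
  by apply: lerD => //; apply: le_trans (gL i) _; rewrite ler_pM2l.
(* The first coefficient is nonnegative by [hsin_le_cos], and its inner product is nonnegative
   because z_i stays within c N < N of z_0. *)
have -> : ip (F i) (z 0%N) = (2 * (1 - cos h) - h * sin h) * ip (z i) (z 0%N)
    + h * sin h * ip (z i + g i) (z 0%N).
  by rewrite /F !(ipD, ipZ); ring.
rewrite -[leLHS]add0r; apply: lerD.
  by rewrite mulr_ge0 // subr_ge0 hsin_le_cos.
apply: le_trans (_ : h * sin h * (zeta * (N ^+ 2 * (1 - 2 * e))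
  - (1 + L) * (N * (1 + e)) * (N * e)) <= _); last by rewrite ler_wpM2l.
have -> : h * sin h * (zeta * (N ^+ 2 * (1 - 2 * e))
    - (1 + L) * (N * (1 + e)) * (N * e)) =
  N ^+ 2 * (h * sin h * zeta - h * sin h * (2 * zeta * e + (1 + L) * (1 + e) * e)).
  by ring.
rewrite ler_wpM2l ?sqr_ge0 //; apply: lerB.
  rewrite /A ler_pM2r // [h ^+ 2]expr2 mulrCA ler_pM2l //.
  by rewrite sin_ge_56.
have -> : B * x ^+ 2 = h ^+ 2 * (4 * (1 + L) * e).
  by rewrite /B /e /c /b; field.
have L1 := L0.
have fin : 2 * zeta * e + (1 + L) * (1 + e) * e <= 4 * (1 + L) * e.
  have -> : 2 * zeta * e + (1 + L) * (1 + e) * e = (2 * zeta + (1 + L) * (1 + e)) * e by ring.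
  rewrite ler_wpM2r //.
  have e2 : 1 + e <= 2 by have := e1; rewrite /c; lra.
  have : (1 + L) * (1 + e) <= (1 + L) * 2 by rewrite ler_pM2l ?addr_gt0.
  lra.
apply: ler_pM => //; apply: addr_ge0.
  by rewrite mulr_ge0 // mulr_ge0 // ltW.
by rewrite mulr_ge0 // mulr_ge0 // addr_ge0 // ltW.
Qed.

(** The same double summation as in [leap_dist_aux], now for the components along z_0, where the
    sign of the force is kept. *)
Lemma leap_ip_aux i : (i <= n)%N -> let x : R := i%:R in
  ip (z i - z 0%N) (z 0%N) <=
    - (N ^+ 2 * (A * x ^+ 2 / 2 - B * (x ^+ 2 * (x ^+ 2 - 1)) / 12))
  /\ ip (dz i) (z 0%N) <=
    - (N ^+ 2 * (A * (2^-1 + x) - B * (x * (x + 1) * (2 * x + 1)) / 6)).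
Proof.
elim: i => [|i IH] iln x.
  rewrite /x mulr0n; split.
    rewrite subrr -(scale0r 0) ipZ; lra.
  rewrite leap_diff0 ipN ipZ; have := force_ip_ge iln; rewrite mulr0n; lra.
have [IH1 IH2] := IH (ltnW iln); set y : R := i%:R in IH1 IH2.
have xE : x = y + 1 by rewrite /x mulrSr.
split.
  have -> : z i.+1 - z 0%N = (z i - z 0%N) + dz i.
    by rewrite /dz [RHS]addrC addrA subrK.
  rewrite ipD (le_trans (lerD IH1 IH2)) //.
  by apply/eqW; rewrite xE; field.
rewrite leap_diffS ipD ipN (le_trans (lerB IH2 (force_ip_ge iln))) //.
by apply/eqW; rewrite -/x xE; field.
Qed.

(** Put u = zeta T^2 and expand |z_0 + w|^2. The cross term contributes - 2 (5/12 - 2/11) u and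
    |w|^2 at most c^2 u = 36/121 u, since (1 + L)^2 T^4 <= u. The total is below - u/6, and 1 - u/6
    <= (1 - u/12)^2. *)
Lemma leap_contraction : `|z n| <= (1 - zeta * T ^+ 2 / 12) * `|z 0%N|.
Proof.
have zeta0 : 0 < zeta by case/andP: zeta_bnd.
have zL : zeta <= L + 1 by case/andP: zeta_bnd.
have zT1 : zeta * T ^+ 2 <= 1.
  apply: le_trans (_ : (1 + L) * T ^+ 2 <= _).
    by rewrite ler_wpM2r ?sqr_ge0 // addrC.
  by apply: le_trans bn2; rewrite /T /b exprMn; apply/eqW; ring.
have d := leap_dist (leqnn n).
have [q _] := leap_ip_aux (leqnn n).
rewrite -(@ler_pXn2r _ 2) ?nnegrE //; last first.
  by rewrite mulr_ge0 // subr_ge0; lra.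
set w := z n - z 0%N in d q *.
have zE : z n = z 0%N + w by rewrite /w addrC subrK.
clearbody w; have -> : `|z n| ^+ 2 = `|w| ^+ 2 + 2 * ip w (z 0%N) + N ^+ 2.
  rewrite zE -ipE ipD (ipC (z 0%N) (_ + _)) (ipC w (_ + _)) !ipD !ipE.
  by rewrite (ipC (z 0%N) w) -/N; ring.
rewrite [leRHS]exprMn -/N.
have w2 : `|w| ^+ 2 <= N ^+ 2 * (c * b * n%:R ^+ 2) ^+ 2.
  by rewrite -exprMn lerXn2r ?nnegrE // mulr_ge0 // mulr_ge0 ?sqr_ge0 ?cb0.
have bT : b * n%:R ^+ 2 = (1 + L) * T ^+ 2 by rewrite /b /T exprMn; ring.
have b2T : (b * n%:R ^+ 2) ^+ 2 <= zeta * T ^+ 2.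
  rewrite bT (_ : _ ^+ 2 = T ^+ 2 * (1 + L) ^+ 2 * T ^+ 2); last by ring.
  by rewrite ler_wpM2r ?sqr_ge0.
have N20 : 0 <= N ^+ 2 by exact: sqr_ge0.
apply: le_trans (_ : N ^+ 2 * (1 - zeta * T ^+ 2 / 6) <= _); last first.
  rewrite mulrC ler_wpM2r // expr2; set u := zeta * T ^+ 2.
  have : 0 <= u ^+ 2 by rewrite sqr_ge0.
  by rewrite expr2; lra.
have q' : ip w (z 0%N) <= - (N ^+ 2 * (5 / 12 * (zeta * T ^+ 2)
    - 2 / 11 * (zeta * T ^+ 2))).
  apply: le_trans q _; rewrite lerN2 ler_wpM2l //.
  have -> : A * n%:R ^+ 2 / 2 = 5 / 12 * (zeta * T ^+ 2).
    by rewrite /A /T exprMn; field.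
  have : B * (n%:R ^+ 2 * (n%:R ^+ 2 - 1)) / 12 <= 2 / 11 * (b * n%:R ^+ 2) ^+ 2.
    have X0 : 0 <= b ^+ 2 * n%:R ^+ 2 by rewrite mulr_ge0 ?sqr_ge0.
    have -> : (b * n%:R ^+ 2) ^+ 2 = b ^+ 2 * n%:R ^+ 2 * n%:R ^+ 2 by ring.
    have -> : B * (n%:R ^+ 2 * (n%:R ^+ 2 - 1)) / 12 =
        2 / 11 * (b ^+ 2 * n%:R ^+ 2 * n%:R ^+ 2 - b ^+ 2 * n%:R ^+ 2).
      by rewrite /B; field.
    by rewrite ler_pM2l ?gerBl //; lra.
  by lra.
have w2' : `|w| ^+ 2 <= N ^+ 2 * (36 / 121 * (zeta * T ^+ 2)).
  apply: le_trans w2 _; rewrite ler_wpM2l // /c -mulrA exprMn.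
  by rewrite (_ : (6 / 11) ^+ 2 = 36 / 121) ?ler_pM2l //; field.
by set u := zeta * T ^+ 2 in q' w2' *; nra.
Qed.

End LeapfrogContraction.

(** * Growth and stability of leapfrog trajectories *)

(** The left side is the bound for both components of one step, divided by h. The monomials declared
    nonnegative in the proof make the comparison linear. *)
Lemma growth_poly_le {R : realType} (L L' a c : R) :
  0 <= L -> 0 <= L' -> 0 <= a -> 0 <= c ->
  a / 2 + c + (L * a + L') / 2 + a + c / 2 + (L * a + L') / 2 +
  (L * ((2 + L + L') * (a + c + 1)) + L') / 2 <=
  (2 + L + L') ^+ 2 * (a + c + 1).
Proof.
move=> L0 L'0 a0 c0.
have : 0 <= L * a by rewrite mulr_ge0.
have : 0 <= L * c by rewrite mulr_ge0.
have : 0 <= L' * a by rewrite mulr_ge0.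
have : 0 <= L' * c by rewrite mulr_ge0.
have : 0 <= L * L' by rewrite mulr_ge0.
have : 0 <= L * L' * a by rewrite !mulr_ge0.
have : 0 <= L * L' * c by rewrite !mulr_ge0.
have : 0 <= L ^+ 2 by exact: sqr_ge0.
have : 0 <= L ^+ 2 * a by rewrite mulr_ge0 ?sqr_ge0.
have : 0 <= L ^+ 2 * c by rewrite mulr_ge0 ?sqr_ge0.
have : 0 <= L' ^+ 2 by exact: sqr_ge0.
have : 0 <= L' ^+ 2 * a by rewrite mulr_ge0 ?sqr_ge0.
have : 0 <= L' ^+ 2 * c by rewrite mulr_ge0 ?sqr_ge0.
by lra.
Qed.

Section Leapfrog.
Context {R : realType} {E : normedModType R}.
Variables (G : E -> E) (h : R).

(** [psi] with an arbitrary force on an arbitrary normed space. For [G := C_grad lam DPhi] the two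
    are convertible, which is how the estimates reach [psi]. *)
Definition leap (z : E * E) : E * E :=
  let q := z.1 in let v := z.2 in
  let q1 := cos h *: q + sin h *: v - (h / 2 * sin h) *: G q in
  let v1 := - sin h *: q + cos h *: v - (h / 2 * cos h) *: G q
            - (h / 2) *: G q1 in
  (q1, v1).

Definition psize (z : E * E) : R := `|z.1| + `|z.2|.

Lemma psize_ge0 z : 0 <= psize z.
Proof. exact: addr_ge0. Qed.

Lemma le_psize1 z : `|z.1| <= psize z. Proof. by rewrite lerDl. Qed.

Lemma psizeD z w : psize (z + w) <= psize z + psize w.
Proof. by rewrite /psize addrACA lerD // ler_normD. Qed.

Variables L L' : R.
Hypothesis L0 : 0 < L.
Hypothesis L'0 : 0 <= L'.
Hypothesis GL : forall x y, `|G x - G y| <= L * `|x - y|.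
Hypothesis GB : forall x, `|G x| <= L * `|x| + L'.
Hypothesis h01 : 0 <= h <= 1.

(** Both rates are quadratic in the constants because the second half kick evaluates the force at
    the updated position, which already contains one force. *)
Definition lip_rate := (1 + L) ^+ 2.
Definition growth_rate := (2 + L + L') ^+ 2.

Let h0 : 0 <= h. Proof. by case/andP: h01. Qed.
Let h1 : h <= 1. Proof. by case/andP: h01. Qed.

Let sin_le : `|sin h| <= h.
Proof. by rewrite ger0_norm ?sin_ge0_01 // sin_le_id. Qed.

Let hsin_le : `|h / 2 * sin h| <= h / 2.
Proof. by rewrite normrM ger0_norm ?divr_ge0 // ler_piMr ?divr_ge0 ?sin_max. Qed.

Let hcos_le : `|h / 2 * cos h| <= h / 2.
Proof. by rewrite normrM ger0_norm ?divr_ge0 // ler_piMr ?divr_ge0 ?cos_max. Qed.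

Let cosB1_le : `|cos h - 1| <= h / 2.
Proof.
rewrite ler0_norm ?subr_le0 ?cos_le1 // opprB.
have := cos_ge_quad h0; have : h ^+ 2 <= h by rewrite expr2 ler_piMl.
lra.
Qed.

Let h2_le1 : h / 2 <= 1. Proof. by have := h1; lra. Qed.

Lemma normZ_le (k : R) c (x : E) : `|k| <= c -> `|k *: x| <= c * `|x|.
Proof. by move=> kc; rewrite normrZ ler_wpM2r. Qed.

Lemma leap_lip z w : psize (leap z - leap w) <= (1 + lip_rate * h) * psize (z - w).
Proof.
case: z w => [q v] [x y]; rewrite /psize /=.
set dq := q - x; set dv := v - y; set dG := G q - G x.
set q1 := cos h *: q + _ - _; set x1 := cos h *: x + _ - _.
have dGL : `|dG| <= L * `|dq| by exact: GL.
have E1 : q1 - x1 = cos h *: dq + sin h *: dv - (h / 2 * sin h) *: dG.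
  rewrite /q1 /x1 /dq /dv /dG !scalerBr !opprD !opprK.
  by rewrite [LHS]addrACA; congr (_ + _); exact: addrACA.
have E2 : (- sin h *: q + cos h *: v - (h / 2 * cos h) *: G q - (h / 2) *: G q1)
    - (- sin h *: x + cos h *: y - (h / 2 * cos h) *: G x - (h / 2) *: G x1) =
    - sin h *: dq + cos h *: dv - (h / 2 * cos h) *: dG
    - (h / 2) *: (G q1 - G x1).
  rewrite /dq /dv /dG !scalerBr !opprD !opprK.
  rewrite [LHS]addrACA; congr (_ + _).
  rewrite [LHS]addrACA; congr (_ + _).
  exact: addrACA.
rewrite E1 E2.
have B1 : `|q1 - x1| <= `|dq| + h * `|dv| + h / 2 * (L * `|dq|).
  rewrite E1; apply: le_trans (ler_normB _ _) _; apply: lerD.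
    apply: le_trans (ler_normD _ _) _; apply: lerD; last exact: normZ_le.
    by rewrite -[leRHS]mul1r; apply: normZ_le; exact: cos_max.
  apply: le_trans (normZ_le _ hsin_le) _.
  by rewrite ler_wpM2l // divr_ge0.
have B2 : `|- sin h *: dq + cos h *: dv - (h / 2 * cos h) *: dG
    - (h / 2) *: (G q1 - G x1)| <=
    h * `|dq| + `|dv| + h / 2 * (L * `|dq|) + h / 2 * (L * `|q1 - x1|).
  apply: le_trans (ler_normB _ _) _; apply: lerD.
    apply: le_trans (ler_normB _ _) _; apply: lerD.
      apply: le_trans (ler_normD _ _) _; apply: lerD.
        by apply: normZ_le; rewrite normrN.
      by rewrite -[leRHS]mul1r; apply: normZ_le; exact: cos_max.
    apply: le_trans (normZ_le _ hcos_le) _.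
    by rewrite ler_wpM2l // divr_ge0.
  rewrite normrZ ger0_norm ?divr_ge0 // ler_wpM2l ?divr_ge0 //.
rewrite -E1; apply: le_trans (lerD B1 B2) _.
set a := `|dq|; set c := `|dv|; set d := `|q1 - x1| in B1 *.
have a0 : 0 <= a by exact: normr_ge0.
have c0 : 0 <= c by exact: normr_ge0.
have d2 : d <= (2 + L) * (a + c).
  apply: le_trans B1 _; rewrite -/a -/c.
  have : h * c <= c by rewrite ler_piMl.
  have La0 : 0 <= L * a by rewrite mulr_ge0 // ltW.
  have : h / 2 * (L * a) <= 1 * (L * a) by rewrite ler_wpM2r.
  have : 0 <= L * c by rewrite mulr_ge0 // ltW.
  by lra.
have hLd : h / 2 * (L * d) <= h / 2 * (L * ((2 + L) * (a + c))).
  by rewrite ler_wpM2l ?divr_ge0 // ler_pM2l.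
rewrite /lip_rate.
have hL : 0 <= h * L by rewrite mulr_ge0 // ltW.
have hL2 : 0 <= h * L ^+ 2 by rewrite mulr_ge0 // sqr_ge0.
have : 0 <= h * L * c by rewrite mulr_ge0.
have : 0 <= h * L ^+ 2 * (a + c) by rewrite mulr_ge0 // addr_ge0.
by rewrite !expr2 in hLd *; lra.
Qed.

(** Bounding the increment rather than the new state serves twice: iterated, it gives exponential
    growth; summed, it gives the displacement. *)
Lemma leap_growth z :
  psize (leap z - z) <= growth_rate * h * (psize z + 1).
Proof.
case: z => [q v]; rewrite /psize /=.
set q1 := cos h *: q + _ - _.
have E1 : q1 - q = (cos h - 1) *: q + sin h *: v - (h / 2 * sin h) *: G q.
  rewrite /q1; have [f [-> -> -> _ [fD fN fZ]]] := lincomb q v (G q) 0.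
  by rewrite !(fZ, fN, fD); congr f; ring.
have E2 : - sin h *: q + cos h *: v - (h / 2 * cos h) *: G q - (h / 2) *: G q1 - v
   = - sin h *: q + (cos h - 1) *: v - (h / 2 * cos h) *: G q - (h / 2) *: G q1.
  move: (G q1) => Gq1.
  have [f [-> -> -> -> [fD fN fZ]]] := lincomb q v (G q) Gq1.
  by rewrite !(fZ, fN, fD); congr f; ring.
rewrite E2.
set a := `|q|; set c := `|v|.
have a0 : 0 <= a by exact: normr_ge0.
have c0 : 0 <= c by exact: normr_ge0.
have B1 : `|q1 - q| <= h / 2 * a + h * c + h / 2 * (L * a + L').
  rewrite E1; apply: le_trans (ler_normB _ _) _; apply: lerD.
    by apply: le_trans (ler_normD _ _) _; apply: lerD; exact: normZ_le.
  apply: le_trans (normZ_le _ hsin_le) _.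
  by rewrite ler_wpM2l // divr_ge0.
have Gq1 : `|G q1| <= L * ((2 + L + L') * (a + c + 1)) + L'.
  apply: le_trans (GB _) _; rewrite lerD2r ler_pM2l //.
  have -> : q1 = q + (q1 - q) by rewrite addrC subrK.
  apply: le_trans (ler_normD _ _) _; apply: le_trans (lerD (lexx _) B1) _.
  have : h * c <= c by rewrite ler_piMl.
  have : h / 2 * (L * a + L') <= 1 * (L * a + L').
    by rewrite ler_wpM2r ?addr_ge0 // mulr_ge0 // ltW.
  have : h / 2 * a <= 1 * a by rewrite ler_wpM2r.
  have : 0 <= L * (c + 1) by rewrite mulr_ge0 ?addr_ge0 // ltW.
  have : 0 <= L' * (a + c) by rewrite mulr_ge0 ?addr_ge0.
  by rewrite -/a; lra.
have B2 : `|- sin h *: q + (cos h - 1) *: v - (h / 2 * cos h) *: G q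
    - (h / 2) *: G q1| <= h * a + h / 2 * c + h / 2 * (L * a + L')
    + h / 2 * (L * ((2 + L + L') * (a + c + 1)) + L').
  apply: le_trans (ler_normB _ _) _; apply: lerD.
    apply: le_trans (ler_normB _ _) _; apply: lerD.
      apply: le_trans (ler_normD _ _) _; apply: lerD; last exact: normZ_le.
      by apply: normZ_le; rewrite normrN.
    apply: le_trans (normZ_le _ hcos_le) _.
    by rewrite ler_wpM2l // divr_ge0.
  by rewrite normrZ ger0_norm ?divr_ge0 // ler_wpM2l ?divr_ge0.
apply: le_trans (lerD B1 B2) _; rewrite /growth_rate.
rewrite [leLHS](_ : _ = h * (a / 2 + c + (L * a + L') / 2 + a + c / 2
  + (L * a + L') / 2 + (L * ((2 + L + L') * (a + c + 1)) + L') / 2)); last by field.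
rewrite [leRHS](_ : _ = h * ((2 + L + L') ^+ 2 * (a + c + 1))); last by ring.
rewrite ler_wpM2l //.
exact: growth_poly_le (ltW L0) _ _ _.
Qed.

Lemma expr_le_expR (k : R) n : 0 <= k -> n%:R * h <= 1 ->
  (1 + k * h) ^+ n <= expR k.
Proof.
move=> k0 nh; apply: le_trans (_ : expR (k * h) ^+ n <= _).
  rewrite lerXn2r ?nnegrE ?expR_ge0 ?expR_ge1Dx //.
  by rewrite addr_ge0 // mulr_ge0.
rewrite -expRM_natl ler_expR mulrCA -[leRHS]mulr1.
by rewrite ler_wpM2l.
Qed.

Lemma iter_leap_lip n z w : n%:R * h <= 1 ->
  psize (iter n leap z - iter n leap w) <= expR lip_rate * psize (z - w).
Proof.
have r0 : 0 <= lip_rate by exact: sqr_ge0.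
move=> nh; apply: le_trans (_ : (1 + lip_rate * h) ^+ n * psize (z - w) <= _).
  elim: n {nh} => [|n IH]; first by rewrite expr0 mul1r.
  rewrite !iterS exprS -mulrA (le_trans (leap_lip _ _)) // ler_wpM2l //.
  by rewrite addr_ge0 // mulr_ge0.
by rewrite ler_wpM2r ?psize_ge0 // expr_le_expR.
Qed.

Lemma iter_leap_growth n z : n%:R * h <= 1 ->
  psize (iter n leap z) + 1 <= expR growth_rate * (psize z + 1).
Proof.
have r0 : 0 <= growth_rate by exact: sqr_ge0.
move=> nh.
apply: le_trans (_ : (1 + growth_rate * h) ^+ n * (psize z + 1) <= _).
  elim: n {nh} => [|n IH]; first by rewrite expr0 mul1r.
  rewrite iterS exprS -mulrA; apply: le_trans (ler_wpM2l _ IH); last first.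
    by rewrite addr_ge0 // mulr_ge0.
  set y := iter n leap z; have -> : leap y = y + (leap y - y).
    by rewrite addrC subrK.
  rewrite [leRHS]mulrDl mul1r; have := psizeD y (leap y - y).
  have := leap_growth y; lra.
by rewrite ler_wpM2r ?addr_ge0 ?psize_ge0 // expr_le_expR.
Qed.

(** The increments add up to a factor n h, the elapsed time. Without this factor T the cost of a
    single rejection could not be absorbed by a gain of order T^2. *)
Lemma iter_leap_dist n z : n%:R * h <= 1 ->
  psize (iter n leap z - z) <=
  n%:R * h * (growth_rate * expR growth_rate * (psize z + 1)).
Proof.
elim: n => [|n IH] nh.
  by rewrite subrr /psize !normr0 addr0 mulr0n !mul0r.
have nh' : n%:R * h <= 1 by apply: le_trans nh; rewrite ler_wpM2r // ler_nat.
rewrite iterS; set y := iter n leap z in IH *.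
have -> : leap y - z = (y - z) + (leap y - y) by rewrite [RHS]addrC addrA subrK.
apply: le_trans (psizeD _ _) _.
rewrite mulrSr mulrDl mulrDl mul1r; apply: lerD (IH nh') _.
apply: le_trans (leap_growth _) _.
rewrite [leRHS](_ : _ = growth_rate * h *
  (expR growth_rate * (psize z + 1))); last by ring.
rewrite ler_wpM2l; first by [].
  by rewrite mulr_ge0 ?sqr_ge0.
exact: iter_leap_growth nh'.
Qed.

End Leapfrog.

(** * The scale of Hilbert spaces *)

Section HsFacts.
Context {R : realType}.
Implicit Types (s t k : R).

Lemma HsnormE s (a : Hs s) : `|a| = norm_s a. Proof. by []. Qed.

Lemma Hs_ip_normE s (a : Hs s) : ip_s s a a = `|a| ^+ 2.
Proof. by rewrite HsnormE norm_s_sqr. Qed.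

Lemma ip_sDl s (a b c : Hs s) : ip_s s (a + b) c = ip_s s a c + ip_s s b c.
Proof. by rewrite /ip_s coordsD ip_termDl lim_seriesD //; exact: cvg_ip_s. Qed.

Lemma ip_sZl s k (a b : Hs s) : ip_s s (k *: a) b = k * ip_s s a b.
Proof.
rewrite /ip_s coordsZ -[RHS]lim_seriesZ; last exact: cvg_ip_s.
congr (limn (series _)); apply/funext => j.
by rewrite /ip_term /GRing.scale /= /GRing.scale /=; ring.
Qed.

Lemma ip_sC s (a b : Hs s) : ip_s s a b = ip_s s b a.
Proof. by rewrite /ip_s ip_termC. Qed.

Lemma norm_ip_s_le s (a b : Hs s) : `|ip_s s a b| <= `|a| * `|b|.
Proof.
by apply: (@norm_ip_le _ _ (fun a b : Hs s => ip_s s a b));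
  [exact: ip_sDl|exact: ip_sZl|exact: ip_sC|exact: Hs_ip_normE].
Qed.

Lemma to_HsE s (a : nat -> R) : a \in sq_summable s -> coords (to_Hs s a) = a.
Proof. by move=> sa; rewrite /to_Hs (insubdK (0 : Hs s) sa). Qed.

Lemma weightN s j : j.+1%:R `^ (2 * - s) * j.+1%:R `^ (2 * s) = 1 :> R.
Proof.
rewrite mulrN powRN mulVf // gt_eqF //; exact: weight_gt0.
Qed.

Lemma sq_summable_le s t k (a : nat -> R) (b : nat -> R) :
  (forall j, ip_term s a a j <= k * ip_term t b b j) ->
  b \in sq_summable t -> a \in sq_summable s.
Proof.
move=> ab /asboolP cb; apply/asboolP.
apply: (series_le_cvg (v_ := `|k| *: ip_term t b b)).
- by move=> j; exact: ip_term_ge0.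
- by move=> j; rewrite mulr_ge0 ?ip_term_ge0.
- move=> j; apply: le_trans (ab j) _.
  by rewrite ler_wpM2r ?ip_term_ge0 // ler_norm.
- exact: is_cvg_seriesZ.
Qed.

Lemma ler_norm_Hs s t k (a : Hs s) (b : Hs t) : 0 <= k ->
  (forall j, ip_term s a a j <= k ^+ 2 * ip_term t b b j) -> `|a| <= k * `|b|.
Proof.
move=> k0 ab; rewrite -(@ler_pXn2r _ 2) ?nnegrE ?mulr_ge0 //.
rewrite exprMn -!Hs_ip_normE /ip_s.
have cz : cvgn (series (k ^+ 2 *: ip_term t b b)).
  by apply: is_cvg_seriesZ; exact: cvg_ip_s.
rewrite -[leRHS]lim_seriesZ; last exact: cvg_ip_s.
by apply: lim_series_le => //; exact: cvg_ip_s.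
Qed.

Section DualPair.
Context {l : R}.
Implicit Types (f : Hs (- l)) (u : Hs l).

(** The Riesz isometry from [Hs l] onto its dual. It turns the dual pairing into an inner product of
    [Hs (- l)], so that bilinearity and Cauchy-Schwarz carry over. *)
Definition riesz u : Hs (- l) :=
  to_Hs (- l) (fun j => j.+1%:R `^ (2 * l) * u j).

Lemma rieszE u : coords (riesz u) = fun j => j.+1%:R `^ (2 * l) * u j.
Proof.
apply: to_HsE; apply: (@sq_summable_le _ l 1 _ u); last exact: valP.
move=> j; rewrite mul1r /ip_term.
apply/eqW; rewrite -[RHS]mul1r; move: (weightN l j).
by set w := powR _ _; set w' := powR _ _ => <-; ring.
Qed.

Lemma norm_riesz u : `|riesz u| = `|u|.
Proof.
rewrite !HsnormE /norm_s /ip_s; congr (Num.sqrt (limn (series _))).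
apply/funext => j; rewrite /ip_term rieszE.
rewrite -[RHS]mul1r; move: (weightN l j).
by set w := powR _ _; set w' := powR _ _ => <-; ring.
Qed.

Lemma dual_pairE f u : dual_pair f u = ip_s (- l) f (riesz u).
Proof.
rewrite /dual_pair /ip_s; congr (limn (series _)); apply/funext => j.
rewrite /ip_term rieszE.
rewrite -[LHS]mul1r; move: (weightN l j).
by set w := powR _ _; set w' := powR _ _ => <-; ring.
Qed.

Lemma rieszD u v : riesz (u + v) = riesz u + riesz v.
Proof.
by apply/val_inj/funext => j; rewrite /= !rieszE; exact: mulrDr.
Qed.

Lemma rieszZ k u : riesz (k *: u) = k *: riesz u.
Proof.
by apply/val_inj/funext => j; rewrite /= !rieszE; exact: mulrCA.
Qed.

Lemma dual_pairDl f g u : dual_pair (f + g) u = dual_pair f u + dual_pair g u.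
Proof. by rewrite !dual_pairE ip_sDl. Qed.

Lemma dual_pairZl k f u : dual_pair (k *: f) u = k * dual_pair f u.
Proof. by rewrite !dual_pairE ip_sZl. Qed.

Lemma dual_pairDr f u v : dual_pair f (u + v) = dual_pair f u + dual_pair f v.
Proof. by rewrite !dual_pairE rieszD ip_sC ip_sDl !(ip_sC _ f). Qed.

Lemma dual_pairZr k f u : dual_pair f (k *: u) = k * dual_pair f u.
Proof. by rewrite !dual_pairE rieszZ ip_sC ip_sZl ip_sC. Qed.

Lemma dual_pairBl f g u : dual_pair (f - g) u = dual_pair f u - dual_pair g u.
Proof. by rewrite dual_pairDl -scaleN1r dual_pairZl mulN1r. Qed.

Lemma dual_pairBr f u v : dual_pair f (u - v) = dual_pair f u - dual_pair f v.
Proof. by rewrite dual_pairDr -scaleN1r dual_pairZr mulN1r. Qed.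

Lemma norm_dual_pair_le f u : `|dual_pair f u| <= `|f| * `|u|.
Proof. by rewrite dual_pairE -(norm_riesz u) norm_ip_s_le. Qed.

End DualPair.

(** * Eigenvalue decay and the diagonal operators C and C^(1/2) *)

Section EigenvalueDecay.
Variables (lam : nat -> R) (kappa l : R).
Hypothesis lam0 : forall j, 0 < lam j.
Hypothesis decay : eigenvalue_decay lam kappa.
Hypothesis lkappa : 0 <= l < kappa - 2^-1.

Lemma decay_bound : exists2 K : R, 0 < K &
  forall j, j.+1%:R `^ kappa * lam j <= K.
Proof.
case: decay => _ [_]; rewrite /limn_esup /limf_esup.
move=> /ereal_inf_lt[_ /= [V nV <-]] Vlt.
pose w j := j.+1%:R `^ kappa * lam j.
have w0 j : 0 < w j by rewrite mulr_gt0 ?powR_gt0.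
case: nV => n _ nV.
set sV := ereal_sup _ in Vlt.
have Vn j : (n <= j)%N -> ((w j)%:E <= sV)%E.
  by move=> nj; apply: ereal_sup_ubound; exists j => //; exact: nV.
have sV0 : (0 < sV)%E.
  by apply: lt_le_trans (Vn n (leqnn n)); rewrite lte_fin.
have sVfin : sV \is a fin_num by rewrite fin_numElt Vlt andbT (lt_trans _ sV0).
(* The finite upper limit bounds only a tail; the finitely many earlier terms are added to the
   bound. *)
exists (fine sV + \sum_(i < n) w i).
  rewrite ltr_wpDr ?sumr_ge0 // => [i _|]; first exact: ltW.
  by rewrite fine_gt0 // sV0.
move=> j; rewrite -/(w j); have [nj|jn] := leqP n j.
  rewrite -[leLHS]addr0 lerD //; last by rewrite sumr_ge0 // => i _; exact: ltW.
  by rewrite -lee_fin fineK // Vn.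
rewrite (bigD1 (Ordinal jn)) //= addrCA lerDl addr_ge0 //.
  by rewrite fine_ge0 // ltW.
by rewrite sumr_ge0 // => i _; exact: ltW.
Qed.

Lemma lam_le : exists2 K : R, 0 < K &
  forall j, lam j ^+ 2 <= K * j.+1%:R `^ (2 * - kappa).
Proof.
have [K K0 Kw] := decay_bound; exists (K ^+ 2); first exact: exprn_gt0.
move=> j; set w := powR _ _; have w0 : 0 <= w by exact: powR_ge0.
rewrite -[leLHS]mul1r -[X in X * _](weightN kappa j) -/w -mulrA mulrC.
rewrite ler_wpM2r // [2 * kappa]mulrC powRrM powR_mulrn ?powR_ge0 // -exprMn.
rewrite lerXn2r ?nnegrE ?mulr_ge0 ?powR_ge0 //; last exact: ltW.
  exact: ltW.
Qed.

Lemma lam_weight_le : exists2 K : R, 0 < K &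
  forall j, j.+1%:R `^ (2 * l) * lam j ^+ 2 <= K ^+ 2.
Proof.
have [K K0 lK] := lam_le; exists (Num.sqrt K); first by rewrite sqrtr_gt0.
move=> j; rewrite sqr_sqrtr; last exact: ltW.
apply: le_trans (_ : j.+1%:R `^ (2 * l) * (K * j.+1%:R `^ (2 * - kappa)) <= _).
  by rewrite ler_wpM2l ?powR_ge0.
rewrite mulrCA -[leRHS]mulr1 ler_pM2l // -powRD; last first.
  by rewrite pnatr_eq0 implybT.
rewrite -[leRHS](powRr0 j.+1%:R) ler_powR ?ler1n //.
by move: lkappa => /andP[_]; lra.
Qed.

Lemma diag_term_le K (a : nat -> R) j :
  j.+1%:R `^ (2 * l) * lam j ^+ 2 <= K ^+ 2 ->
  ip_term 0 (fun j => lam j * a j) (fun j => lam j * a j) j <=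
  K ^+ 2 * ip_term (- l) a a j.
Proof.
move=> lK; rewrite /ip_term mulr0 powRr0.
rewrite [leLHS](_ : _ = lam j ^+ 2 * (a j * a j)); last by ring.
rewrite [leRHS]mulrA ler_wpM2r //; first by rewrite -expr2 sqr_ge0.
move: (weightN l j) lK (weight_gt0 (- l) j).
set w := powR _ _; set w' := powR _ _ => ww' lK w0.
apply: le_trans (_ : w * (w' * lam j ^+ 2) <= _); first by rewrite mulrA ww' mul1r !expr2.
by rewrite [leRHS]mulrC ler_pM2l.
Qed.

(** Telescoping comparison: with e = a - 1 and x = j + 2, e x^(-a) <= (x - 1)^(-e) - x^(-e), which
    is (1 - 1/x)^(-e) >= 1 + e/x in disguise. *)
Lemma series_powR_cvg (a : R) : 1 < a ->
  cvgn (series (fun j => j.+1%:R `^ (- a) : R)).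
Proof.
move=> a1; set e := a - 1; have e0 : 0 < e by rewrite subr_gt0.
pose v (j : nat) : R := j.+1%:R `^ (- e).
have v0 j : 0 < v j by rewrite powR_gt0.
have step j : e * (j.+2%:R `^ (- a)) <= v j - v j.+1.
  rewrite /v; set x : R := j.+2%:R; have x0 : 0 < x by [].
  have xj : j.+1%:R = x * (1 - x^-1) :> R.
    by rewrite mulrBr mulr1 mulfV ?gt_eqF // /x [in RHS]mulrSr addrK.
  have y0 : 0 < 1 - x^-1 by rewrite -(pmulr_rgt0 _ x0) -xj.
  rewrite xj powRM //; last exact: ltW.
  rewrite (_ : - a = - e + - 1); last by rewrite /e; ring.
  rewrite powRD; last by rewrite (gt_eqF x0) implybT.
  rewrite powR_inv1 // mulrCA -[X in _ <= _ - X]mulr1 -mulrBr.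
  rewrite ler_pM2l ?powR_gt0 // lerBrDr addrC /powR (gt_eqF y0).
  apply: le_trans (expR_ge1Dx _); rewrite lerD2l mulNr -mulrN.
  rewrite ler_pM2l // lerNr; apply: le_ln1Dx.
  by rewrite ltrN2 invf_lt1 // /x ltr1n.
have part n : series (fun j => j.+1%:R `^ (- a) : R) n.+1 <=
    1 + e^-1 * (v 0%N - v n).
  elim: n => [|n IH].
    by rewrite /series /= big_nat1 subrr mulr0 addr0 powR1.
  rewrite seriesSr (le_trans (lerD IH (lexx _))) // -addrA lerD2l.
  rewrite -lerBrDl -mulrBr (_ : _ - _ - _ = v n - v n.+1); last by ring.
  by rewrite ler_pdivlMl // step.
apply: nondecreasing_is_cvgn.
  by apply: nondecreasing_series => j _ _; exact: powR_ge0.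
exists (1 + e^-1 * v 0%N) => _ [n _ <-].
have sn : series (fun j => j.+1%:R `^ (- a) : R) n <=
    series (fun j => j.+1%:R `^ (- a) : R) n.+1.
  by rewrite [leRHS]seriesSr lerDl powR_ge0.
apply: le_trans sn (le_trans (part n) _).
by rewrite lerD2l ler_pM2l ?invr_gt0 // gerBl ltW.
Qed.

(** The sum is the trace of the covariance of the velocity in [Hs l]; the gap 1/2 between l and
    kappa makes the exponent 2 (kappa - l) exceed 1. *)
Lemma trace_cvg :
  cvgn (series (fun j => j.+1%:R `^ (2 * l) * lam j ^+ 2)).
Proof.
have [K K0 lK] := lam_le.
have a1 : 1 < 2 * (kappa - l) by move: lkappa => /andP[_]; lra.
apply: (series_le_cvg (v_ := K *: (fun j => j.+1%:R `^ (- (2 * (kappa - l)))))).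
- by move=> j; rewrite mulr_ge0 ?powR_ge0 ?sqr_ge0.
- by move=> j; rewrite mulr_ge0 ?powR_ge0 // ltW.
- move=> j.
  apply: le_trans (_ : j.+1%:R `^ (2 * l) * (K * j.+1%:R `^ (2 * - kappa)) <= _).
    by rewrite ler_wpM2l ?powR_ge0.
  rewrite mulrCA -powRD; last by rewrite pnatr_eq0 implybT.
  by rewrite (_ : _ + _ = - (2 * (kappa - l))) //; ring.
- by apply: is_cvg_seriesZ; exact: series_powR_cvg.
Qed.

(** The decay of the eigenvalues keeps the image square summable and so excludes the default value 0
    of [diag_op]. *)
Lemma diag_lamE (a : Hs (- l)) :
  coords (diag_op lam 0 a) = fun j => lam j * a j.
Proof.
have [K K0 lK] := lam_weight_le.
apply: to_HsE; apply: (@sq_summable_le _ (- l) (K ^+ 2) _ a); last exact: valP.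
move=> j; exact: diag_term_le.
Qed.

Lemma diag_lam2E (a : Hs (- l)) :
  coords (diag_op (fun j => lam j ^+ 2) l a) = fun j => lam j ^+ 2 * a j.
Proof.
have [K K0 lK] := lam_weight_le.
apply: to_HsE; apply: (@sq_summable_le _ (- l) (K ^+ 2 * K ^+ 2) _ a); last exact: valP.
move=> j; rewrite /ip_term; have w0 := weight_gt0 (- l) j.
move: (weightN l j) (lK j) w0.
set w := powR _ _; set w' := powR _ _ => ww' {}lK w0.
have w'0 : 0 <= w' by exact: powR_ge0.
have -> : w' * (lam j ^+ 2 * a j * (lam j ^+ 2 * a j)) =
    (w' * lam j ^+ 2) * (w' * lam j ^+ 2) * (w * (a j * a j)).
  rewrite -[LHS]mul1r -ww'; ring.
have aj0 : 0 <= w * (a j * a j)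
  by apply: mulr_ge0; [exact: ltW|rewrite -expr2 sqr_ge0].
rewrite ler_wpM2r //.
by apply: ler_pM => //; rewrite mulr_ge0 ?sqr_ge0.
Qed.

Lemma sqrtC_lipschitz : exists2 K : R, 0 < K & (forall a b : Hs (- l),
    `|diag_op lam 0 a - diag_op lam 0 b| <= K * `|a - b|) /\
  (forall a : Hs (- l), `|diag_op lam 0 a| <= K * `|a|).
Proof.
have [K K0 lK] := lam_weight_le; exists K => //; split=> [a b|a].
  apply: ler_norm_Hs; first exact: ltW.
  have E : coords (diag_op lam 0 a - diag_op lam 0 b) =
      fun j => lam j * (a - b) j.
    apply/funext => i; rewrite -[LHS]/(diag_op lam 0 a i - diag_op lam 0 b i).
    by rewrite !diag_lamE -mulrBr.
  by move=> j; rewrite E; exact: diag_term_le (lK j).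
apply: ler_norm_Hs; first exact: ltW.
by move=> j; rewrite diag_lamE; exact: diag_term_le (lK j).
Qed.

(** Turns the pairing of [DPhi] with a half kick into the squared norm that occurs in [DeltaH]. *)
Lemma dual_pair_diag (a : Hs (- l)) :
  dual_pair a (diag_op (fun j => lam j ^+ 2) l a) = `|diag_op lam 0 a| ^+ 2.
Proof.
rewrite -Hs_ip_normE /dual_pair /ip_s; congr (limn (series _)).
apply/funext => j; rewrite /ip_term diag_lamE diag_lam2E mulr0 powRr0.
by ring.
Qed.

End EigenvalueDecay.
End HsFacts.

(** * Derivatives along curves *)

Section CurveDerivative.
Context {R : realType}.

Lemma is_derive_small (e : R -> R) (s : R) : e s = 0 ->
  (forall eps, 0 < eps -> \forall t \near (0 : R), `|e (s + t)| <= eps * `|t|) ->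
  is_derive s 1 e 0.
Proof.
move=> es0 small.
have q0 : t^-1 *: ((e \o shift s) (t *: 1) - e s) @[t --> 0^'] --> 0.
  apply/cvgr0Pnorm_le => eps eps0.
  apply/nbhs_dnbhs; near=> t.
  rewrite es0 subr0 /= normrZ normfV.
  have [->|t0] := eqVneq t 0; first by rewrite normr0 invr0 mul0r ltW.
  rewrite ler_pdivrMl ?normr_gt0 // mulrC.
  rewrite (_ : t *: 1 + s = s + t); last by rewrite addrC [_ *: _]mulr1.
  by near: t; exact: small.
by apply: DeriveDef; [apply/cvg_ex; exists 0|exact: cvg_lim].
Unshelve. all: by end_near. Qed.

Lemma derive_lipschitz_near (a : R -> R) (s a' : R) : is_derive s 1 a a' ->
  \forall t \near (0 : R), `|a (s + t) - a s| <= (`|a'| + 1) * `|t|.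
Proof.
move=> [ad aE]; have q : t^-1 *: ((a \o shift s) (t *: 1) - a s) @[t --> 0^'] --> a'.
  by rewrite -aE; exact: ad.
have /cvgr_distC_le/(_ 1 ltr01) := q; rewrite near_withinE => qn.
near=> t; have [->|t0] := eqVneq t 0.
  by rewrite addr0 subrr normr0 mulr0.
have : `|t^-1 *: ((a \o shift s) (t *: 1) - a s) - a'| <= 1.
  have : t != 0 -> `|t^-1 *: ((a \o shift s) (t *: 1) - a s) - a'| <= 1.
    near: t; apply: qn.
  exact.
rewrite /= (_ : t *: 1 + s = s + t); last by rewrite addrC [_ *: _]mulr1.
set d := a (s + t) - a s => d1.
have : `|t^-1 *: d| <= `|a'| + 1.
  rewrite -[_ *: d](subrK a') addrC (le_trans (ler_normD _ _)) // lerD2l //.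
by rewrite normrZ normfV ler_pdivrMl ?normr_gt0 // mulrC.
Unshelve. all: by end_near. Qed.

Context {E : normedModType R}.

Definition rlinear (l : E -> R) : Prop :=
  forall k x y, l (k *: x + y) = k * l x + l y.

Lemma rlinear0 (l : E -> R) : rlinear l -> l 0 = 0.
Proof.
move=> ll; have := ll 1 0 0; rewrite scaler0.
by rewrite addr0 mul1r; lra.
Qed.

Lemma rlinearZ (l : E -> R) k x : rlinear l -> l (k *: x) = k * l x.
Proof. by move=> ll; have := ll k x 0; rewrite (rlinear0 ll) !addr0. Qed.

(** The curve stays in the span of q and p, so its chain rule involves l only through the two
    numbers l q and l p. *)
Lemma frechet_curve (f : E -> R) (l : E -> R) (q p : E) (a b : R -> R)
  (s a' b' : R) :
  rlinear l ->
  (forall eps, 0 < eps -> \forall u \near (0 : E),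
     `|f (a s *: q + b s *: p + u) - f (a s *: q + b s *: p) - l u|
       <= eps * `|u|) ->
  is_derive s 1 a a' -> is_derive s 1 b b' ->
  is_derive s 1 (fun t => f (a t *: q + b t *: p)) (a' * l q + b' * l p).
Proof.
move=> llin fl da db; set x := a s *: q + b s *: p in fl.
pose e t := f (a t *: q + b t *: p) - f x - l ((a t - a s) *: q + (b t - b s) *: p).
have cE t : a t *: q + b t *: p = x + ((a t - a s) *: q + (b t - b s) *: p).
  by rewrite /x addrACA -!scalerDl (addrC (a s)) (addrC (b s)) !subrK.
have lZ k y : l (k *: y) = k * l y by exact: rlinearZ.
have l0 : l 0 = 0 by exact: rlinear0.
have fE : (fun t => f (a t *: q + b t *: p)) =
    (fun t => e t + (f x + (a t - a s) * l q + (b t - b s) * l p)).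
  by apply/funext => t; rewrite /e llin lZ; ring.
have de : is_derive s 1 e 0.
  apply: is_derive_small; first by rewrite /e -/x !subrr !scale0r addr0 l0 subrr.
  move=> eps eps0.
  (* A Lipschitz constant of the curve near s; the final 1 keeps it positive, so that eps / K is a
     legitimate tolerance. *)
  pose K := (`|a'| + 1) * `|q| + (`|b'| + 1) * `|p| + 1.
  have K0 : 0 < K by rewrite ltr_wpDl ?addr_ge0 ?mulr_ge0 ?addr_ge0.
  have /fl : 0 < eps / K by rewrite divr_gt0.
  move=> /nbhs_norm0P[r /= r0 fr].
  near=> t.
  have uK : `|(a (s + t) - a s) *: q + (b (s + t) - b s) *: p| <= K * `|t|.
    apply: le_trans (_ : ((`|a'| + 1) * `|t|) * `|q|
        + ((`|b'| + 1) * `|t|) * `|p| <= _).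
      rewrite (le_trans (ler_normD _ _)) // !normrZ.
      by apply: lerD; rewrite ler_wpM2r //; near: t; exact: derive_lipschitz_near.
    rewrite [leRHS](_ : _ = (`|a'| + 1) * `|t| * `|q|
        + (`|b'| + 1) * `|t| * `|p| + `|t|) ?lerDl //.
    by rewrite /K; ring.
  rewrite /e cE /x; apply: le_trans (fr _ _) _.
    rewrite /= (le_lt_trans uK) // -ltr_pdivlMl // mulrC.
    by near: t; apply: (@nbhs0_lt R R^o); rewrite divr_gt0.
  by rewrite -mulrA ler_pM2l // ler_pdivrMl.
rewrite fE; apply: trigger_derive => /=.
rewrite /GRing.scale /=; ring.
Unshelve. all: by end_near. Qed.

Definition small_error (f : E -> R) (l : E -> R) (x : E) : Prop :=
  forall eps, 0 < eps -> \forall u \near (0 : E),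
    `|f (x + u) - f x - l u| <= eps * `|u|.

Lemma is_derive_unique (g : R -> R) (t A B : R) :
  is_derive t 1 g A -> is_derive t 1 g B -> A = B.
Proof. by move=> [_ <-] [_ <-]. Qed.

Lemma line_derive (f l : E -> R) (x u : E) (t : R) : rlinear l ->
  small_error f l (x + t *: u) -> is_derive t 1 (fun t => f (x + t *: u)) (l u).
Proof.
move=> llin fl.
have -> : (fun t => f (x + t *: u)) = (fun t => f (cst 1 t *: x + id t *: u)).
  by apply/funext => r; rewrite /= scale1r.
rewrite (_ : l u = 0 * l x + 1 * l u); last by rewrite mul0r add0r mul1r.
by apply: frechet_curve => //=; rewrite scale1r.
Qed.

(** Both functionals give the derivative along the line in direction u. This identifies the
    derivatives supplied by [is_Cn] with those built from [DPhi]. *)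
Lemma frechet_unique (f l l' : E -> R) (x u : E) :
  rlinear l -> rlinear l' -> small_error f l x -> small_error f l' x ->
  l u = l' u.
Proof.
move=> ll ll' fl fl'.
by apply: (@is_derive_unique (fun t => f (x + t *: u)) 0);
  apply: line_derive; rewrite ?scale0r ?addr0.
Qed.

Lemma derive_norm_le (g : R -> R) (A K : R) : is_derive (0 : R) 1 g A ->
  (forall t, `|g t - g 0| <= K * `|t|) -> `|A| <= K.
Proof.
move=> [gd gE] gK.
have q : t^-1 *: ((g \o shift 0) (t *: 1) - g 0) @[t --> 0^'] --> A.
  by rewrite -gE; exact: gd.
have qn : `|t^-1 *: ((g \o shift 0) (t *: 1) - g 0)| @[t --> 0^'] --> `|A|.
  by apply: cvg_norm; exact: q.
rewrite -(cvg_lim _ qn) //; apply: limr_le; first by apply: cvgP qn.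
have K0 : 0 <= K by have := gK 1; rewrite normr1 mulr1; exact: le_trans.
apply: nbhs_dnbhs; near=> t.
rewrite /= normrZ normfV addr0 [_ *: 1]mulr1.
have [->|t0] := eqVneq t 0; first by rewrite normr0 invr0 mul0r.
by rewrite ler_pdivrMl ?normr_gt0 // mulrC.
Unshelve. all: by end_near. Qed.

Lemma frechet_norm_le (f l : E -> R) (x u : E) (K : R) :
  rlinear l -> small_error f l x ->
  (forall y, `|f y - f x| <= K * `|y - x|) -> `|l u| <= K * `|u|.
Proof.
move=> ll fl fK; apply: (@derive_norm_le (fun t => f (x + t *: u))).
  by apply: line_derive; rewrite ?scale0r ?addr0.
move=> t; rewrite scale0r addr0 (le_trans (fK _)) // addrAC subrr add0r.
by rewrite normrZ [`|t| * _]mulrC mulrA.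
Qed.

Lemma frechet_lipschitz (f : E -> R) (l : E -> E -> R) (K : R) :
  (forall x, rlinear (l x)) -> (forall x, small_error f (l x) x) ->
  (forall x u, `|l x u| <= K * `|u|) ->
  forall x y, `|f y - f x| <= K * `|y - x|.
Proof.
move=> ll fl lK x y.
have d (t : R) : is_derive t 1 (fun t => f (x + t *: (y - x)))
    (l (x + t *: (y - x)) (y - x)).
  exact: line_derive.
have := norm_mvt0 ler01 d (fun t _ => lK _ _).
by rewrite scale1r scale0r addr0 mulr1 (addrC x) subrK.
Qed.

Lemma mform_le_mono k (A : mform E k) (c c' : R) : c <= c' ->
  mform_le A c -> mform_le A c'.
Proof.
elim: k A c c' => [|k IH] /= A c c' cc'; first by move=> /le_trans; apply.
by move=> Ac u; apply: IH (Ac u); rewrite ler_wpM2r.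
Qed.

(** Evaluating all but the differentiated slot reduces statements about form-valued maps to
    real-valued ones. The tolerance is divided by |w| + 1 to allow for w = 0. *)
Lemma frechet_slice k (F : E -> mform E k.+1) (F' : E -> E -> mform E k.+1) w :
  is_frechet F F' -> is_frechet (fun x => F x w) (fun x u => F' x u w).
Proof.
move=> FF' x; have [lin [c cF] small] := FF' x; split.
- by move=> a u v; rewrite lin.
- exists (c * `|w|) => u; rewrite mulrAC; exact: cF.
- move=> eps eps0; have w0 : 0 < `|w| + 1 by rewrite ltr_wpDl.
  have /small : 0 < eps / (`|w| + 1) by rewrite divr_gt0.
  apply: filterS => u /(_ w); apply: mform_le_mono.
  rewrite mulrAC ler_wpM2r // -mulrA -[leRHS]mulr1 ler_pM2l // mulrC.
  by rewrite ler_pdivrMr // mul1r lerDl.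
Qed.

Lemma frechet0_rlinear (F : E -> mform E 0) (F' : E -> E -> mform E 0) x :
  is_frechet F F' -> rlinear (F' x).
Proof. by move=> FF'; have [lin _ _] := FF' x; exact: lin. Qed.

Lemma frechet0_small (F : E -> mform E 0) (F' : E -> E -> mform E 0) x :
  is_frechet F F' -> small_error F (F' x) x.
Proof. by move=> FF'; have [_ _] := FF' x. Qed.

Lemma differentiable_small (W : normedModType R) (f : E -> W) x :
  differentiable f x -> forall eps, 0 < eps -> \forall u \near (0 : E),
    `|f (x + u) - f x - 'd f x u| <= eps * `|u|.
Proof.
move=> /diff_locallyxC fx eps eps0.
have /eqaddoP/(_ eps eps0) : (fun h => f (x + h)) =
    (fun h => f x + 'd f x h) +o_ (0 : E) (fun h => h).
  by apply/funext => h; rewrite [LHS]fx.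
by apply: filterS => u; rewrite opprD addrA.
Qed.

End CurveDerivative.

(** * Trapezoidal rule along rotations *)

Section RotationCurve.
Context {R : realType} {E : normedModType R}.
Variables (Phi : E -> R) (D1 : E -> E -> R) (D2 : E -> E -> E -> R)
  (D3 : E -> E -> E -> E -> R) (L L' M N : R).
Hypothesis D1lin : forall x, rlinear (D1 x).
Hypothesis D2lin1 : forall x w, rlinear (fun u => D2 x u w).
Hypothesis D2lin2 : forall x u, rlinear (D2 x u).
Hypothesis D3lin1 : forall x u w, rlinear (fun c => D3 x c u w).
Hypothesis D3lin2 : forall x c w, rlinear (fun u => D3 x c u w).
Hypothesis D3lin3 : forall x c u, rlinear (D3 x c u).
Hypothesis Phi_small : forall x, small_error Phi (D1 x) x.
Hypothesis D1_small : forall x w,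
  small_error (fun x => D1 x w) (fun u => D2 x u w) x.
Hypothesis D2_small : forall x u w,
  small_error (fun x => D2 x u w) (fun c => D3 x c u w) x.
Hypotheses (L0 : 0 <= L) (L'0 : 0 <= L') (M0 : 0 <= M) (N0 : 0 <= N).
Hypothesis D1B : forall x u, `|D1 x u| <= (L * `|x| + L') * `|u|.
Hypothesis D1L : forall x y u, `|D1 x u - D1 y u| <= L * `|x - y| * `|u|.
Hypothesis D2B : forall x u w, `|D2 x u w| <= L * `|u| * `|w|.
Hypothesis D2L : forall x y u w,
  `|D2 x u w - D2 y u w| <= M * `|x - y| * `|u| * `|w|.
Hypothesis D3B : forall x c u w, `|D3 x c u w| <= M * `|c| * `|u| * `|w|.
Hypothesis D3L : forall x y c u w,
  `|D3 x c u w - D3 y c u w| <= N * `|x - y| * `|c| * `|u| * `|w|.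

Lemma rlinear2 (l : E -> R) a b q p : rlinear l ->
  l (a *: q + b *: p) = a * l q + b * l p.
Proof. by move=> ll; rewrite ll rlinearZ. Qed.

Lemma rlinearB (l : E -> R) x y : rlinear l -> l (x - y) = l x - l y.
Proof. by move=> ll; rewrite addrC -scaleN1r ll mulN1r addrC. Qed.

Section OneCurve.
Variables q p : E.
(** [rotq] and [rotv] are position and velocity under the free flow q' = v, v' = - q. *)
Definition rotq (s : R) : E := cos s *: q + sin s *: p.
Definition rotv (s : R) : E := (- sin s) *: q + cos s *: p.

Let rotderive (f l : E -> R) (s : R) : rlinear l -> small_error f l (rotq s) ->
  is_derive s 1 (fun t => f (rotq t)) (- sin s * l q + cos s * l p).
Proof. by move=> ll fl; apply: frechet_curve. Qed.

Lemma rot_derive0 (s : R) : is_derive s 1 (fun t => Phi (rotq t))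
  (D1 (rotq s) (rotv s)).
Proof. by rewrite rlinear2 //; exact: rotderive. Qed.

Let d1 w (s : R) : is_derive s 1 (fun t => D1 (rotq t) w)
  (- sin s * D2 (rotq s) q w + cos s * D2 (rotq s) p w).
Proof. exact: (@rotderive (fun x => D1 x w) (fun u => D2 (rotq s) u w)). Qed.

Let d2 u w (s : R) : is_derive s 1 (fun t => D2 (rotq t) u w)
  (- sin s * D3 (rotq s) q u w + cos s * D3 (rotq s) p u w).
Proof.
exact: (@rotderive (fun x => D2 x u w) (fun c => D3 (rotq s) c u w)).
Qed.

Definition rot2 (s : R) : R :=
  D2 (rotq s) (rotv s) (rotv s) - D1 (rotq s) (rotq s).

(** The third derivative of Phi along the rotation. The two argument orders of D2 are kept apart:
    the term with [rotv] first occurs twice, once from D2 and once from differentiating D1 at the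
    moving point. *)
Definition rot3 (s : R) : R :=
  D3 (rotq s) (rotv s) (rotv s) (rotv s) - D2 (rotq s) (rotq s) (rotv s)
  - 2 * D2 (rotq s) (rotv s) (rotq s) - D1 (rotq s) (rotv s).

Let D1E x a b : D1 x (a *: q + b *: p) = a * D1 x q + b * D1 x p.
Proof. exact: rlinear2. Qed.

Let D2E x a b a' b' : D2 x (a *: q + b *: p) (a' *: q + b' *: p) =
  a * (a' * D2 x q q + b' * D2 x q p) + b * (a' * D2 x p q + b' * D2 x p p).
Proof.
rewrite (rlinear2 _ _ _ _ (D2lin1 _ _)).
by rewrite !(rlinear2 _ _ _ _ (D2lin2 _ _)).
Qed.

Let D3E x a b u w : D3 x (a *: q + b *: p) u w = a * D3 x q u w + b * D3 x p u w.
Proof. exact: (rlinear2 _ _ _ _ (D3lin1 _ _ _)). Qed.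

Let D3E' x c a b a' b' : D3 x c (a *: q + b *: p) (a' *: q + b' *: p) =
  a * (a' * D3 x c q q + b' * D3 x c q p)
  + b * (a' * D3 x c p q + b' * D3 x c p p).
Proof.
rewrite (rlinear2 _ _ _ _ (D3lin2 _ _ _)).
by rewrite !(rlinear2 _ _ _ _ (D3lin3 _ _ _)).
Qed.

Let rot2E s : rot2 s =
    (- sin s) * ((- sin s) * D2 (rotq s) q q + cos s * D2 (rotq s) q p)
    + cos s * ((- sin s) * D2 (rotq s) p q + cos s * D2 (rotq s) p p)
    - (cos s * D1 (rotq s) q + sin s * D1 (rotq s) p).
Proof. by rewrite /rot2; congr (_ - _); [exact: D2E|exact: D1E]. Qed.

(** Point and direction both move. Expanding the direction over the fixed vectors q and p leaves
    products of sin and cos with derivatives in constant directions. *)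
Lemma rot_derive1 (s : R) : is_derive s 1 (fun t => D1 (rotq t) (rotv t)) (rot2 s).
Proof.
have -> : (fun t => D1 (rotq t) (rotv t)) =
    (fun t => - sin t * D1 (rotq t) q + cos t * D1 (rotq t) p).
  by apply/funext => t; exact: D1E.
have dq := d1 q s; have dp := d1 p s.
by apply: trigger_derive => /=; rewrite rot2E /GRing.scale /=; ring.
Qed.

Lemma rot_derive2 (s : R) : is_derive s 1 rot2 (rot3 s).
Proof.
rewrite (funext rot2E).
have d1q := d1 q s; have d1p := d1 p s.
have d2qq := d2 q q s; have d2qp := d2 q p s.
have d2pq := d2 p q s; have d2pp := d2 p p s.
have -> : rot3 s =
    (- sin s * (- sin s * (- sin s * D3 (rotq s) q q q + cos s * D3 (rotq s) q q p)
      + cos s * (- sin s * D3 (rotq s) q p q + cos s * D3 (rotq s) q p p))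
    + cos s * (- sin s * (- sin s * D3 (rotq s) p q q + cos s * D3 (rotq s) p q p)
      + cos s * (- sin s * D3 (rotq s) p p q + cos s * D3 (rotq s) p p p)))
    - (cos s * (- sin s * D2 (rotq s) q q + cos s * D2 (rotq s) q p)
      + sin s * (- sin s * D2 (rotq s) p q + cos s * D2 (rotq s) p p))
    - 2 * (- sin s * (cos s * D2 (rotq s) q q + sin s * D2 (rotq s) q p)
      + cos s * (cos s * D2 (rotq s) p q + sin s * D2 (rotq s) p p))
    - (- sin s * D1 (rotq s) q + cos s * D1 (rotq s) p).
  rewrite /rot3; congr (_ - _ - 2 * _ - _); [|exact: D2E|exact: D2E|exact: D1E].
  by rewrite D3E; congr (_ * _ + _ * _); exact: D3E'.
by apply: trigger_derive => /=; rewrite /GRing.scale /=; ring.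
Qed.

Lemma norm_rotq_le s : `|rotq s| <= `|q| + `|p|.
Proof.
rewrite (le_trans (ler_normD _ _)) // !normrZ.
by apply: lerD; rewrite ler_piMl // ?cos_max ?sin_max.
Qed.

Lemma norm_rotv_le s : `|rotv s| <= `|q| + `|p|.
Proof.
rewrite (le_trans (ler_normD _ _)) // !normrZ normrN.
by apply: lerD; rewrite ler_piMl // ?cos_max ?sin_max.
Qed.

Definition trapezoid_defect (h : R) : R :=
  Phi (rotq h) - Phi (rotq 0) - h / 2 * (D1 (rotq 0) (rotv 0) + D1 (rotq h) (rotv h)).

Lemma rotq0 : rotq 0 = q.
Proof. by rewrite /rotq cos0 sin0 scale1r scale0r addr0. Qed.

Lemma rotv0 : rotv 0 = p.
Proof. by rewrite /rotv cos0 sin0 oppr0 scale1r scale0r add0r. Qed.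

End OneCurve.

Lemma rotqB q p q' p' s : rotq q p s - rotq q' p' s = rotq (q - q') (p - p') s.
Proof. by rewrite /rotq !scalerBr opprD addrACA. Qed.

Lemma rotvB q p q' p' s : rotv q p s - rotv q' p' s = rotv (q - q') (p - p') s.
Proof. by rewrite /rotv !scalerBr opprD addrACA. Qed.

Lemma D1_diff rho x y u u' : `|y| <= rho -> `|u| <= rho -> `|u'| <= rho ->
  `|D1 x u - D1 y u'| <= L * rho * `|x - y| + (L * rho + L') * `|u - u'|.
Proof.
move=> yr ur u'r.
have -> : D1 x u - D1 y u' = (D1 x u - D1 y u) + D1 y (u - u').
  by rewrite rlinearB // addrA subrK.
rewrite (le_trans (ler_normD _ _)) // lerD //.
  apply: le_trans (D1L _ _ _) _; rewrite mulrAC.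
  by rewrite ler_wpM2r // ler_wpM2l.
apply: le_trans (D1B _ _) _; rewrite ler_wpM2r //.
by rewrite lerD2r ler_wpM2l.
Qed.

Lemma D2_diff rho x y u u' w w' :
  `|u| <= rho -> `|w| <= rho -> `|u'| <= rho -> `|w'| <= rho ->
  `|D2 x u w - D2 y u' w'| <=
    M * rho ^+ 2 * `|x - y| + L * rho * `|u - u'| + L * rho * `|w - w'|.
Proof.
move=> ur wr u'r w'r; have r0 : 0 <= rho by exact: le_trans ur.
have -> : D2 x u w - D2 y u' w' =
    (D2 x u w - D2 y u w) + D2 y (u - u') w + D2 y u' (w - w').
  rewrite (rlinearB _ _ (D2lin1 _ _)) (rlinearB _ _ (D2lin2 _ _)); ring.
rewrite (le_trans (ler_normD _ _)) // lerD //.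
  rewrite (le_trans (ler_normD _ _)) // lerD //.
    apply: le_trans (D2L _ _ _ _) _.
    rewrite [leRHS](_ : _ = M * `|x - y| * rho * rho); last by ring.
    by do 2 (apply: ler_pM => //; rewrite ?mulr_ge0 //); rewrite ler_wpM2l ?mulr_ge0.
  apply: le_trans (D2B _ _ _) _; rewrite mulrAC ler_wpM2r //.
  by rewrite ler_wpM2l.
apply: le_trans (D2B _ _ _) _; rewrite ler_wpM2r // ler_wpM2l //.
Qed.

Lemma D3_diff rho x y c c' : `|c| <= rho -> `|c'| <= rho ->
  `|D3 x c c c - D3 y c' c' c'| <=
    N * rho ^+ 3 * `|x - y| + 3 * (M * rho ^+ 2 * `|c - c'|).
Proof.
move=> cr c'r; have r0 : 0 <= rho by exact: le_trans cr.
have -> : D3 x c c c - D3 y c' c' c' =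
    (D3 x c c c - D3 y c c c) + (D3 y (c - c') c c + D3 y c' (c - c') c
    + D3 y c' c' (c - c')).
  rewrite (rlinearB _ _ (D3lin1 _ _ _)) (rlinearB _ _ (D3lin2 _ _ _)).
  rewrite (rlinearB _ _ (D3lin3 _ _ _)); ring.
have pM2 (a b d : R) : 0 <= a -> 0 <= b -> b <= rho -> 0 <= d -> d <= rho ->
    a * b * d <= a * rho ^+ 2.
  move=> a0 b0 br d0 dr; rewrite -mulrA ler_wpM2l // expr2; exact: ler_pM.
rewrite (le_trans (ler_normD _ _)) // lerD //.
  apply: le_trans (D3L _ _ _ _ _) _.
  rewrite [leRHS](_ : _ = N * `|x - y| * rho * rho * rho); last by ring.
  by do 2 (apply: ler_pM => //; rewrite ?mulr_ge0 //); rewrite ler_wpM2l ?mulr_ge0.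
have -> : 3 * (M * rho ^+ 2 * `|c - c'|) = M * `|c - c'| * rho ^+ 2
    + M * `|c - c'| * rho ^+ 2 + M * `|c - c'| * rho ^+ 2 by ring.
rewrite (le_trans (ler_normD _ _)) // lerD //.
  rewrite (le_trans (ler_normD _ _)) // lerD //.
    by apply: le_trans (D3B _ _ _ _) _; apply: pM2 => //; rewrite mulr_ge0.
  apply: le_trans (D3B _ _ _ _) _.
  by rewrite [M * _ * _]mulrAC; apply: pM2 => //; rewrite mulr_ge0.
apply: le_trans (D3B _ _ _ _) _.
rewrite (_ : _ * _ = M * `|c - c'| * `|c'| * `|c'|); last by ring.
by apply: pM2 => //; rewrite mulr_ge0.
Qed.

(** Coefficients collected from [rot3]: M from D3, 3 L from the three D2 terms and L + L' from D1.
    In the Lipschitz version these become N + 3 M, 3 (M + 2 L) and 2 L + L'. All powers of rho >= 1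
    are raised to the third. *)
Definition defect_bound := M + 4 * L + L'.
Definition defect_lip := N + 6 * M + 8 * L + L'.

Lemma rot3_le q p rho s : 1 <= rho -> `|q| + `|p| <= rho ->
  `|rot3 q p s| <= defect_bound * rho ^+ 3.
Proof.
move=> r1 qpr; have r0 : 0 <= rho by exact: le_trans r1.
set c := rotq q p s; set v := rotv q p s.
have cr : `|c| <= rho by exact: le_trans (norm_rotq_le _ _ _) qpr.
have vr : `|v| <= rho by exact: le_trans (norm_rotv_le _ _ _) qpr.
have r2 : rho <= rho ^+ 2 by rewrite expr2 ler_peMl.
have r3 : rho ^+ 2 <= rho ^+ 3 by rewrite [leRHS]exprS ler_peMl ?sqr_ge0.
have b3 : `|D3 c v v v| <= M * rho ^+ 3.
  apply: le_trans (D3B _ _ _ _) _; rewrite !exprS expr0 mulr1 !mulrA.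
  by do 3 (apply: ler_pM => //; rewrite ?mulr_ge0 //).
have b2 x y : `|x| <= rho -> `|y| <= rho -> `|D2 c x y| <= L * rho ^+ 3.
  move=> xr yr; apply: le_trans (D2B _ _ _) _.
  apply: le_trans (_ : L * rho ^+ 2 <= _); last by rewrite ler_wpM2l.
  by rewrite expr2 mulrA; do 2 (apply: ler_pM => //; rewrite ?mulr_ge0 //).
have b1 : `|D1 c v| <= (L + L') * rho ^+ 3.
  apply: le_trans (D1B _ _) _; apply: le_trans (_ : (L * rho + L' * rho) * rho <= _).
    apply: ler_pM => //; first by rewrite addr_ge0 ?mulr_ge0.
    by rewrite lerD // ?ler_wpM2l // ler_peMr.
  by rewrite -mulrDl -mulrA -expr2 ler_wpM2l // addr_ge0.
rewrite /rot3 -/c -/v /defect_bound.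
have := b2 _ _ cr vr; have := b2 _ _ vr cr.
move: b3 b1; rewrite !ler_norml; lra.
Qed.

Lemma rot3_lip q p q' p' rho s : 1 <= rho ->
  `|q| + `|p| <= rho -> `|q'| + `|p'| <= rho ->
  `|rot3 q p s - rot3 q' p' s| <=
    defect_lip * rho ^+ 3 * (`|q - q'| + `|p - p'|).
Proof.
move=> r1 qpr qpr'; have r0 : 0 <= rho by exact: le_trans r1.
set d := `|q - q'| + `|p - p'|.
set c := rotq q p s; set v := rotv q p s.
set c' := rotq q' p' s; set v' := rotv q' p' s.
have cr : `|c| <= rho by exact: le_trans (norm_rotq_le _ _ _) qpr.
have vr : `|v| <= rho by exact: le_trans (norm_rotv_le _ _ _) qpr.
have cr' : `|c'| <= rho by exact: le_trans (norm_rotq_le _ _ _) qpr'.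
have vr' : `|v'| <= rho by exact: le_trans (norm_rotv_le _ _ _) qpr'.
have dc : `|c - c'| <= d by rewrite rotqB norm_rotq_le.
have dv : `|v - v'| <= d by rewrite rotvB norm_rotv_le.
have d0 : 0 <= d by exact: le_trans dc.
have r2 : rho <= rho ^+ 2 by rewrite expr2 ler_peMl.
have r3 : rho ^+ 2 <= rho ^+ 3 by rewrite [leRHS]exprS ler_peMl ?sqr_ge0.
have r13 : rho <= rho ^+ 3 by exact: le_trans r3.
have r03 : 1 <= rho ^+ 3 by exact: le_trans r13.
have up (a b e : R) : 0 <= a -> 0 <= b -> b <= rho ^+ 3 -> 0 <= e -> e <= d ->
    a * b * e <= a * (rho ^+ 3 * d).
  by move=> a0 b0 br e0 ed; rewrite -mulrA ler_wpM2l //; exact: ler_pM.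
have b3 : `|D3 c v v v - D3 c' v' v' v'| <= (N + 3 * M) * (rho ^+ 3 * d).
  apply: le_trans (D3_diff _ _ vr vr') _;
  rewrite (_ : (N + 3 * M) * _ = N * (rho ^+ 3 * d) + 3 * (M * (rho ^+ 3 * d)));
    last by ring.
  apply: lerD; first by apply: up; rewrite ?exprn_ge0.
  by rewrite ler_pM2l //; apply: up; rewrite ?exprn_ge0.
have b2 x y x' y' : `|x| <= rho -> `|y| <= rho -> `|x'| <= rho -> `|y'| <= rho ->
    `|x - x'| <= d -> `|y - y'| <= d ->
    `|D2 c x y - D2 c' x' y'| <= (M + 2 * L) * (rho ^+ 3 * d).
  move=> xr yr xr' yr' dx dy; apply: le_trans (D2_diff _ _ xr yr xr' yr') _.
  rewrite (_ : (M + 2 * L) * _ = M * (rho ^+ 3 * d) + L * (rho ^+ 3 * d)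
    + L * (rho ^+ 3 * d)); last by ring.
  by apply: lerD; [apply: lerD|]; apply: up; rewrite ?exprn_ge0.
have b1 : `|D1 c v - D1 c' v'| <= (2 * L + L') * (rho ^+ 3 * d).
  apply: le_trans (D1_diff _ cr' vr vr') _.
  rewrite (_ : (2 * L + L') * _ = L * (rho ^+ 3 * d) + (L * (rho ^+ 3 * d)
    + L' * (rho ^+ 3 * d))); last by ring.
  apply: lerD; first by apply: up.
  rewrite mulrDl; apply: lerD; first by apply: up.
  by have := up L' 1 _ L'0 ler01 r03 (normr_ge0 _) dv; rewrite mulr1.
rewrite /rot3 -/c -/v -/c' -/v' /defect_lip -mulrA.
have := b2 _ _ _ _ cr vr cr' vr' dc dv; have := b2 _ _ _ _ vr cr vr' cr' dv dc.
move: b3 b1; set e := rho ^+ 3 * d; rewrite !ler_norml; lra.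
Qed.

Lemma trapezoid_defect_le q p rho h : 0 <= h -> 1 <= rho ->
  `|q| + `|p| <= rho ->
  `|trapezoid_defect q p h| <= defect_bound * rho ^+ 3 * h ^+ 3.
Proof.
move=> h0 r1 qpr.
apply: (@trapezoid_bound _ (fun t => Phi (rotq q p t))
  (fun t => D1 (rotq q p t) (rotv q p t)) (rot2 q p) (rot3 q p)) => //.
- exact: rot_derive0.
- exact: rot_derive1.
- exact: rot_derive2.
- by move=> s _; exact: rot3_le.
Qed.

Lemma trapezoid_defect_lip q p q' p' rho h : 0 <= h -> 1 <= rho ->
  `|q| + `|p| <= rho -> `|q'| + `|p'| <= rho ->
  `|trapezoid_defect q p h - trapezoid_defect q' p' h| <=
    defect_lip * rho ^+ 3 * (`|q - q'| + `|p - p'|) * h ^+ 3.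
Proof.
move=> h0 r1 qpr qpr'.
pose g t := Phi (rotq q p t) - Phi (rotq q' p' t).
pose g1 t := D1 (rotq q p t) (rotv q p t) - D1 (rotq q' p' t) (rotv q' p' t).
pose g2 t := rot2 q p t - rot2 q' p' t.
pose g3 t := rot3 q p t - rot3 q' p' t.
have -> : trapezoid_defect q p h - trapezoid_defect q' p' h =
    g h - g 0 - h / 2 * (g1 0 + g1 h) by rewrite /trapezoid_defect /g /g1; ring.
apply: (@trapezoid_bound _ g g1 g2 g3) => //.
- by move=> s; apply: is_deriveB; exact: rot_derive0.
- by move=> s; apply: is_deriveB; exact: rot_derive1.
- by move=> s; apply: is_deriveB; exact: rot_derive2.
- by move=> s _; exact: rot3_lip.
Qed.

End RotationCurve.

(** * Energy error of the numerical flow *)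

Section PotentialDefect.
Context {R : realType} {l : R}.
Variables (lam : nat -> R) (Phi : Hs l -> R) (DPhi : Hs l -> Hs (- l)).
Variables (L L' M N : R).
Hypotheses (L0 : 0 <= L) (L'0 : 0 <= L').
Hypothesis grad : is_gradient Phi DPhi.
Hypothesis gradB : grad_bounds lam DPhi L L'.
Hypothesis highB : higher_bounds lam Phi DPhi M N.

Let D1 (x u : Hs l) : R := dual_pair (DPhi x) u.

Let DL x y : `|DPhi x - DPhi y| <= L * `|x - y|.
Proof. by case: gradB. Qed.

Let DB x : `|DPhi x| <= L * `|x| + L'.
Proof. by case: gradB. Qed.

Lemma dual_pair_rlinear (f : Hs (- l)) : rlinear (dual_pair f).
Proof. by move=> k x y; rewrite dual_pairDr dual_pairZr. Qed.

Lemma gradient_small x : small_error Phi (D1 x) x.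
Proof.
move=> eps eps0; have [dPhi dE] := grad x.
by apply: filterS (differentiable_small dPhi eps0) => u; rewrite dE.
Qed.

Lemma gradient_derivative_small x w : differentiable DPhi x ->
  small_error (fun y => D1 y w) (fun u => dual_pair ('d DPhi x u) w) x.
Proof.
move=> dD eps eps0; have w0 : 0 < `|w| + 1 by rewrite ltr_wpDl.
have e0 : 0 < eps / (`|w| + 1) by rewrite divr_gt0.
apply: filterS (differentiable_small dD e0) => u du.
rewrite /D1 -!dual_pairBl; apply: le_trans (norm_dual_pair_le _ _) _.
apply: le_trans (ler_wpM2r (normr_ge0 w) du) _.
rewrite mulrAC ler_wpM2r // -mulrA -[leRHS]mulr1 ler_pM2l // mulrC.
by rewrite ler_pdivrMr // mul1r lerDl.
Qed.

Lemma derivative_pair_rlinear x w : rlinear (fun u => dual_pair ('d DPhi x u) w).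
Proof.
by move=> k u v; rewrite linearD linearZ dual_pairDl dual_pairZl.
Qed.

Let D1L x y u : `|D1 x u - D1 y u| <= L * `|x - y| * `|u|.
Proof.
rewrite -dual_pairBl; apply: le_trans (norm_dual_pair_le _ _) _.
by rewrite ler_wpM2r.
Qed.

Let D1B x u : `|D1 x u| <= (L * `|x| + L') * `|u|.
Proof. by apply: le_trans (norm_dual_pair_le _ _) _; rewrite ler_wpM2r. Qed.

(** [is_Cn] provides abstract forms, whereas the quantitative assumptions concern [DPhi] and its
    differential. Uniqueness of derivatives matches the first two orders. The bounds on D2 and D3
    come from the Lipschitz constants L of D1 and M of D2, and the bound N on the fourth derivative
    makes D3 Lipschitz. *)
Lemma potential_defect (q p q' p' : Hs l) rho h : 0 <= h -> 1 <= rho ->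
  `|q| + `|p| <= rho -> `|q'| + `|p'| <= rho ->
  `|trapezoid_defect Phi D1 q p h| <=
    defect_bound L L' `|M| * rho ^+ 3 * h ^+ 3 /\
  `|trapezoid_defect Phi D1 q p h - trapezoid_defect Phi D1 q' p' h| <=
    defect_lip L L' `|M| `|N| * rho ^+ 3 * (`|q - q'| + `|p - p'|) * h ^+ 3.
Proof.
move=> h0 r1 qpr qpr'.
have [[D [[D0 fr _] D4N]] dD DM _] := highB.
pose D2 x u w := dual_pair ('d DPhi x u) w.
have D2small x w : small_error (fun y => D1 y w) (fun u => D2 x u w) x.
  exact: gradient_derivative_small.
have fr01 : is_frechet (D 0%N) (D 1%N) by exact: fr.
have fr12 w := frechet_slice w (fr 1%N isT).
have fr23 u w := frechet_slice w (frechet_slice u (fr 2%N isT)).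
have fr34 c u w := frechet_slice w (frechet_slice u (frechet_slice c (fr 3%N isT))).
have D1E x u : D 1%N x u = D1 x u.
  have DPhiE : D 0%N = Phi by apply/funext.
  apply: (@frechet_unique _ _ Phi (D 1%N x) (D1 x) x u).
  - exact: frechet0_rlinear fr01.
  - exact: dual_pair_rlinear.
  - by rewrite -DPhiE; exact: frechet0_small fr01.
  - exact: gradient_small.
have D2E x u w : D 2%N x u w = D2 x u w.
  apply: (@frechet_unique _ _ (fun y => D1 y w) (fun u => D 2%N x u w)
    (fun u => D2 x u w) x u).
  - exact: frechet0_rlinear (fr12 w).
  - exact: derivative_pair_rlinear.
  - rewrite (_ : (fun y => D1 y w) = fun y => D 1%N y w); last first.
      by apply/funext => y; rewrite D1E.
    exact: frechet0_small (fr12 w).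
  - exact: D2small.
have D3small x u w : small_error (fun y => D2 y u w) (fun c => D 3%N x c u w) x.
  rewrite (_ : (fun y => D2 y u w) = fun y => D 2%N y u w); last first.
    by apply/funext => y; rewrite D2E.
  exact: frechet0_small (fr23 u w).
have D2lin1 x w : rlinear (fun u => D2 x u w) by exact: derivative_pair_rlinear.
have D2lin2 x u : rlinear (D2 x u) by exact: dual_pair_rlinear.
have D3lin1 x u w : rlinear (fun c => D 3%N x c u w).
  exact: frechet0_rlinear (fr23 u w).
(* D 3 inherits linearity in the other slots from D2, being its derivative. *)
have comb x c u1 w1 u2 w2 u3 w3 (k : R) :
    (forall y, D2 y u3 w3 = k * D2 y u1 w1 + D2 y u2 w2) ->
    D 3%N x c u3 w3 = k * D 3%N x c u1 w1 + D 3%N x c u2 w2.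
  move=> E.
  have d (u w : Hs l) : is_derive (0 : R) 1 (fun t : R => D2 (x + t *: c) u w) (D 3%N x c u w).
    apply: (@line_derive _ _ (fun y => D2 y u w) (fun c => D 3%N x c u w)) => //.
    by rewrite scale0r addr0.
  have d1 := d u1 w1; have d2 := d u2 w2.
  apply: (is_derive_unique (d u3 w3)).
  rewrite (_ : (fun t : R => D2 (x + t *: c) u3 w3) =
    fun t : R => k * D2 (x + t *: c) u1 w1 + D2 (x + t *: c) u2 w2).
    by apply: trigger_derive; rewrite /GRing.scale /=; ring.
  by apply/funext => t; exact: E.
have D3lin2 x c w : rlinear (fun u => D 3%N x c u w).
  by move=> k u v; apply: comb => y; exact: D2lin1.
have D3lin3 x c u : rlinear (D 3%N x c u).
  by move=> k w v; apply: comb => y; exact: D2lin2.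
have D2B x u w : `|D2 x u w| <= L * `|u| * `|w|.
  rewrite mulrAC; apply: (@frechet_norm_le _ _ (fun y => D1 y w)
    (fun u => D2 x u w) x) => // y.
  by rewrite mulrAC.
(* [M] and [N] come without a sign, hence the absolute values. *)
have D2L x y u w : `|D2 x u w - D2 y u w| <= `|M| * `|x - y| * `|u| * `|w|.
  rewrite -dual_pairBl; apply: le_trans (norm_dual_pair_le _ _) _.
  rewrite ler_wpM2r //; apply: le_trans (DM _ _ _) _.
  by rewrite -!mulrA ler_wpM2r ?mulr_ge0 // ler_norm.
have D3B x c u w : `|D 3%N x c u w| <= `|M| * `|c| * `|u| * `|w|.
  rewrite [leRHS](_ : _ = (`|M| * `|u| * `|w|) * `|c|); last by ring.
  apply: (@frechet_norm_le _ _ (fun y => D2 y u w)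
    (fun c => D 3%N x c u w) x) => // y.
  by rewrite [leRHS](_ : _ = `|M| * `|y - x| * `|u| * `|w|); last by ring.
have D3L x y c u w :
    `|D 3%N x c u w - D 3%N y c u w| <= `|N| * `|x - y| * `|c| * `|u| * `|w|.
  rewrite [leRHS](_ : _ = (`|N| * `|c| * `|u| * `|w|) * `|x - y|); last by ring.
  apply: (@frechet_lipschitz _ _ (fun z => D 3%N z c u w)
    (fun z e => D 4%N z e c u w)).
  - by move=> z; exact: frechet0_rlinear (fr34 c u w).
  - by move=> z; exact: frechet0_small (fr34 c u w).
  - move=> z e; apply: le_trans (D4N z e c u w) _.
    rewrite [leRHS](_ : _ = `|N| * `|e| * `|c| * `|u| * `|w|); last by ring.
    by do 4 (rewrite ler_wpM2r //); rewrite ler_norm.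
have P1small := gradient_small.
have D1lin x : rlinear (D1 x) by exact: dual_pair_rlinear.
split.
- exact: (@trapezoid_defect_le _ _ Phi D1 D2 (D 3%N) L L' `|M|).
- exact: (@trapezoid_defect_lip _ _ Phi D1 D2 (D 3%N) L L' `|M| `|N|).
Qed.

End PotentialDefect.

Lemma trapezoid_telescope {R : realType} (P a s : nat -> R) (h : R) n :
  \sum_(i < n.+1) (P i.+1 - P i - h / 2 * (a i + a i.+1)
    + h ^+ 2 / 4 * (s i - s i.+1)) =
  P n.+1 - P 0%N - h / 2 * (a 0%N + a n.+1 + 2 * \sum_(1 <= i < n.+1) a i)
  + h ^+ 2 / 4 * (s 0%N - s n.+1).
Proof.
elim: n => [|n IH]; first by rewrite big_ord1 big_geq // mulr0 addr0.
by rewrite big_ord_recr /= IH [in RHS]big_nat_recr //=; field.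
Qed.

Lemma sqr_diff_le {R : realType} (a b B d : R) :
  0 <= a <= B -> 0 <= b <= B -> `|a - b| <= d ->
  `|a ^+ 2 - b ^+ 2| <= d * (2 * B).
Proof.
move=> /andP[a0 aB] /andP[b0 bB] abd; rewrite subr_sqr normrM.
by apply: ler_pM => //; rewrite ger0_norm ?addr_ge0 //; lra.
Qed.

Lemma sqr_dist_le {R : realType} (a b B : R) :
  0 <= a <= B -> 0 <= b <= B -> `|a ^+ 2 - b ^+ 2| <= B ^+ 2.
Proof.
move=> /andP[a0 aB] /andP[b0 bB].
have a2 : a ^+ 2 <= B ^+ 2 by rewrite lerXn2r // nnegrE (le_trans a0).
have b2 : b ^+ 2 <= B ^+ 2 by rewrite lerXn2r // nnegrE (le_trans a0).
have := sqr_ge0 a; have := sqr_ge0 b; rewrite ler_norml; lra.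
Qed.

Lemma norm_sum_ord_le {R : realType} n (f : nat -> R) (B : R) :
  (forall i, (i < n)%N -> `|f i| <= B) -> `|\sum_(i < n) f i| <= n%:R * B.
Proof.
move=> fB; apply: le_trans (ler_norm_sum _ _ _) _.
apply: (@le_trans _ _ (\sum_(i < n) B)); first by apply: ler_sum => i _; exact: fB.
by rewrite sumr_const card_ord mulr_natl.
Qed.

Section EnergyError.
Context {R : realType} {l : R}.
Variables (lam : nat -> R) (kappa : R).
Hypothesis lam0 : forall j, 0 < lam j.
Hypothesis decay : eigenvalue_decay lam kappa.
Hypothesis lkappa : 0 <= l < kappa - 2^-1.

Section Decomposition.
Variables (Phi : Hs l -> R) (DPhi : Hs l -> Hs (- l)) (h : R).
Let G := C_grad lam DPhi.
Let D1 (x u : Hs l) : R := dual_pair (DPhi x) u.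
Let S (x : Hs l) : R := `|sqrtC_grad lam DPhi x| ^+ 2.

(** The velocity after the first half kick. From it the position moves by a pure rotation, and the
    rotated velocity is the new velocity before its last half kick. *)
Definition half_kick (z : Hs l * Hs l) : Hs l := z.2 - (h / 2) *: G z.1.

Lemma dual_pair_C_grad x : D1 x (G x) = S x.
Proof. exact: (dual_pair_diag lam0 decay lkappa). Qed.

Lemma psi_rot z : (psi lam DPhi h z).1 = rotq z.1 (half_kick z) h.
Proof.
rewrite /psi /rotq /half_kick /= -/G.
have [f [-> -> -> _ [fD fN fZ]]] := lincomb z.1 z.2 (G z.1) 0.
by rewrite !(fZ, fN, fD); congr f; ring.
Qed.

Lemma psi_drot z : rotv z.1 (half_kick z) h =
  (psi lam DPhi h z).2 + (h / 2) *: G (psi lam DPhi h z).1.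
Proof.
rewrite /psi /rotv /half_kick /= -/G; move: (G (_ - _)) => G1.
have [f [-> -> -> -> [fD fN fZ]]] := lincomb z.1 z.2 (G z.1) G1.
by rewrite !(fZ, fN, fD); congr f; ring.
Qed.

(** The half-kicked velocities differ from the true ones by - (h/2) C DPhi at the start and + (h/2)
    C DPhi at the end; the trapezoidal weight h/2 turns these into the h^2/4 terms. *)
Lemma step_defect z : let z' := psi lam DPhi h z in
  trapezoid_defect Phi D1 z.1 (half_kick z) h =
  Phi z'.1 - Phi z.1 - h / 2 * (D1 z.1 z.2 + D1 z'.1 z'.2)
  + h ^+ 2 / 4 * (S z.1 - S z'.1).
Proof.
move=> z'; have pB : D1 z.1 (half_kick z) = D1 z.1 z.2 - h / 2 * S z.1.
  by rewrite /D1 dual_pairBr dual_pairZr; congr (_ - _ * _); exact: dual_pair_C_grad.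
have pD : D1 z'.1 (z'.2 + (h / 2) *: G z'.1) = D1 z'.1 z'.2 + h / 2 * S z'.1.
  by rewrite /D1 dual_pairDr dual_pairZr; congr (_ + _ * _); exact: dual_pair_C_grad.
rewrite /trapezoid_defect rotq0 rotv0 psi_drot -psi_rot -/z' pB pD.
move: (D1 z.1 z.2) (D1 z'.1 z'.2) (S z.1) (S z'.1) (Phi z.1) (Phi z'.1) => *.
by field.
Qed.

(** The h^2/4 terms telescope to twice the correction contained in [DeltaH], so half of it is left
    over with the opposite sign. *)
Lemma DeltaH_defect (I : nat) (z : Hs l * Hs l) : (0 < I)%N ->
  let zi i := iter i (psi lam DPhi h) z in
  DeltaH lam Phi DPhi h I z.1 z.2 =
  \sum_(i < I) trapezoid_defect Phi D1 (zi i).1 (half_kick (zi i)) h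
  + h ^+ 2 / 8 * (S (zi I).1 - S (zi 0%N).1).
Proof.
case: I => // n _ zi.
rewrite (eq_bigr (fun i : 'I_n.+1 => Phi (zi i.+1).1 - Phi (zi i).1
  - h / 2 * (D1 (zi i).1 (zi i).2 + D1 (zi i.+1).1 (zi i.+1).2)
  + h ^+ 2 / 4 * (S (zi i).1 - S (zi i.+1).1))); last first.
  by move=> i _; exact: step_defect.
rewrite (trapezoid_telescope (fun i => Phi (zi i).1)
  (fun i => D1 (zi i).1 (zi i).2) (fun i => S (zi i).1)).
have -> : DeltaH lam Phi DPhi h n.+1 z.1 z.2 =
    Phi (zi n.+1).1 - Phi (zi 0%N).1
    + h ^+ 2 / 8 * (S (zi 0%N).1 - S (zi n.+1).1)
    - h * (\sum_(1 <= i < n.+1) D1 (zi i).1 (zi i).2)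
    - h / 2 * (D1 (zi 0%N).1 (zi 0%N).2 + D1 (zi n.+1).1 (zi n.+1).2).
  by rewrite /DeltaH -surjective_pairing.
set A := \sum_(1 <= i < _) _; move: A => A.
move: (D1 (zi 0%N).1 _) (D1 (zi n.+1).1 _) (S _) (S _) (Phi _) (Phi _) => *.
by field.
Qed.
End Decomposition.

Variables (L L' M N : R).
Hypotheses (L0 : 0 < L) (L'0 : 0 <= L').

(** Over a time at most 1, [e1] is the growth factor of one plus the size and [e2] the Lipschitz
    factor of the flow; [k1] also allows for a half kick. *)
Let e1 := expR (growth_rate L L').
Let e2 := expR (lip_rate L).
Let k1 := (1 + L + L') * e1.

Let e1_ge1 : 1 <= e1. Proof. by rewrite -[leLHS]expR0 ler_expR; exact: sqr_ge0. Qed.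
Let LL'0 : 0 <= L + L'. Proof. by rewrite addr_ge0 // ltW. Qed.
Let k1_ge1 : 1 <= k1.
Proof.
rewrite -[leLHS]mulr1 /k1; apply: ler_pM => //.
by rewrite -addrA lerDl.
Qed.

(** [K] is chosen before [Phi] so that the step size can be uniform over all potentials with the
    same constants. *)
Lemma energy_error_bound : exists2 K : R, 0 < K &
  forall (Phi : Hs l -> R) (DPhi : Hs l -> Hs (- l)),
  is_gradient Phi DPhi -> grad_bounds lam DPhi L L' ->
  higher_bounds lam Phi DPhi M N ->
  forall (h A : R) (I : nat) (z w : Hs l * Hs l),
  0 < h -> (0 < I)%N -> I%:R * h <= 1 ->
  psize z + 1 <= A -> psize w + 1 <= A ->
  `|DeltaH lam Phi DPhi h I z.1 z.2| <= K * (h ^+ 2 * A ^+ 3) /\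
  `|DeltaH lam Phi DPhi h I z.1 z.2 - DeltaH lam Phi DPhi h I w.1 w.2| <=
    K * (h ^+ 2 * A ^+ 3 * psize (z - w)).
Proof.
have [Ks Ks0 [Slip SB0]] := sqrtC_lipschitz lam0 decay lkappa.
have Ks0' := ltW Ks0; have L0' := ltW L0.
have L10 : 0 <= 1 + L by rewrite addr_ge0.
have k10 : 0 <= k1 by exact: le_trans k1_ge1.
have e20 : 0 <= e2 by exact: expR_ge0.
have db0 : 0 <= defect_bound L L' `|M| by rewrite !addr_ge0 // mulr_ge0.
have dl0 : 0 <= defect_lip L L' `|M| `|N|.
  by rewrite !addr_ge0 // mulr_ge0.
pose b1 := defect_bound L L' `|M| * k1 ^+ 3.
pose c1 := defect_lip L L' `|M| `|N| * k1 ^+ 3 * ((1 + L) * e2).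
pose b2 := (Ks * (L + L') * k1) ^+ 2.
pose c2 := 4 * (Ks * L * e2 * (Ks * (L + L') * k1)).
have b10 : 0 <= b1 by rewrite mulr_ge0 ?exprn_ge0.
have k130 : 0 <= k1 ^+ 3 by exact: exprn_ge0.
have c10 : 0 <= c1 by do 2 (apply: mulr_ge0 => //).
have b20 : 0 <= b2 by exact: sqr_ge0.
have c20 : 0 <= c2 by do ?(apply: mulr_ge0 => //).
(* [b1] and [c1] control the sum of defects and its variation, [b2] and [c2] the boundary term. *)
exists (b1 + c1 + b2 + c2 + 1); first by rewrite ltr_wpDl // !addr_ge0.
move=> Phi DPhi grad gradB highB h A I z w h0 I0 Ih zA wA.
have h1 : h <= 1 by apply: le_trans Ih; rewrite ler_peMl ?ler1n // ltW.
have h01 : 0 <= h <= 1 by rewrite h1 ltW.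
have A1 : 1 <= A by apply: le_trans zA; rewrite lerDr psize_ge0.
have A0 : 0 <= A by exact: le_trans A1.
set G := C_grad lam DPhi.
have [DL GL DB GB] : grad_bounds lam DPhi L L' := gradB.
pose S x := `|sqrtC_grad lam DPhi x|.
pose D1 (x u : Hs l) : R := dual_pair (DPhi x) u.
pose rho := k1 * A.
have rho1 : 1 <= rho by rewrite -[leLHS]mulr1; apply: ler_pM.
have ih i : (i <= I)%N -> i%:R * h <= 1.
  by move=> iI; apply: le_trans Ih; rewrite ler_wpM2r ?ler_nat // ltW.
pose it (z : Hs l * Hs l) i := iter i (psi lam DPhi h) z.
have size_it y i : psize y + 1 <= A -> (i <= I)%N -> psize (it y i) + 1 <= e1 * A.
  move=> yA iI; apply: le_trans (iter_leap_growth L0 L'0 GB h01 y (ih i iI)) _.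
  by rewrite ler_wpM2l // expR_ge0.
have diff_it i : (i <= I)%N -> psize (it z i - it w i) <= e2 * psize (z - w).
  by move=> iI; exact: (iter_leap_lip L0 GL h01 z w (ih i iI)).
have kick_size y i : psize y + 1 <= A -> (i <= I)%N ->
    `|(it y i).1| + `|half_kick DPhi h (it y i)| <= rho.
  move=> yA iI; move: (size_it y i yA iI); move: (it y i) => [q v] /= sz.
  apply: le_trans (_ : (1 + L + L') * (psize (q, v) + 1) <= _); last first.
    by rewrite /rho /k1 -mulrA ler_wpM2l // addr_ge0 // addr_ge0 // ltW.
  rewrite /half_kick /= /psize /=.
  have B1 : `|v - (h / 2) *: G q| <= `|v| + (L * `|q| + L').
    rewrite (le_trans (ler_normB _ _)) // lerD2l normrZ.
    apply: le_trans (GB q); rewrite ler_piMl // ger0_norm; lra.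
  have La : 0 <= L * `|v| by rewrite mulr_ge0 // ltW.
  have Lb : 0 <= L' * (`|q| + `|v|) by rewrite mulr_ge0 // addr_ge0.
  have := B1; rewrite -/G; lra.
have kick_diff i : (i <= I)%N ->
    `|(it z i).1 - (it w i).1|
    + `|half_kick DPhi h (it z i) - half_kick DPhi h (it w i)| <=
    (1 + L) * e2 * psize (z - w).
  move=> iI; move: (diff_it i iI).
  move: (it z i) (it w i) => [q v] [q' v'] /= sz.
  rewrite -mulrA; apply: le_trans (_ : (1 + L) * psize ((q, v) - (q', v')) <= _).
    rewrite /half_kick /= /psize /=.
    have -> : v - (h / 2) *: G q - (v' - (h / 2) *: G q') =
        (v - v') - (h / 2) *: (G q - G q').
      by rewrite scalerBr !opprD !opprK addrACA.
    have B1 : `|(v - v') - (h / 2) *: (G q - G q')| <= `|v - v'| + L * `|q - q'|.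
      rewrite (le_trans (ler_normB _ _)) // lerD2l normrZ.
      apply: le_trans (GL q q'); rewrite ler_piMl // ger0_norm; lra.
    have La : 0 <= L * `|v - v'| by rewrite mulr_ge0 // ltW.
    by lra.
  by rewrite ler_wpM2l // addr_ge0 // ltW.
have SB x : S x <= Ks * `|DPhi x| by exact: SB0.
have S_le y i : psize y + 1 <= A -> (i <= I)%N ->
    0 <= S (it y i).1 <= Ks * (L + L') * k1 * A.
  move=> yA iI; move: (size_it y i yA iI); move: (it y i) => y' sz.
  rewrite normr_ge0 /=; apply: le_trans (SB y'.1) _.
  rewrite [leRHS](_ : _ = Ks * ((L + L') * (k1 * A))); last by ring.
  rewrite ler_pM2l //; apply: le_trans (DB _) _.
  have qA : `|y'.1| <= k1 * A.
    apply: le_trans (le_psize1 _) _; apply: le_trans (_ : e1 * A <= _); first lra.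
    by rewrite ler_wpM2r // /k1 ler_peMl ?expR_ge0 // -addrA lerDl.
  rewrite mulrDl; apply: lerD; first by rewrite ler_wpM2l.
  rewrite ler_peMr // -[leLHS]mulr1; exact: ler_pM.
have S_diff i : (i <= I)%N ->
    `|S (it z i).1 ^+ 2 - S (it w i).1 ^+ 2| <=
    Ks * L * e2 * psize (z - w) * (2 * (Ks * (L + L') * k1 * A)).
  move=> iI; apply: (sqr_diff_le (S_le z i zA iI) (S_le w i wA iI)).
  apply: le_trans (ler_dist_dist _ _) _; apply: le_trans (Slip _ _) _.
  rewrite [leRHS](_ : _ = Ks * (L * (e2 * psize (z - w)))); last by ring.
  rewrite ler_pM2l //; apply: le_trans (DL _ _) _.
  rewrite ler_pM2l //; apply: le_trans (diff_it i iI).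
  exact: (le_psize1 (it z i - it w i)).
(* The number of steps absorbs one power of h from the local error, because the total time is at
   most 1. *)
have Ihh : I%:R * h ^+ 3 <= h ^+ 2.
  by rewrite exprS mulrA ler_piMl ?sqr_ge0.
have A3 : 1 <= A ^+ 3 by exact: exprn_ege1.
have A2 : A ^+ 2 <= A ^+ 3 by rewrite [leRHS]exprS ler_peMl ?sqr_ge0.
have A13 : A <= A ^+ 3.
  by apply: le_trans A2; rewrite expr2 ler_peMl.
have rho3 : rho ^+ 3 = k1 ^+ 3 * A ^+ 3 by rewrite exprMn.
have ps0 : 0 <= psize (z - w) by exact: psize_ge0.
have defect i : (i < I)%N ->
    `|trapezoid_defect Phi D1 (it z i).1 (half_kick DPhi h (it z i)) h| <=
      b1 * A ^+ 3 * h ^+ 3 /\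
    `|trapezoid_defect Phi D1 (it z i).1 (half_kick DPhi h (it z i)) h -
      trapezoid_defect Phi D1 (it w i).1 (half_kick DPhi h (it w i)) h| <=
      c1 * A ^+ 3 * psize (z - w) * h ^+ 3.
  move=> iI; have [B1 B2] := potential_defect (ltW L0) L'0 grad gradB highB
    (ltW h0) rho1 (kick_size z i zA (ltnW iI)) (kick_size w i wA (ltnW iI)).
  split; first by rewrite /b1 -[_ * _ * A ^+ 3]mulrA -rho3.
  apply: le_trans B2 _; rewrite ler_wpM2r ?exprn_ge0 ?(ltW h0) //.
  rewrite rho3 /c1 [leRHS](_ : _ = defect_lip L L' `|M| `|N|
    * (k1 ^+ 3 * A ^+ 3) * ((1 + L) * e2 * psize (z - w))); last by ring.
  rewrite ler_wpM2l ?kick_diff ?(ltnW iI) //.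
  by do 2 (apply: mulr_ge0 => //); exact: exprn_ge0.
pose t y i :=
  trapezoid_defect Phi D1 (it y i).1 (half_kick DPhi h (it y i)) h.
have DHE y : DeltaH lam Phi DPhi h I y.1 y.2 =
    \sum_(i < I) t y i + h ^+ 2 / 8 * (S (it y I).1 ^+ 2 - S (it y 0%N).1 ^+ 2).
  exact: DeltaH_defect.
rewrite !DHE; set P := psize (z - w) in ps0 S_diff defect *.
have h20 : 0 <= h ^+ 2 by exact: sqr_ge0.
have hA : 0 <= h ^+ 2 * A ^+ 3 by rewrite mulr_ge0 // exprn_ge0.
split.
  have sumB : `|\sum_(i < I) t z i| <= b1 * (h ^+ 2 * A ^+ 3).
    apply: le_trans (@norm_sum_ord_le _ I (t z) (b1 * A ^+ 3 * h ^+ 3) _) _.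
      by move=> i iI; case: (defect i iI).
    rewrite (_ : _ * _ = b1 * A ^+ 3 * (I%:R * h ^+ 3)); last by ring.
    rewrite [leRHS](_ : _ = b1 * A ^+ 3 * h ^+ 2); last by ring.
    by rewrite ler_wpM2l // mulr_ge0 // exprn_ge0.
  have SS : `|S (it z I).1 ^+ 2 - S (it z 0%N).1 ^+ 2| <= b2 * A ^+ 3.
    apply: le_trans (_ : b2 * A ^+ 2 <= _); last by rewrite ler_wpM2l.
    rewrite /b2 -exprMn; apply: sqr_dist_le; exact: S_le.
  have SB' : `|h ^+ 2 / 8 * (S (it z I).1 ^+ 2 - S (it z 0%N).1 ^+ 2)| <=
      b2 * (h ^+ 2 * A ^+ 3).
    rewrite normrM [leRHS](_ : _ = h ^+ 2 * (b2 * A ^+ 3)); last by ring.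
    by apply: ler_pM => //; rewrite ger0_norm ?divr_ge0 // ler_pdivrMr // ler_peMr // ler1n.
  apply: le_trans (ler_normD _ _) _; apply: le_trans (lerD sumB SB') _.
  rewrite -mulrDl ler_wpM2r //; lra.
have sumB : `|\sum_(i < I) t z i - \sum_(i < I) t w i| <=
    c1 * (h ^+ 2 * A ^+ 3 * P).
  rewrite -sumrB.
  apply: le_trans (@norm_sum_ord_le _ I (fun i => t z i - t w i)
    (c1 * A ^+ 3 * P * h ^+ 3) _) _.
    by move=> i iI; case: (defect i iI).
  rewrite (_ : _ * _ = c1 * A ^+ 3 * P * (I%:R * h ^+ 3)); last by ring.
  rewrite [leRHS](_ : _ = c1 * A ^+ 3 * P * h ^+ 2); last by ring.
  by rewrite ler_wpM2l // mulr_ge0 // mulr_ge0 // exprn_ge0.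
have SS : `|h ^+ 2 / 8 * (S (it z I).1 ^+ 2 - S (it z 0%N).1 ^+ 2)
    - h ^+ 2 / 8 * (S (it w I).1 ^+ 2 - S (it w 0%N).1 ^+ 2)| <=
    c2 * (h ^+ 2 * A ^+ 3 * P).
  move: (S_diff I (leqnn I)) (S_diff 0%N isT).
  move: (S (it z I).1) (S (it w I).1) (S (it z 0%N).1) (S (it w 0%N).1).
  move=> x x' y y'; rewrite [X in _ <= X -> _ -> _](_ : _ = c2 / 2 * A * P); last first.
    by rewrite /c2; field.
  rewrite [X in _ -> _ <= X -> _](_ : _ = c2 / 2 * A * P); last first.
    by rewrite /c2; field.
  move=> B1 B2; rewrite -mulrBr normrM (ger0_norm (divr_ge0 h20 _)) //.
  have B3 : `|x ^+ 2 - y ^+ 2 - (x' ^+ 2 - y' ^+ 2)| <= c2 * A * P.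
    rewrite (_ : _ - _ - _ = (x ^+ 2 - x' ^+ 2) - (y ^+ 2 - y' ^+ 2)); last by ring.
    by apply: le_trans (ler_normB _ _) _; lra.
  rewrite [leRHS](_ : _ = h ^+ 2 * (c2 * A ^+ 3 * P)); last by ring.
  apply: ler_pM => //; first by rewrite divr_ge0.
    by rewrite ler_pdivrMr // ler_peMr // ler1n.
  apply: le_trans B3 _; rewrite ler_wpM2r // ler_wpM2l //.
rewrite opprD addrACA.
apply: le_trans (ler_normD _ _) _; apply: le_trans (lerD sumB SS) _.
by rewrite -mulrDl ler_wpM2r ?mulr_ge0 //; lra.
Qed.

End EnergyError.

(** * Measurability and Gaussian moments *)

Section HsMeasurability.
Context {R : realType} {l : R}.

(** A dense family indexed by the countable type [seq rat], which makes [Hs l] separable. *)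
Definition rat_point (s : seq rat) : Hs l := to_Hs l (fun j => ratr s`_j).

Lemma finite_support_sq_summable (a : nat -> R) n :
  (forall j, (n <= j)%N -> a j = 0) -> a \in sq_summable l.
Proof.
move=> a0; apply/asboolP.
suff h : series (ip_term l a a) @ \oo --> series (ip_term l a a) n.
  exact: cvgP h.
apply: cvg_near_cst; exists n => // m /= nm.
rewrite /series /= (big_cat_nat (leq0n n) nm) /=.
rewrite [X in _ + X = _]big_nat_cond [X in _ + X = _]big1 ?addr0 //.
by move=> j /andP[/andP[nj _] _]; rewrite /ip_term a0 // mulr0 mulr0.
Qed.

Lemma rat_pointE s : coords (rat_point s) = fun j => ratr s`_j.
Proof.
apply: to_HsE; apply: (@finite_support_sq_summable _ (size s)) => j sj.
by rewrite nth_default // raddf0.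
Qed.

Lemma rat_approx (c x e : R) : 0 < c -> 0 < e ->
  exists q : rat, c * (x - ratr q) ^+ 2 <= e.
Proof.
move=> c0 e0; have d0 : 0 < Num.sqrt (e / c) by rewrite sqrtr_gt0 divr_gt0.
have /rat_in_itvoo[q] : x < x + Num.sqrt (e / c) by rewrite ltrDl.
rewrite in_itv /= => /andP[xq qx]; exists q.
rewrite mulrC -ler_pdivlMr // -[leRHS]sqr_sqrtr; last first.
  by apply: divr_ge0; exact: ltW.
have qx0 : 0 <= ratr q - x by rewrite subr_ge0 ltW.
rewrite -[leLHS]sqrrN opprB lerXn2r ?nnegrE ?sqrtr_ge0 //.
by rewrite lerBlDl ltW.
Qed.

Lemma rat_point_dense (x : Hs l) (e : R) : 0 < e ->
  exists s, `|x - rat_point s| < e.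
Proof.
(* One d pays for the tail and one for the n leading coordinates, each approximated to d / (n + 1);
   together 2 d < e^2. *)
move=> e0; pose d := e ^+ 2 / 4.
have d0 : 0 < d by rewrite divr_gt0 // exprn_gt0.
pose S := series (ip_term l x x).
have Scvg : S @ \oo --> limn S by exact: cvg_ip_s.
have Snd : nondecreasing_seq S.
  by apply: nondecreasing_series => j _ _; exact: ip_term_ge0.
have /cvgrPdist_lt/(_ d d0)[n _ Sn] := Scvg.
have tail m : (n <= m)%N -> S m - S n <= d.
  move=> nm; have := Sn n (leqnn n); rewrite ger0_norm => [|].
    have : S m <= limn S by exact: (nondecreasing_cvgn_le Snd).
    lra.
  by rewrite subr_ge0; apply: (nondecreasing_cvgn_le Snd).
have n1 : 0 < n.+1%:R :> R by [].
pose q j := sval (cid (@rat_approx (j.+1%:R `^ (2 * l)) (x j) (d / n.+1%:R)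
  (weight_gt0 l j) (divr_gt0 d0 n1))).
have qE j : j.+1%:R `^ (2 * l) * (x j - ratr (q j)) ^+ 2 <= d / n.+1%:R.
  by rewrite /q; case: cid.
pose s := mkseq q n; exists s.
have termE : ip_term l (x - rat_point s) (x - rat_point s) =
    fun j => j.+1%:R `^ (2 * l) * (x j - ratr s`_j) ^+ 2.
  apply/funext => j; rewrite /ip_term -[coords _ j]/(x j - rat_point s j).
  by rewrite rat_pointE expr2.
rewrite -(@ltr_pXn2r _ 2) ?nnegrE //; last exact: ltW.
rewrite -Hs_ip_normE.
apply: le_lt_trans (_ : 2 * d < _); last by rewrite /d; have := exprn_gt0 2 e0; lra.
apply: limr_le; first exact: cvg_ip_s.
rewrite termE; exists n => // m /= nm; rewrite /series /= (big_cat_nat (leq0n n) nm) /=.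
have -> : 2 * d = d + d by ring.
apply: lerD.
  apply: (@le_trans _ _ (\sum_(0 <= j < n) d / n.+1%:R)).
    apply: ler_sum_nat => j /andP[_ jn].
    by rewrite nth_mkseq.
  rewrite sumr_const_nat subn0 -[_ *+ n]mulr_natr -mulrA ler_piMr //.
    exact: ltW.
  by rewrite ltW // mulrC ltr_pdivrMr // mul1r ltr_nat.
rewrite [leLHS](_ : _ = S m - S n).
  exact: tail.
rewrite /S /series /= (big_cat_nat (leq0n n) nm) /= addrAC subrr add0r.
apply: eq_big_nat => j /andP[nj _].
by rewrite /ip_term nth_default ?size_mkseq // raddf0 subr0 expr2.
Qed.

Context d (T : measurableType d).
Variable W : T -> Hs l.
Hypothesis mW : forall j, measurable_fun setT (fun t => W t j).

Lemma measurable_Hs_dist (a : Hs l) : measurable_fun setT (fun t => `|W t - a| : R).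
Proof.
have E : (fun t => `|W t - a| : R) = Num.sqrt \o (fun t => ip_s l (W t - a) (W t - a)).
  by apply/funext => t.
rewrite E; apply: measurableT_comp.
  by apply: continuous_measurable_fun; exact: sqrt_continuous.
apply: (@measurable_fun_cvg _ _ _ _
  (fun n t => series (ip_term l (W t - a) (W t - a)) n)).
  move=> n; rewrite /series /=; apply: measurable_sum => j.
  rewrite /ip_term; apply: measurable_funM => //.
  by apply: measurable_funM; apply: measurable_funB.
by move=> t _; exact: cvg_ip_s.
Qed.

(** By separability an open set is the union of those balls with rational centre and radius 1 / (n +
    1) that it contains. Their preimages are measurable because squared distances are limits of
    finite sums of coordinates. *)
Lemma measurable_Hs_open (O : set (Hs l)) : open O -> measurable (W @^-1` O).
Proof.
move=> oO.
pose B (k : nat) : set (Hs l) :=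
  if unpickle k is Some (s, n) then ball (rat_point s) (n.+1%:R^-1) else set0.
pose A k := if `[< B k `<=` O >] then B k else set0.
have -> : O = \bigcup_k A k.
  apply/seteqP; split => [x Ox|x [k _]]; last first.
    by rewrite /A; case: asboolP => // BO /BO.
  move: oO; rewrite openE => /(_ x Ox) /nbhs_ballP[e /= e0 xeO].
  have [n ne] : exists n, n.+1%:R^-1 < e / 2.
    have := near_infty_natSinv_lt (PosNum (divr_gt0 e0 (ltr0Sn R 1))).
    by move=> [n _ /(_ n (leqnn n)) /= ?]; exists n.
  have [s xs] := @rat_point_dense x (n.+1%:R^-1) (ltac:(by rewrite invr_gt0)).
  exists (pickle (s, n)) => //.
  have BE : B (pickle (s, n)) = ball (rat_point s) (n.+1%:R^-1).
    by rewrite /B pickleK.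
  rewrite /A; case: asboolP => [_|].
    by rewrite BE -ball_normE /= distrC.
  case; rewrite BE => y; rewrite -ball_normE /= => sy; apply: xeO.
  rewrite -ball_normE /= -(subrKA (rat_point s)).
  by rewrite (le_lt_trans (ler_normD _ _)) // [ltRHS]splitr; apply: ltrD;
    apply: lt_trans ne.
rewrite preimage_bigcup; apply: bigcupT_measurable => k; rewrite /A.
case: asboolP => _; last by rewrite preimage_set0.
rewrite /B; case: unpickle => [[s n]|]; last by rewrite preimage_set0.
rewrite (_ : _ @^-1` _ = [set t | `|W t - rat_point s| < n.+1%:R^-1]).
  rewrite -[X in measurable X]setTI.
  have := measurable_Hs_dist (rat_point s) measurableT (measurable_itv `]-oo, n.+1%:R^-1[).
  by rewrite preimage_itvNyo.
by apply/seteqP; split => t /=; rewrite -ball_normE /= distrC.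
Qed.

Lemma measurable_Hs_continuous (F : Hs l -> R) :
  continuous F -> measurable_fun setT (fun t => F (W t)).
Proof.
move=> /continuousP cF; apply: (measurability _ (RGenOpens.measurableE R)).
move=> _ [_ [a [b ->] <-]]; rewrite setTI.
apply: (@measurable_Hs_open (F @^-1` `]a, b[%classic)).
by apply: cF; exact: interval_open.
Qed.

End HsMeasurability.

(** * Fourth moment of the normal law *)

Section NormalMoment.
Context {R : realType}.
Local Notation leb := (@lebesgue_measure R).
Local Open Scope ereal_scope.

(** The Radon-Nikodym derivative of the normal law agrees almost everywhere with [normal_pdf], as
    both have the same integral over every measurable set. *)
Lemma ge0_integral_normal_prob (m s : R) (f : R -> \bar R) :
  measurable_fun setT f -> (forall x, 0 <= f x) ->
  \int[normal_prob m s]_x f x = \int[leb]_x (f x * (normal_pdf m s x)%:E).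
Proof.
move=> mf f0; have dom := @normal_prob_dominates R m s.
rewrite -(Radon_Nikodym_SigmaFinite.change_of_variables dom f0 measurableT mf).
have mg : measurable_fun [set: R]
    (Radon_Nikodym_SigmaFinite.f (normal_prob m s) leb).
  exact: measurable_int (Radon_Nikodym_SigmaFinite.f_integrable dom).
have mpdf : measurable_fun [set: R] (fun x => (normal_pdf m s x)%:E).
  by apply/measurable_EFinP; exact: measurable_normal_pdf.
apply: ae_eq_integral => //.
- exact: emeasurable_funM.
- exact: emeasurable_funM.
apply: ae_eqe_mul2l; apply: integral_ae_eq => //=.
- exact: Radon_Nikodym_SigmaFinite.f_integrable.
- move=> E _ mE; rewrite -(Radon_Nikodym_SigmaFinite.f_integral dom mE).
  by rewrite /normal_prob.
Qed.

Local Close Scope ereal_scope.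

Lemma sqr_le_expR (u : R) : 0 <= u -> u ^+ 2 <= 4 * expR u.
Proof.
move=> u0; have -> : u = u / 2 + u / 2 by field.
rewrite expRD; set e := expR (u / 2).
have eu : 1 + u / 2 <= e by exact: expR_ge1Dx.
have : (u / 2) ^+ 2 <= e ^+ 2.
  rewrite lerXn2r ?nnegrE ?divr_ge0 ?expR_ge0 //; lra.
rewrite [(u / 2) ^+ 2]expr2 expr2 => H; nra.
Qed.

(** Doubling the deviation leaves a spare factor exp(- u) with u = 3/8 x^2 / s^2, which beats x^4 =
    64/9 s^4 u^2 since u^2 <= 4 exp u. With the factor 2 between the normalisations the constant is
    512/9, rounded up to 64. *)
Lemma normal_pdf_quartic (s x : R) : 0 < s ->
  x ^+ 4 * normal_pdf 0 s x <= 64 * s ^+ 4 * normal_pdf 0 (2 * s) x.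
Proof.
move=> s0; have s2 : 0 < 2 * s by rewrite mulr_gt0.
rewrite !normal_pdfE ?gt_eqF // /normal_peak /normal_fun subr0.
have -> : Num.sqrt ((2 * s) ^+ 2 * pi *+ 2) = 2 * Num.sqrt (s ^+ 2 * pi *+ 2) :> R.
  rewrite exprMn -mulrA -mulrnAr sqrtrM ?sqr_ge0 // sqrtr_sqr ger0_norm //.
set p := Num.sqrt _.
have p0 : 0 < p.
  by rewrite sqrtr_gt0 -mulr_natr mulr_gt0 // mulr_gt0 ?pi_gt0 ?exprn_gt0.
rewrite invfM.
have -> : x ^+ 4 * (p^-1 * expR (- x ^+ 2 / (s ^+ 2 *+ 2))) =
  p^-1 * (x ^+ 4 * expR (- x ^+ 2 / (s ^+ 2 *+ 2))) by ring.
have -> : 64 * s ^+ 4 * (2^-1 * p^-1 * expR (- x ^+ 2 / ((2 * s) ^+ 2 *+ 2))) =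
  p^-1 * (32 * s ^+ 4 * expR (- x ^+ 2 / ((2 * s) ^+ 2 *+ 2))).
  by field; rewrite gt_eqF.
rewrite ler_pM2l ?invr_gt0 //.
set u := 3 / 8 * (x ^+ 2 / s ^+ 2).
have u0 : 0 <= u by rewrite mulr_ge0 // divr_ge0 ?sqr_ge0.
have -> : - x ^+ 2 / (s ^+ 2 *+ 2) = - x ^+ 2 / ((2 * s) ^+ 2 *+ 2) - u.
  by rewrite /u; field; rewrite gt_eqF.
rewrite expRD expRN mulrCA mulrC -subr_ge0 -mulrBl mulr_ge0 ?expR_ge0 //.
rewrite subr_ge0 ler_pdivrMr ?expR_gt0 //.
have -> : x ^+ 4 = 64 / 9 * s ^+ 4 * u ^+ 2.
  by rewrite /u; field; rewrite gt_eqF.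
have s4 : 0 < s ^+ 4 by rewrite exprn_gt0.
have : s ^+ 4 * u ^+ 2 <= s ^+ 4 * (4 * expR u) by rewrite ler_pM2l // sqr_le_expR.
have : 0 <= s ^+ 4 * expR u by rewrite mulr_ge0 ?expR_ge0 // ltW.
lra.
Qed.

Lemma normal_fourth_moment (s : R) : 0 < s ->
  (\int[normal_prob 0 s]_x (x ^+ 4)%:E <= (64 * s ^+ 4)%:E)%E.
Proof.
move=> s0; rewrite ge0_integral_normal_prob; last 2 first.
- by apply/measurable_EFinP; exact: measurable_funX.
- by move=> x; rewrite lee_fin exprn_even_ge0.
have c0 : 0 <= 64 * s ^+ 4 by rewrite mulr_ge0 // exprn_ge0 // ltW.
apply: (@le_trans _ _ (\int[leb]_x ((64 * s ^+ 4)%:E * (normal_pdf 0 (2 * s) x)%:E))%E).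
  apply: ge0_le_integral => //=.
  - move=> x _; rewrite -EFinM lee_fin mulr_ge0 ?normal_pdf_ge0 //.
    by rewrite exprn_even_ge0.
  - apply: emeasurable_funM; first by apply/measurable_EFinP; exact: measurable_funX.
    by apply/measurable_EFinP; exact: measurable_normal_pdf.
  - apply: emeasurable_funM => //.
    by apply/measurable_EFinP; exact: measurable_normal_pdf.
  - by move=> x _; rewrite -!EFinM lee_fin normal_pdf_quartic.
rewrite ge0_integralZl //.
- by rewrite integral_normal_pdf mule1.
- by apply/measurable_EFinP; exact: measurable_normal_pdf.
- by move=> x _; rewrite lee_fin normal_pdf_ge0.
Qed.

End NormalMoment.

(** * Fourth moment of the velocity in [Hs l] *)

Section GaussianNorm.
Context {R : realType} {H : completeNormedModType R}.
Variables (ip : H -> H -> R) (phi : nat -> H) (C : {linear H -> H}).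
Hypothesis hip : is_inner_product ip.
Hypothesis hphi : orthonormal_basis ip phi.
Variables (lam : nat -> R) (kappa l : R).
Hypothesis lam0 : forall j, 0 < lam j.
Hypothesis hCphi : forall j, C (phi j) = lam j ^+ 2 *: phi j.
Hypothesis decay : eigenvalue_decay lam kappa.
Hypothesis lkappa : 0 <= l < kappa - 2^-1.

Lemma innerDl x y w : ip (x + y) w = ip x w + ip y w.
Proof. by have := ip_linear hip w 1 x y; rewrite !scale1r. Qed.

Lemma innerZl k x w : ip (k *: x) w = k * ip x w.
Proof.
have ip0 : ip 0 w = 0 by have := innerDl 0 0 w; rewrite addr0; lra.
by have := ip_linear hip w k x 0; rewrite !addr0 ip0 addr0.
Qed.

(** By polarization the functional is a combination of squared norms. *)
Lemma inner_continuous z : continuous (fun x => ip x z).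
Proof.
have sym := ip_sym hip.
have ipDr x y w : ip w (x + y) = ip w x + ip w y by rewrite !(sym w) innerDl.
have ipNl x w : ip (- x) w = - ip x w by rewrite -scaleN1r innerZl mulN1r.
have ipNr x w : ip w (- x) = - ip w x by rewrite !(sym w) ipNl.
have polar x : ip x z = (`|x + z| ^+ 2 - `|x - z| ^+ 2) / 4.
  by rewrite -!(ip_norm hip) !innerDl !ipDr !ipNl !ipNr (sym z x); field.
rewrite (funext polar) => x; apply: cvgM; last exact: cvg_cst.
have sq (f : H -> H) : {for x, continuous f} ->
    {for x, continuous (fun y => `|f y| ^+ 2 : R)}.
  move=> cf; apply: (@continuous_comp _ _ _ (fun y => `|f y|) (fun r : R => r ^+ 2)).
    by apply: continuous_comp => //; exact: norm_continuous.
  exact: exprn_continuous.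
apply: cvgB; apply: sq.
  by apply: cvgD; [exact: cvg_id|exact: cvg_cst].
by apply: cvgB; [exact: cvg_id|exact: cvg_cst].
Qed.

Definition gcoord (j : nat) (y : borel H) : R := ip y (phi j).

Lemma measurable_gcoord j : measurable_fun setT (gcoord j).
Proof.
apply: (measurability _ (RGenOpens.measurableE R)).
move=> _ [_ [a [b ->] <-]]; rewrite setTI; apply: sub_sigma_algebra.
have /continuousP := @inner_continuous (phi j); apply.
exact: interval_open.
Qed.

Definition gterm (y : borel H) : nat -> R :=
  ip_term l (fun j => gcoord j y) (fun j => gcoord j y).

Let gterm_ge0 y j : 0 <= gterm y j. Proof. exact: ip_term_ge0. Qed.

Let measurable_gterm j : measurable_fun setT (fun y => gterm y j).
Proof.
apply: measurable_funM => //.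
by apply: measurable_funM; exact: measurable_gcoord.
Qed.

(** Where the coordinates define an element of [Hs l]; elsewhere [Hs_of] takes its default value 0
    and every bound on its norm is trivial. *)
Definition regular_set : set (borel H) := [set y | cvgn (series (gterm y))].

Lemma measurable_regular_set : measurable regular_set.
Proof.
have -> : regular_set = \bigcup_K \bigcap_n
    [set y | series (gterm y) n <= K%:R].
  apply/seteqP; split=> [y cy|y [K _ yK]].
    have [K lK] : exists K : nat, limn (series (gterm y)) <= K%:R.
      exists (Num.trunc (limn (series (gterm y)))).+1.
      by rewrite ltW // truncnS_gt.
    exists K => // n _ /=; apply: le_trans lK.
    apply: nondecreasing_cvgn_le cy _.
    by apply: nondecreasing_series => j _ _.
  apply: nondecreasing_is_cvgn; first by apply: nondecreasing_series => j _ _.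
  by exists K%:R => _ [n _ <-]; exact: yK.
apply: bigcupT_measurable => K; apply: bigcapT_measurable => n.
rewrite -[X in measurable X]setTI.
have ms : measurable_fun setT (fun y => series (gterm y) n).
  by apply: measurable_sum => j; exact: measurable_gterm.
have := ms measurableT _ (measurable_itv `]-oo, (K%:R : R)]).
by rewrite preimage_itvNyc.
Qed.

Let W : borel H -> Hs l := Hs_of ip phi l.

Lemma Hs_of_regular y : regular_set y -> coords (W y) = fun j => gcoord j y.
Proof. by move=> cy; apply: to_HsE; apply/asboolP. Qed.

Lemma Hs_of_singular y : ~ regular_set y -> W y = 0.
Proof.
move=> ncy; rewrite /W /Hs_of /to_Hs /insubd insubF //.
by apply/negbTE/negP => /asboolP.
Qed.

Lemma measurable_Hs_of_coord j : measurable_fun setT (fun y => W y j).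
Proof.
rewrite (_ : (fun y => W y j) =
    fun y => if y \in regular_set then gcoord j y else 0); last first.
  apply/funext => y; case: ifPn => [/set_mem cy|/negP ncy].
    by rewrite Hs_of_regular.
  by rewrite Hs_of_singular // => cy; apply: ncy; exact/mem_set.
apply: measurable_fun_ifT => //.
- apply: (measurable_fun_bool true).
  rewrite setTI (_ : _ @^-1` _ = regular_set) //; last first.
    by apply/seteqP; split => y /=; [exact: set_mem|exact: mem_set].
  exact: measurable_regular_set.
- exact: measurable_gcoord.
Qed.

(** The trace of the covariance of the velocity in [Hs l], that is, the sum of the variances of its
    weighted coordinates. *)
Definition trace_norm : R :=
  limn (series (fun j => j.+1%:R `^ (2 * l) * lam j ^+ 2)).

Let b j : R := j.+1%:R `^ (2 * l) * lam j ^+ 2.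

Let b0 j : 0 < b j.
Proof. by rewrite mulr_gt0 ?weight_gt0 // exprn_gt0. Qed.

Let bcvg : cvgn (series b). Proof. exact: trace_cvg lam0 decay lkappa. Qed.

Let b_le n : series b n <= trace_norm.
Proof.
apply: nondecreasing_cvgn_le => //.
by apply: nondecreasing_series => j _ _; exact: ltW.
Qed.

(** Weighted Cauchy-Schwarz. The cross term of the induction step is compared after multiplication
    by B, where X^2 <= B Y completes a square; B = 0 is treated apart. *)
Lemma sqr_sum_le n (t : nat -> R) :
  (\sum_(0 <= j < n) b j * t j) ^+ 2 <=
  (\sum_(0 <= j < n) b j) * \sum_(0 <= j < n) b j * t j ^+ 2.
Proof.
elim: n => [|n IH]; first by rewrite !big_geq // mul0r expr0n.
rewrite !big_nat_recr //=.
set B := \sum_(0 <= j < n) b j in IH *.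
set X := \sum_(0 <= j < n) b j * t j in IH *.
set Y := \sum_(0 <= j < n) b j * t j ^+ 2 in IH *.
have B0 : 0 <= B by rewrite sumr_ge0 // => j _; exact: ltW.
have Y0 : 0 <= Y by rewrite sumr_ge0 // => j _; rewrite mulr_ge0 ?sqr_ge0 // ltW.
suff : 2 * (X * t n) <= Y + B * t n ^+ 2.
  move=> key; have := ler_wpM2l (ltW (b0 n)) key; lra.
have [BE|BN] := eqVneq B 0.
  have X0 : X = 0.
    by apply/eqP; rewrite -sqrf_eq0 eq_le sqr_ge0 andbT (le_trans IH) // BE mul0r.
  by rewrite X0 BE !mul0r mulr0 addr0.
have Bp : 0 < B by rewrite lt_neqAle eq_sym BN.
rewrite -(ler_pM2l Bp) mulrDr.
apply: le_trans (_ : X ^+ 2 + (B * t n) ^+ 2 <= _).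
  have := sqr_ge0 (X - B * t n); lra.
by rewrite exprMn; lra.
Qed.

Variable mu : probability (borel H) R.
Hypothesis gaussian : gaussian_measure ip C mu.

Lemma gcoord_fourth_moment j :
  (\int[mu]_y (gcoord j y ^+ 4)%:E <= (64 * lam j ^+ 4)%:E)%E.
Proof.
have phi1 : ip (phi j) (phi j) = 1 by rewrite hphi.1 eqxx.
have phi0 : phi j != 0.
  apply/eqP => phi0; move: phi1; rewrite (ip_norm hip) phi0 normr0 expr0n /=.
  by move=> /eqP; rewrite eq_sym oner_eq0.
have sd : Num.sqrt (ip (C (phi j)) (phi j)) = lam j.
  by rewrite hCphi innerZl phi1 mulr1 sqrtr_sqr gtr0_norm.
have mg := measurable_gcoord j.
have mgX : (gcoord j : borel H -> measurableTypeR R) \in mfun by exact/mem_set.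
pose X : {mfun borel H >-> measurableTypeR R} := mfun_Sub mgX.
have -> : (\int[mu]_y (gcoord j y ^+ 4)%:E =
    \int[distribution mu X]_x (x ^+ 4)%:E)%E.
  rewrite ge0_integral_pushforward //.
  - by apply/measurable_EFinP; exact: measurable_funX.
  - by move=> x _; rewrite lee_fin exprn_even_ge0.
have -> : (\int[distribution mu X]_x (x ^+ 4)%:E =
    \int[normal_prob 0 (lam j)]_x (x ^+ 4)%:E)%E.
  apply: eq_measure_integral => A mA _; rewrite /distribution /pushforward /=.
  by have := gaussian phi0 mA; rewrite sd => <-.
exact: normal_fourth_moment.
Qed.

(* The squared norm is the sum of the b_j t_j with t_j = (gcoord_j / lam_j)^2,
   and (sum b_j t_j)^2 <= (sum b_j) (sum b_j t_j^2) by Cauchy-Schwarz. *)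
Lemma Hs_of_fourth_moment :
  (\int[mu]_y (`|W y| ^+ 4)%:E <= (64 * trace_norm ^+ 2)%:E)%E.
Proof.
pose g j (y : borel H) : R := b j * (gcoord j y ^+ 2 / lam j ^+ 2) ^+ 2.
have g0 j y : 0 <= g j y by rewrite mulr_ge0 ?sqr_ge0 // ltW.
have mg j : measurable_fun setT (g j).
  apply: measurable_funM => //; apply: measurable_funX.
  by apply: measurable_funM => //; apply: measurable_funX; exact: measurable_gcoord.
have tr0 : 0 <= trace_norm by apply: le_trans (b_le 0); rewrite /series /= big_geq.
have pointwise y : ((`|W y| ^+ 4)%:E <=
    trace_norm%:E * \sum_(j <oo) (g j y)%:E)%E.
  have S0 : (0 <= \sum_(j <oo) (g j y)%:E)%E.
    by apply: nneseries_ge0 => j _ _; rewrite lee_fin.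
  have [cy|ncy] := pselect (regular_set y); last first.
    by rewrite Hs_of_singular // normr0 expr0n /= mule_ge0 // lee_fin.
  have WE : `|W y| ^+ 2 = limn (series (gterm y)).
    by rewrite -Hs_ip_normE /ip_s Hs_of_regular.
  have part n : ((series (gterm y) n ^+ 2)%:E <=
      trace_norm%:E * \sum_(j <oo) (g j y)%:E)%E.
    have sE : series (gterm y) n = \sum_(0 <= j < n) b j * (gcoord j y ^+ 2 / lam j ^+ 2).
      apply: eq_bigr => j _; rewrite /gterm /ip_term /b; field.
      by rewrite gt_eqF.
    apply: le_trans (_ : (trace_norm * \sum_(0 <= j < n) g j y)%:E <= _)%E.
      rewrite lee_fin sE; apply: le_trans (sqr_sum_le _ _) _.
      by apply: ler_wpM2r; [apply: sumr_ge0 => j _; exact: g0|exact: b_le].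
    rewrite EFinM; apply: lee_wpmul2l; first by rewrite lee_fin.
    by rewrite -sumEFin; apply: nneseries_lim_ge => j _ _; rewrite lee_fin.
  (* An infinite right side is set aside, so that the limit can be taken among real numbers. *)
  have [->|fin] := eqVneq (trace_norm%:E * \sum_(j <oo) (g j y)%:E)%E +oo%E.
    exact: leey.
  have fnum : (trace_norm%:E * \sum_(j <oo) (g j y)%:E)%E \is a fin_num.
    by rewrite ge0_fin_numE ?ltey // mule_ge0 // lee_fin.
  rewrite -(fineK fnum) lee_fin (_ : _ ^+ 4 = limn (series (gterm y)) ^+ 2); last first.
    by rewrite -WE -exprM.
  have sqcvg : (fun n => series (gterm y) n ^+ 2) @ \oo -->
      limn (series (gterm y)) ^+ 2 by apply: cvgM.
  rewrite -(cvg_lim _ sqcvg) //; apply: limr_le; first exact: cvgP sqcvg.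
  by apply: nearW => n; rewrite -lee_fin fineK.
have mW j := measurable_Hs_of_coord j.
apply: (@le_trans _ _ (\int[mu]_y (trace_norm%:E * \sum_(j <oo) (g j y)%:E))%E).
  apply: ge0_le_integral => //.
  - apply/measurable_EFinP; apply: measurable_funX.
    rewrite (_ : (fun y => _) = fun y => `|W y - 0| : R).
      exact: measurable_Hs_dist.
    by apply/funext => y; rewrite subr0.
  - apply: emeasurable_funM => //; apply: ge0_emeasurable_sum => //.
      by move=> j y _ _; rewrite lee_fin.
    by move=> j _; apply/measurable_EFinP.
rewrite ge0_integralZl //; last 2 first.
- apply: ge0_emeasurable_sum => //.
    by move=> j y _ _; rewrite lee_fin.
  by move=> j _; apply/measurable_EFinP.
- by move=> y _; apply: nneseries_ge0 => j _ _; rewrite lee_fin.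
rewrite integral_nneseries //; last 2 first.
- by move=> j; apply/measurable_EFinP.
- by move=> j y _; rewrite lee_fin.
have gint j : (\int[mu]_y (g j y)%:E <= (64 * b j)%:E)%E.
  rewrite (eq_integral (fun y => (b j / lam j ^+ 4)%:E * (gcoord j y ^+ 4)%:E)%E).
    rewrite ge0_integralZl //.
    - apply: le_trans (lee_wpmul2l _ (gcoord_fourth_moment j)) _.
        by rewrite lee_fin divr_ge0 ?exprn_ge0 // ltW.
      rewrite -EFinM lee_fin; apply/eqW; field.
      by rewrite gt_eqF.
    - by apply/measurable_EFinP; apply: measurable_funX; exact: measurable_gcoord.
    - by move=> y _; rewrite lee_fin exprn_even_ge0.
    - by rewrite lee_fin divr_ge0 ?exprn_ge0 // ltW.
  move=> y _; rewrite -EFinM; congr (_%:E); rewrite /g; field.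
  by rewrite gt_eqF.
rewrite (_ : 64 * trace_norm ^+ 2 = trace_norm * (64 * trace_norm)); last by ring.
rewrite EFinM; apply: lee_wpmul2l; first by rewrite lee_fin.
apply: lime_le.
  by apply: is_cvg_nneseries => j _ _; apply: integral_ge0 => y _; rewrite lee_fin.
apply: nearW => n; apply: le_trans (lee_sum _ (fun j _ => gint j)) _.
by rewrite sumEFin lee_fin -mulr_sumr ler_wpM2l // b_le.
Qed.

End GaussianNorm.

(** * Metropolis thresholds *)

(* No measurability is needed: the integral of a nonnegative function is a
   supremum over the simple functions below it. *)
Lemma ge0_le_lower_integral d (T : measurableType d) (R : realType)
    (mu : {measure set T -> \bar R}) (f g : T -> \bar R) :
  (forall x, 0 <= f x)%E -> (forall x, f x <= g x)%E ->
  (\int[mu]_x f x <= \int[mu]_x g x)%E.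
Proof.
move=> f0 fg; have g0 x : (0 <= g x)%E by exact: le_trans (fg x).
rewrite !ge0_integralTE //; apply: ub_ereal_sup => _ [h hf <-].
apply: ereal_sup_ubound => /=.
by exists h => // x; exact: le_trans (hf x) (fg x).
Qed.

Section Metropolis.
Context {R : realType}.

Definition metropolis (t : R) : R := Num.min 1 (expR (- t)).

Lemma metropolis_ge0 t : 0 <= metropolis t.
Proof. by rewrite /metropolis le_min ler01 expR_ge0. Qed.

Lemma metropolis_le1 t : metropolis t <= 1.
Proof. by rewrite /metropolis ge_min lexx. Qed.

Lemma metropolis_rejection t : 1 - metropolis t <= `|t|.
Proof.
rewrite lerBlDl -lerBlDr /metropolis le_min; apply/andP; split.
  by rewrite gerBl.
apply: le_trans (expR_ge1Dx _); rewrite lerD2l lerN2; exact: ler_norm.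
Qed.

(** For s <= t, exp(- t) >= [metropolis s] (1 - (t - s)): this is 1 - (t - s) <= exp(- (t - s)), or
    a sign argument when t - s > 1. Since [metropolis s] <= 1, at most t - s is lost. *)
Lemma metropolis_lipschitz s t : `|metropolis s - metropolis t| <= `|s - t|.
Proof.
wlog st : s t / s <= t => [H|].
  by have [/H//|/ltW/H] := leP s t; rewrite distrC (distrC t).
have mono : metropolis t <= metropolis s.
  by rewrite /metropolis le_min !ge_min lexx /= ler_expR lerN2 st orbT.
rewrite ger0_norm ?subr_ge0 // distrC ger0_norm ?subr_ge0 //.
have key : metropolis s * (1 - (t - s)) <= expR (- t).
  have [ts|ts] := lerP (t - s) 1; last first.
    apply: le_trans (expR_ge0 _); rewrite mulr_ge0_le0 ?metropolis_ge0 //.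
    by rewrite subr_le0 ltW.
  have -> : - t = - s + - (t - s) by ring.
  rewrite expRD; apply: ler_pM; rewrite ?metropolis_ge0 ?subr_ge0 //.
    by rewrite /metropolis ge_min lexx orbT.
  exact: expR_ge1Dx.
have s1 := metropolis_le1 s; have s0 := metropolis_ge0 s.
rewrite lerBlDr -lerBlDl {2}/metropolis le_min; apply/andP; split.
  by rewrite lerBlDr (le_trans s1) // lerDl subr_ge0.
apply: le_trans key; rewrite mulrBr mulr1 lerD2l lerN2 ler_piMl //.
by rewrite subr_ge0.
Qed.

End Metropolis.

(** * Integrating out the uniform variable *)

Section UniformThreshold.
Context {R : realType} d (Omega : measurableType d) (P : probability Omega R).
Context d1 (T1 : measurableType d1) (X : {RV P >-> T1}) (U : {RV P >-> R}).
Hypothesis indep : independent_rv P X U.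
Hypothesis uniform : forall A : set R, measurable A ->
  distribution P U A = uniform_prob (@ltr01 R) A.
Local Open Scope ereal_scope.

(** Independence says that the joint law agrees with the product law on rectangles, hence
    everywhere; Tonelli then separates the variables. *)
Lemma independent_integral (F : T1 * R -> \bar R) :
  measurable_fun setT F -> (forall z, 0 <= F z) ->
  \int[P]_om F (X om, U om) =
  \int[distribution P X]_x \int[distribution P U]_u F (x, u).
Proof.
move=> mF F0.
have mZ : measurable_fun setT (fun om => (X om, U om)).
  by apply: measurable_fun_pair.
have mZ' : (fun om => (X om, U om)) \in mfun by exact/mem_set.
pose Z : {mfun Omega >-> (T1 * R)%type} := mfun_Sub mZ'.
transitivity (\int[distribution P Z]_z F z).
  by rewrite ge0_integral_pushforward.
transitivity (\int[(distribution P X \x distribution P U)]_z F z).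
  apply: eq_measure_integral => A mA _; apply/esym.
  exact: product_measure_unique.
exact: fubini_tonelli1.
Qed.

Lemma uniform_le (A : set R) (a b : R) : measurable A -> (a <= b)%R ->
  A `&` `[0%R, 1%R] `<=` `]a, b] -> distribution P U A <= (b - a)%:E.
Proof.
move=> mA ab Aab; rewrite uniform // /uniform_prob integral_uniform_pdf.
apply: (@le_trans _ _ (\int[lebesgue_measure]_(x in `]a, b]) (cst 1 x))).
  rewrite [X in _ <= X]integral_mkcond [X in X <= _]integral_mkcond.
  apply: ge0_le_lower_integral => x; rewrite !patchE.
    by case: ifP => // _; rewrite lee_fin uniform_pdf_ge0.
  case: ifPn => [/set_mem xA|_]; last by case: ifP => // _; rewrite lee_fin.
  rewrite ifT; last by apply/mem_set; exact: Aab.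
  rewrite lee_fin /uniform_pdf; case: ifP => // _.
  by rewrite subr0 invr1.
rewrite integral_cst //= mul1e lebesgue_measure_itv /= lte_fin.
by case: ifPn => // _; rewrite lee_fin subr_ge0.
Qed.

(** [a] and [b] stand for the smaller and the larger of two acceptance probabilities: U above a
    means at least one rejection, U between a and b exactly one. Given X these events have
    probability at most 1 - a and b - a. *)
Lemma uniform_threshold_integral (a b g : T1 -> R) (c0 c1 : R) :
  measurable_fun setT a -> measurable_fun setT b -> measurable_fun setT g ->
  (forall x, 0 <= a x /\ a x <= b x /\ b x <= 1)%R ->
  (0 <= c0)%R -> (0 <= c1)%R -> (forall x, 0 <= g x)%R ->
  \int[P]_om (c0 + c1 * (a (X om) < U om)%R%:R
    + g (X om) * (a (X om) < U om <= b (X om))%R%:R)%:E <=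
  \int[distribution P X]_x (c0 + c1 * (1 - a x) + g x * (b x - a x))%:E.
Proof.
move=> ma mb mg ab c00 c10 g0.
pose D1 := [set z : T1 * R | a z.1 < z.2]%R.
pose D2 := [set z : T1 * R | a z.1 < z.2 <= b z.1]%R.
have ma1 : measurable_fun setT (fun z : T1 * R => a z.1) by exact: measurableT_comp.
have mb1 : measurable_fun setT (fun z : T1 * R => b z.1) by exact: measurableT_comp.
have mg1 : measurable_fun setT (fun z : T1 * R => g z.1) by exact: measurableT_comp.
have m2 : measurable_fun setT (fun z : T1 * R => z.2) by exact: measurable_snd.
have mD1 : measurable_fun setT (fun z : T1 * R => (a z.1 < z.2)%R).
  exact: measurable_fun_ltr.
have mD2 : measurable_fun setT (fun z : T1 * R => (z.2 <= b z.1)%R).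
  exact: measurable_fun_ler.
have mnat (f : T1 * R -> bool) : measurable_fun setT f ->
    measurable_fun setT (fun z => (f z)%:R : R).
  move=> mf; rewrite (_ : (fun z => _) = fun z => if f z then 1%R else 0%R).
    exact: measurable_fun_ifT.
  by apply/funext => z; case: (f z).
pose F (z : T1 * R) : \bar R := (c0 + c1 * (a z.1 < z.2)%R%:R
  + g z.1 * (a z.1 < z.2 <= b z.1)%R%:R)%:E.
have mF : measurable_fun setT F.
  apply/measurable_EFinP; apply: measurable_funD.
    by apply: measurable_funD => //; apply: measurable_funM => //; exact: mnat.
  by apply: measurable_funM => //; apply: mnat; exact: measurable_and.
have F0 z : 0 <= F z by rewrite lee_fin addr_ge0 ?addr_ge0 ?mulr_ge0.
have -> : \int[P]_om (c0 + c1 * (a (X om) < U om)%R%:R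
    + g (X om) * (a (X om) < U om <= b (X om))%R%:R)%:E =
    \int[P]_om F (X om, U om) by [].
rewrite independent_integral //; apply: ge0_le_lower_integral => [x|x].
  by apply: integral_ge0 => u _.
have [a0 [abx b1]] := ab x.
pose E1 := [set u : R | a x < u]%R.
pose E2 := [set u : R | a x < u <= b x]%R.
have E1E : E1 = `]a x, +oo[%classic by apply/seteqP; split => u /=; rewrite in_itv /= andbT.
have E2E : E2 = `]a x, b x]%classic by apply/seteqP; split => u /=; rewrite in_itv.
have mE1 : measurable E1 by rewrite E1E.
have mE2 : measurable E2 by rewrite E2E.
have -> : \int[distribution P U]_u F (x, u) =
    \int[distribution P U]_u (c0%:E + c1%:E * (\1_E1 u)%:E + (g x)%:E * (\1_E2 u)%:E).
  apply: eq_integral => u _; rewrite /F /= !indicE -!EFinM -!EFinD.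
  congr ((_ + _ * _ + _ * _)%:E).
    by congr (nat_of_bool _)%:R; apply/idP/idP; [move=> ?; exact/mem_set|move/set_mem].
  by congr (nat_of_bool _)%:R; apply/idP/idP; [move=> ?; exact/mem_set|move/set_mem].
have mi (A : set R) (k : R) : measurable A ->
    measurable_fun [set: R] (fun u : R => k%:E * (\1_A u)%:E).
  by move=> mA; apply: emeasurable_funM => //; apply/measurable_EFinP; exact: measurable_indic.
have i0 (A : set R) (k : R) : (0 <= k)%R -> forall u : R, 0 <= k%:E * (\1_A u)%:E.
  by move=> k0 u; rewrite mule_ge0 // lee_fin.
rewrite ge0_integralD //; last 4 first.
- by move=> u _; rewrite adde_ge0 // i0.
- by apply: emeasurable_funD => //; exact: mi.
- by move=> u _; exact: i0.
- exact: mi.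
rewrite ge0_integralD //; last 2 first.
- by move=> u _; exact: i0.
- exact: mi.
rewrite integral_cst //= probability_setT mule1.
have Zl (A : set R) (k : R) : (0 <= k)%R -> measurable A ->
    \int[distribution P U]_u (k%:E * (\1_A u)%:E) = k%:E * distribution P U A.
  move=> k0 mA; rewrite ge0_integralZl //.
  - by rewrite integral_indic // setIT.
  - by apply/measurable_EFinP; exact: measurable_indic.
rewrite !Zl // !EFinD !EFinM; apply: leeD.
  apply: leeD => //; apply: lee_wpmul2l => //; apply: uniform_le => //.
    exact: le_trans b1.
  by move=> u [] /=; rewrite !in_itv /= => -> /andP[].
apply: lee_wpmul2l; first by rewrite lee_fin.
by apply: uniform_le => // u [].
Qed.

End UniformThreshold.

(** * Coupled transitions *)

(** Two rejections restore the distance |x - y|, which is what adding back the gain k |x - y| does.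
    A single rejection moves one chain only, at the additional price of one displacement B. *)
Lemma coupled_step_le {R : realType} {E : normedModType R} (x y x1 y1 : E)
    (ax ay u k B : R) : 0 <= B -> 0 <= k ->
  `|x1 - y1| <= (1 - k) * `|x - y| -> `|x1 - x| <= B -> `|y1 - y| <= B ->
  `|(if u <= ax then x1 else x) - (if u <= ay then y1 else y)| <=
  (1 - k) * `|x - y| + k * `|x - y| * (Num.min ax ay < u)%R%:R
  + B * (Num.min ax ay < u <= Num.max ax ay)%R%:R.
Proof.
move=> B0 k0 c1 xB yB.
set dl := `|x - y|; have dl0 : 0 <= dl by exact: normr_ge0.
have kd : 0 <= k * dl by exact: mulr_ge0.
have [uax|axu] := leP u ax; have [uay|ayu] := leP u ay.
- rewrite (le_trans c1) // -addrA lerDl addr_ge0 // mulr_ge0 //.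
- have -> : (Num.min ax ay < u) by rewrite gt_min ayu orbT.
  have -> : (u <= Num.max ax ay) by rewrite le_max uax.
  have -> : x1 - y = (x1 - x) + (x - y) by rewrite addrA subrK.
  rewrite (le_trans (ler_normD _ _)) // -/dl /= !mulr1; lra.
- have -> : (Num.min ax ay < u) by rewrite gt_min axu.
  have -> : (u <= Num.max ax ay) by rewrite le_max uay orbT.
  have -> : x - y1 = (x - y) - (y1 - y) by rewrite opprB addrA subrK.
  rewrite (le_trans (ler_normB _ _)) // -/dl /= !mulr1; lra.
- have -> : (Num.min ax ay < u) by rewrite gt_min axu.
  have -> : (u <= Num.max ax ay) = false by rewrite le_max !leNgt axu ayu.
  rewrite /= mulr1 mulr0 -/dl; lra.
Qed.

Lemma lipschitz_ball_continuous {R : realType} (V : normedModType R) (f : V -> R) :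
  (forall v, exists c, forall w, `|v - w| <= 1 -> `|f v - f w| <= c * `|v - w|) ->
  continuous f.
Proof.
move=> fL v; have [c fc] := fL v.
apply/cvgrPdist_le => /= e e0; pose k := `|c| + 1.
have k0 : 0 < k by rewrite ltr_wpDl.
near=> w; apply: le_trans (fc w _) _.
  by rewrite ltW //; near: w; exact: cvgr_dist_lt.
apply: le_trans (_ : k * `|v - w| <= _).
  by rewrite ler_wpM2r // (le_trans (ler_norm c)) // lerDl.
rewrite -ler_pdivlMl // mulrC; apply: ltW.
by near: w; apply: cvgr_dist_lt => //; rewrite divr_gt0.
Unshelve. all: by end_near. Qed.

Lemma quartic_le {R : realType} (a b : R) : 0 <= a -> 0 <= b ->
  (a + b) ^+ 4 <= 8 * (a ^+ 4 + b ^+ 4).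
Proof.
move=> a0 b0.
have s (x y : R) : (x + y) ^+ 2 <= 2 * (x ^+ 2 + y ^+ 2).
  have := sqr_ge0 (x - y); lra.
have -> : (a + b) ^+ 4 = ((a + b) ^+ 2) ^+ 2 by rewrite -exprM.
apply: le_trans (_ : (2 * (a ^+ 2 + b ^+ 2)) ^+ 2 <= _).
  by rewrite lerXn2r ?nnegrE ?sqr_ge0 ?mulr_ge0 ?addr_ge0 ?sqr_ge0.
have := s (a ^+ 2) (b ^+ 2); rewrite -!exprM exprMn; lra.
Qed.

(** Brings the fourth moment of 1 + r + |v| into the form (1 + r^2)^2 that matches the shape of the
    step size. *)
Lemma quartic_moment_le {R : realType} (r t : R) : 0 <= t ->
  8 * ((1 + r) ^+ 4 + 64 * t) <= 32 * (1 + 64 * t) * (1 + r ^+ 2) ^+ 2.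
Proof.
move=> t0.
have r4 : (1 + r) ^+ 4 <= 4 * (1 + r ^+ 2) ^+ 2.
  have -> : (1 + r) ^+ 4 = ((1 + r) ^+ 2) ^+ 2 by rewrite -exprM.
  have -> : 4 * (1 + r ^+ 2) ^+ 2 = (2 * (1 + r ^+ 2)) ^+ 2 by ring.
  rewrite lerXn2r ?nnegrE ?sqr_ge0 ?mulr_ge0 ?addr_ge0 ?sqr_ge0 //.
  by have := sqr_ge0 (1 - r); lra.
have r21 : 1 <= (1 + r ^+ 2) ^+ 2 by apply: exprn_ege1; rewrite lerDl sqr_ge0.
have := ler_wpM2l t0 r21.
by move: ((1 + r) ^+ 4) ((1 + r ^+ 2) ^+ 2) r4 r21 => p q *; lra.
Qed.

(** With u = T^(-1/2) and s = h (1 + r^2), the step size gives s Kc u <= 1, so (s Kc)^2 <= T because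
    u^2 T = 1. The constant Kc is at least 1 and at least 22 K2 / zeta, so Kc^2 dominates the latter
    too. *)
Lemma step_size_sqr_le {R : realType} (T r h zeta K2 : R) :
  0 < T -> 0 < zeta -> 0 <= K2 -> 0 <= h ->
  h <= ((1 + 22 * K2 / zeta) * ((1 + T `^ (- 2^-1)) * (1 + r ^+ 2)))^-1 ->
  K2 * (h * (1 + r ^+ 2)) ^+ 2 <= zeta / 22 * T.
Proof.
move=> T0 zeta0 K20 h0.
set u := T `^ _; have u0 : 0 <= u by exact: powR_ge0.
have uT : u ^+ 2 * T = 1.
  rewrite /u powRN exprVn powR12_sqrt ?(ltW T0) // sqr_sqrtr ?(ltW T0) //.
  by rewrite mulVf // gt_eqF.
set Kc := 1 + _.
have Kz0 : 0 <= 22 * K2 / zeta by rewrite divr_ge0 ?mulr_ge0 // ltW.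
have Kc1 : 1 <= Kc by rewrite lerDl.
have Kc0 : 0 < Kc by exact: lt_le_trans Kc1.
have r1 : 0 < 1 + r ^+ 2 by rewrite ltr_wpDr ?sqr_ge0.
rewrite -[X in h <= X]mul1r ler_pdivlMr; last first.
  by do 2 (apply: mulr_gt0 => //); rewrite ltr_wpDr.
set s := h * (1 + r ^+ 2) => hs.
have s0 : 0 <= s by apply: mulr_ge0 => //; exact: ltW.
have su1 : s * Kc * u <= 1.
  apply: le_trans hs.
  apply: le_trans (_ : s * Kc * (1 + u) <= _); last by apply/eqW; rewrite /s; ring.
  by rewrite ler_wpM2l ?lerDr // mulr_ge0 // ltW.
have sT : (s * Kc) ^+ 2 <= T.
  rewrite -[leLHS]mulr1 -uT mulrA -exprMn ler_piMl ?(ltW T0) //.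
  by rewrite expr_le1 // !mulr_ge0 // ltW.
have K2K : K2 <= zeta / 22 * Kc ^+ 2.
  have -> : K2 = zeta / 22 * (22 * K2 / zeta) by field; rewrite gt_eqF.
  apply: ler_wpM2l; first by rewrite divr_ge0 // ltW.
  apply: le_trans (_ : Kc <= _); first by rewrite lerDr.
  by rewrite expr2 ler_peMl // ltW.
apply: le_trans (ler_wpM2r (sqr_ge0 s) K2K) _.
rewrite -(mulrA (zeta / 22)) -exprMn [Kc * s]mulrC; apply: ler_wpM2l => //.
by rewrite divr_ge0 // ltW.
Qed.

Section AdjustedHMC.
Context {R : realType} {l : R}.
Variables (lam : nat -> R) (kappa : R).
Hypothesis lam0 : forall j, 0 < lam j.
Hypothesis decay : eigenvalue_decay lam kappa.
Hypothesis lkappa : 0 <= l < kappa - 2^-1.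
Variables (L L' zeta M N : R).
Hypotheses (L0 : 0 < L) (L'0 : 0 <= L') (zeta_bnd : 0 < zeta <= L + 1).

Lemma psi_contraction (DPhi : Hs l -> Hs (- l)) (h : R)
    (I : nat) (x y v : Hs l) :
  grad_bounds lam DPhi L L' -> strongly_monotone lam DPhi zeta ->
  0 < h -> (0 < I)%N -> (I%:R * h) ^+ 2 * (1 + L) <= zeta / (1 + L) ->
  `|(iter I (psi lam DPhi h) (x, v)).1 - (iter I (psi lam DPhi h) (y, v)).1| <=
  (1 - zeta * (I%:R * h) ^+ 2 / 12) * `|x - y|.
Proof.
move=> [_ GL _ _] mono h0 I0 Tsmall.
pose zx i := iter i (psi lam DPhi h) (x, v).
pose zy i := iter i (psi lam DPhi h) (y, v).
pose z i := (zx i).1 - (zy i).1; pose p i := (zx i).2 - (zy i).2.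
pose g i := C_grad lam DPhi (zx i).1 - C_grad lam DPhi (zy i).1.
have := @leap_contraction R (Hs l) (fun a b : Hs l => ip_s l a b)
  (@ip_sDl _ _) (@ip_sZl _ _) (@ip_sC _ _) (@Hs_ip_normE _ _) h L zeta z p g
  h0 L0 zeta_bnd.
apply => //.
- by rewrite /p /= subrr.
- move=> i; rewrite /z /p /g /zx /zy !iterS /psi /=.
  rewrite !scalerBr !opprD !opprK [LHS]addrACA; congr (_ + _).
  exact: addrACA.
- move=> i; rewrite /z /p /g /zx /zy !iterS.
  move: (iter i _ (x, v)) (iter i _ (y, v)) => [q w] [q' w'].
  rewrite /psi /=; move: (C_grad _ _ (cos h *: q + _ - _)) (C_grad _ _ (cos h *: q' + _ - _)).
  move: (C_grad lam DPhi q) (C_grad lam DPhi q') => G1 G2 G3 G4.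
  rewrite !scalerBr !opprD !opprK [LHS]addrACA; congr (_ + _).
  rewrite [LHS]addrACA; congr (_ + _); exact: addrACA.
- by move=> i; exact: GL.
- by move=> i; exact: mono.
Qed.

(** Supplies the measurability of the acceptance probability in the velocity; the Lipschitz bound of
    the energy error is uniform only on bounded sets. *)
Lemma energy_error_continuous (Phi : Hs l -> R) (DPhi : Hs l -> Hs (- l))
    (h : R) (I : nat) (x : Hs l) :
  is_gradient Phi DPhi -> grad_bounds lam DPhi L L' ->
  higher_bounds lam Phi DPhi M N ->
  0 < h -> (0 < I)%N -> I%:R * h <= 1 ->
  continuous (DeltaH lam Phi DPhi h I x).
Proof.
move=> grad gradB highB h0 I0 Ih.
have [K K0 EB] := energy_error_bound lam0 decay lkappa M N L0 L'0.
apply: lipschitz_ball_continuous => v.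
(* The 2 is the 1 added to every size plus the radius of the unit ball around v. *)
exists (K * (h ^+ 2 * (`|x| + `|v| + 2) ^+ 3)) => w vw.
have sv : psize (x, v) + 1 <= `|x| + `|v| + 2 by rewrite /psize /=; lra.
have sw : psize (x, w) + 1 <= `|x| + `|v| + 2.
  rewrite /psize /=; have : `|w| <= `|v| + `|v - w|.
    by rewrite -{1}(subrK v w) addrC (le_trans (ler_normD _ _)) // lerD2l distrC.
  lra.
have [_] := EB Phi DPhi grad gradB highB h _ I _ _ h0 I0 Ih sv sw.
by rewrite (_ : psize _ = `|v - w|) ?mulrA // /psize /= subrr normr0 add0r.
Qed.

Let Kg := growth_rate L L' * expR (growth_rate L L').
(* h^2 A^4 is the size of the energy error's Lipschitz constant (h^2 A^3) times
   the displacement of a proposal (T A), per unit of time. *)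
Lemma threshold_bound (K T h A dl k a b B : R) :
  0 < K -> 0 < T <= 1 -> 0 <= dl -> 1 <= A ->
  0 <= k <= T * (1 + L) ->
  1 - a <= 2 * (K * (h ^+ 2 * A ^+ 3)) ->
  0 <= b - a <= K * (h ^+ 2 * A ^+ 3 * dl) ->
  0 <= B <= T * (Kg * A) ->
  (1 - k) * dl + k * dl * (1 - a) + B * (b - a) <=
  (1 - k) * dl + dl * (T * (2 * (1 + L) * K + Kg * K) * h ^+ 2) * A ^+ 4.
Proof.
move=> K0 /andP[T0 T1] dl0 A1 /andP[k0 kT] a1 /andP[ba0 ba] /andP[B0 BT].
have A0 : 0 <= A by exact: le_trans A1.
have h20 : 0 <= h ^+ 2 by exact: sqr_ge0.
have A30 : 0 <= A ^+ 3 by exact: exprn_ge0.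
have A34 : A ^+ 3 <= A ^+ 4 by rewrite [leRHS]exprS ler_peMl.
have K0' := ltW K0; have T0' := ltW T0.
have L10 : 0 <= 1 + L by rewrite addr_ge0 // ltW.
have B1 : k * dl * (1 - a) <=
    dl * (T * (2 * (1 + L) * K) * h ^+ 2) * A ^+ 4.
  apply: le_trans (_ : T * (1 + L) * dl * (2 * (K * (h ^+ 2 * A ^+ 4))) <= _).
    apply: le_trans (_ : k * dl * (2 * (K * (h ^+ 2 * A ^+ 4))) <= _).
      rewrite ler_wpM2l ?mulr_ge0 //; apply: le_trans a1 _.
      by do 3 (rewrite ler_wpM2l //).
    apply: ler_wpM2r; last exact: ler_wpM2r.
    have A40 : 0 <= A ^+ 4 by exact: exprn_ge0.
    by do 3 (apply: mulr_ge0 => //).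
  by apply/eqW; ring.
have B2 : B * (b - a) <= dl * (T * (Kg * K) * h ^+ 2) * A ^+ 4.
  apply: le_trans (ler_pM B0 ba0 BT ba) _; apply/eqW; ring.
rewrite -addrA lerD2l; apply: le_trans (lerD B1 B2) _; apply/eqW; ring.
Qed.

End AdjustedHMC.

Theorem theorem3p2 (R : realType) (H : completeNormedModType R)
  (ip : H -> H -> R) (hip : is_inner_product ip)
  (phi : nat -> H) (hphi : orthonormal_basis ip phi)
  (C : {linear H -> H}) (hC : continuous C)
  (lam : nat -> R) (hlam : forall j, 0 < lam j)
  (hCphi : forall j, C (phi j) = lam j ^+ 2 *: phi j)
  (kappa : R) (hS1 : eigenvalue_decay lam kappa)
  (l : R) (hl : 0 <= l < kappa - 2^-1)
  (L L' zeta M N : R) (hL : 0 < L) (hL' : 0 <= L')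
  (hzeta : 0 < zeta <= L + 1) :
  exists h0 : R -> R -> R,
    (exists2 K : R, 0 < K & forall T r : R, 0 < T ->
       0 < h0 T r /\
       (h0 T r)^-1 <= K * ((1 + T `^ (- 2^-1)) * (1 + r ^+ 2))) /\
    (forall (Phi : Hs l -> R) (DPhi : Hs l -> Hs (- l)),
      potential_regular Phi DPhi ->
      potential_lower_bound Phi ->
      grad_bounds lam DPhi L L' ->
      strongly_monotone lam DPhi zeta ->
      higher_bounds lam Phi DPhi M N ->
      forall T h1 : R, 0 < T -> 0 < h1 ->
      T ^+ 2 + L * (T ^+ 2 + 2 * h1 * T) <= zeta / (1 + L) ->
      forall (d : measure_display) (Omega : measurableType d)
        (P : probability Omega R)
        (v : {RV P >-> borel H}) (U : {RV P >-> R}),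
      gaussian_measure ip C (distribution P v) ->
      (forall A : set R, measurable A ->
        distribution P U A = uniform_prob (@ltr01 R) A) ->
      independent_rv P v U ->
      let w := fun om => Hs_of ip phi l (v om) in
      forall r : R,
      (P [set om | (r < `|w om|)%R] <= (zeta / (2000 * (L + 1)))%:E)%E ->
      forall (h : R) (I : nat),
      0 < h -> h <= Num.min (h0 T r) h1 -> T / h = I%:R ->
      forall x y : Hs l, Num.max `|x| `|y| <= r ->
      ('E_P[fun om => (`|next_pos lam Phi DPhi h I x (w om) (U om)
                         - next_pos lam Phi DPhi h I y (w om) (U om)|)%R]
       <= ((1 - 27^-1 * zeta * T ^+ 2) * `|x - y|)%:E)%E).
Proof.
have [K K0 EB] := energy_error_bound hlam hS1 hl M N hL hL'.
have /andP[zeta0 zetaL] := hzeta.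
pose Kg := growth_rate L L' * expR (growth_rate L L').
have Kg0 : 0 <= Kg by rewrite mulr_ge0 ?expR_ge0 ?sqr_ge0.
pose tr := trace_norm lam l.
(* In [K1] the first summand prices rejections that lose the contraction, the second single
   rejections. [K2] adds the factor from the fourth moment, and [Kc] is what [step_size_sqr_le] asks
   for. *)
pose K1 := 2 * (1 + L) * K + Kg * K.
pose K2 := 32 * K1 * (1 + 64 * tr ^+ 2).
pose Kc := 1 + 22 * K2 / zeta.
have L10 : 0 < 1 + L by rewrite addr_gt0.
have K0' := ltW K0.
have K10 : 0 < K1.
  apply: ltr_wpDr; first exact: mulr_ge0.
  by rewrite mulr_gt0 // mulr_gt0.
have K20 : 0 < K2.
  apply: mulr_gt0; first exact: mulr_gt0.
  by apply: ltr_wpDr => //; rewrite mulr_ge0 ?sqr_ge0.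
have Kc1 : 1 <= Kc.
  by rewrite lerDl; apply: divr_ge0; [rewrite mulr_ge0 // ltW|exact: ltW].
have Kc0 : 0 < Kc by exact: lt_le_trans Kc1.
pose h0 (T r : R) := (Kc * ((1 + T `^ (- 2^-1)) * (1 + r ^+ 2)))^-1.
have g0 (T r : R) : 0 < (1 + T `^ (- 2^-1)) * (1 + r ^+ 2).
  by rewrite mulr_gt0 // ltr_wpDr ?powR_ge0 ?sqr_ge0.
exists h0; split.
  exists Kc => // T r T0; split; first by rewrite invr_gt0 mulr_gt0.
  by rewrite invrK.
move=> Phi DPhi [_ grad _] _ gradB mono highB T h1 T0 h10 Tbound.
move=> d Omega P v U gauss unif indep w r _ h I h_gt0 h_le TI x y xyr.
have h_h0 : h <= h0 T r by move: h_le; rewrite le_min => /andP[].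
have xr : `|x| <= r by move: xyr; rewrite ge_max => /andP[].
have yr : `|y| <= r by move: xyr; rewrite ge_max => /andP[].
have r0 : 0 <= r by exact: le_trans xr.
have Ih : I%:R * h = T by rewrite -TI divfK // gt_eqF.
have I0 : (0 < I)%N.
  by rewrite lt0n; apply/eqP => I0; move: Ih T0; rewrite I0 mul0r => <-; rewrite ltxx.
have Tsmall : T ^+ 2 * (1 + L) <= zeta / (1 + L).
  apply: le_trans Tbound.
  have : 0 <= L * (2 * h1 * T) by rewrite !mulr_ge0 // ltW.
  lra.
have T21 : T ^+ 2 * (1 + L) <= 1.
  by apply: le_trans Tsmall _; rewrite ler_pdivrMr // mul1r addrC.
have T1 : T <= 1.
  have T2 : T ^+ 2 <= 1.
    by apply: le_trans T21; rewrite ler_peMr ?sqr_ge0 // lerDl ltW.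
  by rewrite -(@expr_le1 _ 2) // ltW.
have Ih1 : I%:R * h <= 1 by rewrite Ih.
pose W : borel H -> Hs l := Hs_of ip phi l.
pose dH z (y : borel H) := DeltaH lam Phi DPhi h I z (W y).
pose al z (y : borel H) := metropolis (dH z y).
have mW j : measurable_fun setT (fun y' : borel H => W y' j).
  exact: measurable_Hs_of_coord.
have mdH z : measurable_fun setT (dH z).
  apply: (measurable_Hs_continuous mW).
  exact: (energy_error_continuous hlam hS1 hl hL hL' grad gradB highB).
have mal z : measurable_fun setT (al z).
  apply: measurable_minr => //; apply: measurableT_comp => //.
  exact: measurable_funN.
(* Up to [a] both chains accept, above [b] both reject, and in between exactly one does. *)
pose a (y' : borel H) := Num.min (al x y') (al y y').
pose b (y' : borel H) := Num.max (al x y') (al y y').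
pose A (y' : borel H) := 1 + r + `|W y'|.
have A1 y' : 1 <= A y' by rewrite /A -addrA lerDl addr_ge0.
pose B (y' : borel H) := T * (Kg * A y').
have B0 y' : 0 <= B y'.
  by rewrite /B mulr_ge0 ?(ltW T0) // mulr_ge0 // (le_trans _ (A1 y')).
have mnW : measurable_fun setT (fun y' => `|W y'| : R).
  rewrite (_ : (fun y' => _) = fun y' => `|W y' - 0| : R).
    exact: measurable_Hs_dist.
  by apply/funext => y'; rewrite subr0.
have mB : measurable_fun setT B.
  by apply: measurable_funM => //; apply: measurable_funM => //; exact: measurable_funD.
pose dl := `|x - y|; have dl0 : 0 <= dl by exact: normr_ge0.
pose k := zeta * T ^+ 2 / 12.
have zT : zeta * T ^+ 2 <= 1.
  apply: le_trans T21; rewrite mulrC ler_wpM2l ?sqr_ge0 // addrC //.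
have k0 : 0 <= k by rewrite divr_ge0 // mulr_ge0 ?sqr_ge0 // ltW.
have k1 : k <= 1 by rewrite /k; lra.
(* Since T <= 1, one of the two factors T of the gain can be given up; the remaining one is the
   factor T required of the losses. *)
have kT : k <= T * (1 + L).
  apply: le_trans (_ : zeta * T ^+ 2 <= _).
    by have := k0; rewrite /k; lra.
  rewrite expr2 mulrA [leRHS]mulrC; apply: ler_pM => //.
  - by rewrite mulr_ge0 // ltW.
  - exact: ltW.
  - by rewrite -[leRHS]mulr1 [1 + L]addrC; apply: ler_pM => //; exact: ltW.
have sz z y' : `|z| <= r -> psize (z, W y') + 1 <= A y'.
  by move=> zr; rewrite /psize /A /=; lra.
have err y' : [/\ `|dH x y'| <= K * (h ^+ 2 * A y' ^+ 3),
    `|dH y y'| <= K * (h ^+ 2 * A y' ^+ 3) &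
    `|dH x y' - dH y y'| <= K * (h ^+ 2 * A y' ^+ 3 * dl)].
  have [E1 E2] := EB Phi DPhi grad gradB highB h (A y') I _ _ h_gt0 I0 Ih1
    (sz x y' xr) (sz y y' yr).
  have [E3 _] := EB Phi DPhi grad gradB highB h (A y') I _ _ h_gt0 I0 Ih1
    (sz y y' yr) (sz y y' yr).
  split=> //; apply: le_trans E2 _; apply/eqW.
  by congr (_ * (_ * _)); rewrite /psize /= subrr normr0 addr0.
have a01 y' : 0 <= a y' /\ a y' <= b y' /\ b y' <= 1.
  rewrite /a /b le_min !metropolis_ge0 ge_max !metropolis_le1; split => //.
  by split => //; rewrite ge_min !le_max lexx.
have disp z y' : `|z| <= r ->
    `|(iter I (psi lam DPhi h) (z, W y')).1 - z| <= B y'.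
  move=> zr; have [_ _ _ GB] := gradB.
  have h01 : 0 <= h <= 1.
    by rewrite (ltW h_gt0) /= (le_trans _ Ih1) // ler_peMl ?ler1n // ltW.
  have := iter_leap_dist hL hL' GB h01 (z, W y') Ih1; rewrite Ih => D.
  apply: le_trans (le_psize1 _) (le_trans D _).
  rewrite ler_wpM2l ?(ltW T0) // ler_wpM2l //; exact: sz.
have step y' u : `|next_pos lam Phi DPhi h I x (W y') u
      - next_pos lam Phi DPhi h I y (W y') u| <=
    (1 - k) * dl + k * dl * (a y' < u)%R%:R + B y' * (a y' < u <= b y')%R%:R.
  apply: coupled_step_le => //; [|exact: disp|exact: disp].
  have := psi_contraction hL hzeta x y (W y') gradB mono h_gt0 I0.
  by rewrite Ih; apply.
rewrite unlock.
apply: (@le_trans _ _ (\int[P]_om ((1 - k) * dl + k * dl * (a (v om) < U om)%R%:R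
    + B (v om) * (a (v om) < U om <= b (v om))%R%:R)%:E)%E).
  by apply: ge0_le_lower_integral => om; rewrite lee_fin //; exact: step.
apply: le_trans (uniform_threshold_integral indep unif _ _ mB a01 _ _ B0) _.
- exact: measurable_minr.
- exact: measurable_maxr.
- by rewrite mulr_ge0 // subr_ge0.
- exact: mulr_ge0.
pose c := dl * (T * K1 * h ^+ 2).
have c0 : 0 <= c.
  by do ?(apply: mulr_ge0 => //); rewrite ?sqr_ge0 // ltW.
(* The part independent of the velocity after A^4 <= 8 ((1 + r)^4 + |W|^4). *)
pose cc := (1 - k) * dl + 8 * c * (1 + r) ^+ 4.
have cc0 : 0 <= cc.
  apply: addr_ge0; first by rewrite mulr_ge0 // subr_ge0.
  by rewrite mulr_ge0 ?exprn_ge0 ?addr_ge0 // mulr_ge0.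
apply: (@le_trans _ _ (\int[distribution P v]_y' (cc%:E
    + (8 * c)%:E * (`|W y'| ^+ 4)%:E))%E).
  apply: ge0_le_lower_integral => y'.
    have [a0 [ab b1]] := a01 y'.
    have a1 := le_trans ab b1.
    rewrite lee_fin; apply: addr_ge0; last by apply: mulr_ge0; rewrite ?subr_ge0.
    apply: addr_ge0; first by apply: mulr_ge0; rewrite ?subr_ge0.
    by apply: mulr_ge0; [exact: mulr_ge0|rewrite subr_ge0].
  rewrite -EFinM -EFinD lee_fin.
  have [e1 e2 e3] := err y'; have [a0 [ab b1]] := a01 y'.
  apply: le_trans (@threshold_bound _ L L' hL K T h (A y') dl k (a y') (b y')
    (B y') K0 _ dl0 (A1 y') _ _ _ _) _.
  - by rewrite T0.
  - by rewrite k0.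
  - have r1 := le_trans (metropolis_rejection (dH x y')) e1.
    have r2 := le_trans (metropolis_rejection (dH y y')) e2.
    have p0 : 0 <= K * (h ^+ 2 * A y' ^+ 3) by exact: le_trans e1.
        rewrite -/(al x y') in r1; rewrite -/(al y y') in r2; rewrite lerBlDl -lerBlDr.
    by rewrite /a le_min; apply/andP; split; rewrite lerBlDr; [move: r1|move: r2];
      rewrite lerBlDl => /le_trans; apply; rewrite lerD2l ler_peMl // ler1n.
  - rewrite subr_ge0 ab /=; apply: le_trans e3.
    apply: le_trans (metropolis_lipschitz _ _); rewrite -/(al x y') -/(al y y').
    by rewrite /a /b; have [le1|le1] := leP (al x y') (al y y'); [rewrite distrC|]; exact: ler_norm.
  - by rewrite B0 /=.
  rewrite -/Kg -/K1 -/c /cc -addrA lerD2l.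
  rewrite [leRHS](_ : _ = c * (8 * ((1 + r) ^+ 4 + `|W y'| ^+ 4))); last by ring.
  by rewrite ler_wpM2l // quartic_le // addr_ge0.
rewrite ge0_integralD //; last 2 first.
- move=> y' _; apply: mule_ge0; rewrite lee_fin; first exact: mulr_ge0.
  exact: exprn_ge0.
- apply: emeasurable_funM => //; apply/measurable_EFinP; exact: measurable_funX.
rewrite integral_cst //= probability_setT mule1 ge0_integralZl //; last 2 first.
- by apply/measurable_EFinP; exact: measurable_funX.
- by rewrite lee_fin mulr_ge0.
have mom := Hs_of_fourth_moment hip hphi hlam hCphi hS1 hl gauss.
apply: le_trans (leeD (lexx _) (lee_wpmul2l _ mom)) _.
  by rewrite lee_fin mulr_ge0.
rewrite -EFinM -EFinD lee_fin -/dl -/tr.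
have hT := step_size_sqr_le T0 zeta0 (ltW K20) (ltW h_gt0) h_h0.
have cost : 8 * c * ((1 + r) ^+ 4 + 64 * tr ^+ 2) <= dl * T * (zeta / 22 * T).
  apply: le_trans (_ : c * (32 * (1 + 64 * tr ^+ 2) * (1 + r ^+ 2) ^+ 2) <= _).
    apply: le_trans (_ : c * (8 * ((1 + r) ^+ 4 + 64 * tr ^+ 2)) <= _).
      by apply/eqW; ring.
    by apply: ler_wpM2l => //; exact: quartic_moment_le (sqr_ge0 tr).
  apply: le_trans (_ : dl * T * (K2 * (h * (1 + r ^+ 2)) ^+ 2) <= _).
    by apply/eqW; rewrite /c /K2; ring.
  by apply: ler_wpM2l => //; exact: (mulr_ge0 dl0 (ltW T0)).
have dT : 0 <= dl * zeta * T ^+ 2.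
  by apply: mulr_ge0; [apply: mulr_ge0 => //; exact: ltW|exact: sqr_ge0].
apply: le_trans (_ : (1 - k) * dl + dl * T * (zeta / 22 * T) <= _).
  rewrite /cc -addrA lerD2l -mulrDr //.
(* 1/12 - 1/27 = 5/108 and 22 is the least integer above 108/5; the margin left is 1/1188. *)
rewrite -subr_ge0 (_ : _ - _ = (1/12 - 1/27 - 1/22) * (dl * zeta * T ^+ 2)).
  by apply: mulr_ge0 => //; lra.
by rewrite /k; field.
Qed.
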